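(* Let $g\colon[0,T]\times\mathbb{R}\times\mathbb{R}^d\to\mathbb{R}$ be measurable with $\int_0^T|g(t,0,0)|^2dt<\infty$ and such that for some constant $[g]_L>0$, for $dt$-a.e. $t$, $|g(t,y_1,z_1)-g(t,y_2,z_2)|\le[g]_L(|y_1-y_2|+|z_1-z_2|)$ for all $(y_1,z_1),(y_2,z_2)$. Let $\pi=\{0=t_0<\dots<t_n=T\}$ be a partition of $[0,T]$ with $|\pi|<[g]_L^{-1}$, and let $K\subset L^2(\mathcal{F}_T)$ be a compact subset. Then, for all $\epsilon>0$ there exist $p^\epsilon,M^\epsilon\in\mathbb{N}$ such that for all $p\ge p^\epsilon$ and $M\ge M^\epsilon$, $$\max_{0\le i\le n}\mathbb{E}\big|\mathscr{Y}_i^\pi(X_{t_i},\xi)-\mathscr{Y}_i^{\pi,p,M}(X_{t_i},\xi)\big|^2+\sum_{i=0}^{n-1}\mathbb{E}\Big[\int_{t_i}^{t_{i+1}}\big|\mathscr{Z}_i^\pi(X_{t_i},\xi)-\mathscr{Z}_i^{\pi,p,M}(X_{t_i},\xi)\big|^2dt\Big]\le\epsilon$$ for all $\xi\in K$.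
   Context: $T>0$; $B$ is a standard $d$-dimensional Brownian motion on $[0,T]$ on a complete probability space $(\Omega,\mathcal{F},\mathbb{P})$; $(\mathcal{F}_t)_{t\in[0,T]}$ is its natural augmented filtration; $\mathbb{E}_t[\cdot]=\mathbb{E}[\cdot\mid\mathcal{F}_t]$; $L^2(\mathcal{F}_T)$ is the space of real square-integrable $\mathcal{F}_T$-measurable random variables with its norm topology. Scheme: with $\Delta t_i=t_{i+1}-t_i$, $\Delta B_i=B_{t_{i+1}}-B_{t_i}$, $|\pi|=\max_i\Delta t_i$, set $\mathcal{Y}_n^\pi(\xi)=\xi$, $\mathcal{Z}_n^\pi(\xi)=0$ and, for $i=n-1,\dots,0$, $$\mathcal{Z}_i^\pi(\xi)=\frac1{\Delta t_i}\mathbb{E}_{t_i}\big[\mathcal{Y}_{i+1}^\pi(\xi)\Delta B_i\big],\qquad\mathcal{Y}_i^\pi(\xi)=\mathbb{E}_{t_i}\big[\mathcal{Y}_{i+1}^\pi(\xi)\big]+\Delta t_i\,g(t_i,\mathcal{Y}_i^\pi(\xi),\mathcal{Z}_i^\pi(\xi)),$$ the second equation being implicit; the scheme is well defined when $|\pi|<[g]_L^{-1}$. Chaos: $H_0(x)=1$, $H_n(x)=\frac{(-1)^n}{n!}e^{x^2/2}\frac{d^n}{dx^n}(e^{-x^2/2})$ for $n\ge1$. $\mathcal{A}$ is the set of all sequences $a=(a_1,a_2,\dots)$ of non-negative integers with finitely many nonzero terms, $|a|=\sum_ia_i$, $a!=\prod_ia_i!$; $(h_i)_{i\ge1}$ is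 an orthonormal basis of $L^2([0,T];\mathbb{R}^d)$; $X$ is the $\mathbb{R}^{\mathcal{A}}$-valued process $X_t^a=\prod_{i\ge1}H_{a_i}\big(\int_0^th_i(s)\cdot dB_s\big)$. Every $\xi\in L^2(\mathcal{F}_T)$ has the Wiener chaos decomposition $\xi=\sum_{k\ge0}\sum_{|a|=k}d_aX_T^a$ with $d_a=a!\,\mathbb{E}[\xi X_T^a]$, and $\Pi_{p,M}(\xi)=\sum d_aX_T^a$, the sum being over $a\in\mathcal{A}$ with $|a|\le p$ and $a_k=0$ for all $k>M$. $\mathscr{Y}_i^\pi\colon\mathbb{R}^{\mathcal{A}}\times L^2(\mathcal{F}_T)\to\mathbb{R}$ and $\mathscr{Z}_i^\pi\colon\mathbb{R}^{\mathcal{A}}\times L^2(\mathcal{F}_T)\to\mathbb{R}^d$ are measurable maps (which exist) such that $\mathcal{Y}_i^\pi(\xi)=\mathscr{Y}_i^\pi(X_{t_i},\xi)$ and $\mathcal{Z}_i^\pi(\xi)=\mathscr{Z}_i^\pi(X_{t_i},\xi)$ $\mathbb{P}$-a.s. for all $\xi\in L^2(\mathcal{F}_T)$. Their finite-dimensional approximations are $\mathscr{Y}_i^{\pi,p,M}(x,\xi):=\mathscr{Y}_i^\pi(x,\Pi_{p,M}(\xi))$ and $\mathscr{Z}_i^{\pi,p,M}(x,\xi):=\mathscr{Z}_i^\pi(x,\Pi_{p,M}(\xi))$.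
   Formalization: The Lipschitz condition on g is assumed also at the partition points t_0,…,t_{n-1}, not only for a.e. t; without it the claim fails, e.g. for g(0,y,z)=1_{z>0} and g=0 otherwise, where Y_0 is discontinuous in ξ. *)

(* Defs.v *)
From HB Require Import structures.
From mathcomp Require Import all_boot all_order all_algebra.
From mathcomp Require Import finmap.
From mathcomp Require Import all_classical all_reals all_analysis.

Set Implicit Arguments.
Unset Strict Implicit.
Unset Printing Implicit Defensive.
Import Order.TTheory GRing.Theory Num.Theory.
Import numFieldNormedType.Exports.
Local Open Scope classical_set_scope.
Local Open Scope ring_scope.

(* The library's norm on row vectors is the sup norm; |z| here is Euclidean. *)
Definition dotp (R : realType) (m : nat) (x y : 'rV[R]_m) : R :=
  \sum_(k < m) x ord0 k * y ord0 k.

Definition enorm (R : realType) (m : nat) (x : 'rV[R]_m) : R :=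
  Num.sqrt (dotp x x).

Notation borel X := (g_sigma_algebraType (@open X)).

(* Elements of L2space P are representatives (measurable functions with finite
   L^2 norm), topologized by the L^2 pseudo-distance: two representatives are
   at distance 0 iff they are a.s. equal.  A Borel set is then saturated for
   a.s. equality, so that a real-valued Borel function on L2space P is a
   function of the class. *)
Section L2space.
Context d (W : measurableType d) (R : realType) (P : probability W R).

Definition L2space : Type := LfunType P (lee1n 2).

Definition L2fun (f : L2space) : W -> R := (f : LfunType P (lee1n 2)).

HB.instance Definition _ := Choice.on L2space.
HB.instance Definition _ := GRing.Lmodule.on L2space.
HB.instance Definition _ := isPointed.Build L2space 0.

Definition L2norm (f : L2space) : R :=
  fine ('N[P]_(2%:R%:E)[EFin \o L2fun f]).

Definition L2ball (f : L2space) (e : R) : set L2space :=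
  [set g | L2norm (f - g) < e].

Let L2norm0 : L2norm 0 = 0.
Proof.
rewrite /L2norm (_ : _ \o _ = cst 0%E); last exact/funext.
by rewrite Lnorm0.
Qed.

Let L2normN f : L2norm (- f) = L2norm f.
Proof. exact: LnormrN. Qed.

Let L2normD f g : L2norm (f + g) <= L2norm f + L2norm g.
Proof. exact: ler_LnormD. Qed.

Let L2ball_center f e : 0 < e -> L2ball f e f.
Proof. by move=> e0; rewrite /L2ball /= subrr L2norm0. Qed.

Let L2ball_sym f g e : L2ball f e g -> L2ball g e f.
Proof. by rewrite /L2ball /= -[g - f]opprB L2normN. Qed.

Let L2ball_triangle f g h e1 e2 :
  L2ball f e1 g -> L2ball g e2 h -> L2ball f (e1 + e2) h.
Proof.
rewrite /L2ball /= => fg gh; rewrite -(subrKA g).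
by apply: (le_lt_trans (L2normD _ _)); exact: ltrD.
Qed.

HB.instance Definition _ :=
  hasNbhs.Build L2space (nbhs_ (entourage_ L2ball)).
HB.instance Definition _ := @Nbhs_isPseudoMetric.Build R L2space
  (entourage_ L2ball) erefl L2ball L2ball_center L2ball_sym L2ball_triangle
  erefl.

(* Square-integrable functions are sent to themselves, all others to 0. *)
Definition toL2 (f : W -> R) : L2space := insubd (0 : LfunType P (lee1n 2)) f.

End L2space.

Coercion L2fun : L2space >-> Funclass.

Section sub_sigma_algebra.
Context d (W : measurableType d) (R : realType) (P : probability W R).

Definition measurable_wrt (G : set (set W)) (f : W -> R) : Prop :=
  forall D : set R, measurable D -> G (f @^-1` D).

(* Y is a version of E[X | G]. *)
Definition is_condexp (G : set (set W)) (X Y : W -> R) : Prop :=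
  [/\ P.-integrable setT (EFin \o X),
      P.-integrable setT (EFin \o Y),
      measurable_wrt G Y &
      forall A, G A -> (\int[P]_(w in A) (Y w)%:E = \int[P]_(w in A) (X w)%:E)%E].

Definition L2sub (G : set (set W)) : set (L2space P) :=
  [set f | measurable_wrt G f].

End sub_sigma_algebra.

Section brownian.
Context d (W : measurableType d) (R : realType) (P : probability W R).
Context (m : nat) (B : R -> W -> 'rV[R]_m).

Definition brownian_motion (T : R) : Prop :=
  [/\ forall t k, 0 <= t <= T -> measurable_fun setT (fun w => B t w ord0 k),
      {ae P, forall w, B 0 w = 0},
      (forall s t k (D : set R), 0 <= s -> s < t -> t <= T -> measurable D ->
         P [set w | D (B t w ord0 k - B s w ord0 k)] =
         normal_prob 0 (Num.sqrt (t - s)) D),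
      (* joint independence over disjoint increments and coordinates *)
      (forall (N : nat) (s : nat -> R) (D : 'I_N -> 'I_m -> set R),
         0 <= s 0%N -> s N <= T ->
         (forall j, (j < N)%N -> s j <= s j.+1) ->
         (forall j k, measurable (D j k)) ->
         P [set w | forall j k, D j k (B (s j.+1) w ord0 k - B (s j) w ord0 k)] =
         (\prod_(j < N) \prod_(k < m)
            P [set w | D j k (B (s j.+1) w ord0 k - B (s j) w ord0 k)%R])%E) &
      {ae P, forall w, {within `[0, T], continuous (B ^~ w)}}].

Definition filtration (t : R) : set (set W) :=
  <<s [set A | exists s k (D : set R),
        [/\ 0 <= s <= t, measurable D & A = [set w | D (B s w ord0 k)]]]
      `|` P.-negligible >>.

(* A step integrand sum_q 1_]a_q, b_q] v_q is coded by the sequence of its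
   ((a_q, b_q), v_q). *)
Definition step_fun (s : seq (R * R * 'rV[R]_m)) (u : R) : 'rV[R]_m :=
  \sum_(q <- s) \1_(`]q.1.1, q.1.2]) u *: q.2.

Definition step_int (s : seq (R * R * 'rV[R]_m)) (w : W) : R :=
  \sum_(q <- s) dotp q.2 (B q.1.2 w - B q.1.1 w).

(* I is a version of the stochastic integral of the deterministic
   square-integrable h over [0, t], i.e. the value at h of the L^2-continuous
   extension of step_int. *)
Definition is_wiener_integral (h : R -> 'rV[R]_m) (t : R) (I : W -> R) : Prop :=
  measurable_fun setT I /\
  exists s : nat -> seq (R * R * 'rV[R]_m),
  [/\ forall n, all (fun q => (0 <= q.1.1) && (q.1.1 <= q.1.2 <= t)) (s n),
      (\int[lebesgue_measure]_(u in `[0%R, t])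
         (enorm (h u - step_fun (s n) u) ^+ 2)%:E)%E @[n --> \oo] --> 0%E &
      (\int[P]_w ((I w - step_int (s n) w) ^+ 2)%:E)%E @[n --> \oo] --> 0%E].

End brownian.

Section L2paths.
Context (R : realType) (m : nat) (T : R).
Implicit Types f g : R -> 'rV[R]_m.

Definition L2path f : Prop :=
  (forall k, measurable_fun `[0, T] (fun u => f u ord0 k)) /\
  (\int[lebesgue_measure]_(u in `[0%R, T]) (enorm (f u) ^+ 2)%:E < +oo)%E.

Definition L2path_dot f g : R :=
  \int[lebesgue_measure]_(u in `[0, T]) dotp (f u) (g u).

Definition orthonormal_basis (h : nat -> R -> 'rV[R]_m) : Prop :=
  [/\ forall i, L2path (h i),
      forall i j, L2path_dot (h i) (h j) = (i == j)%:R &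
      forall f, L2path f ->
        (\int[lebesgue_measure]_(u in `[0%R, T])
           (enorm (f u - \sum_(i < N) L2path_dot f (h i) *: h i u) ^+ 2)%:E)%E
          @[N --> \oo] --> 0%E].

End L2paths.

Definition hermite (R : realType) (n : nat) (x : R) : R :=
  (-1) ^+ n / n`!%:R * expR (x ^+ 2 / 2)
  * ((fun u : R => expR (- (u ^+ 2 / 2)))^`(n))%classic x.

(* Finitely supported sequences, indexed from 0: a k stands for a_{k+1}, and
   likewise h i stands for h_{i+1} below. *)
Definition multiindex := {fsfun nat -> nat with 0%N}.

HB.instance Definition _ := Choice.on multiindex.

Definition mi_size (a : multiindex) : nat := (\sum_(k <- finsupp a) a k)%N.

Definition mi_fact (a : multiindex) : nat := (\prod_(k <- finsupp a) (a k)`!)%N.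

(* R^A with the product sigma-algebra. *)
Notation RA R := (g_sigma_algebraType
  [set C : set (multiindex -> R) | exists a (D : set R),
     measurable D /\ C = [set x | D (x a)]]).

Section chaos.
Context d (W : measurableType d) (R : realType) (P : probability W R).
(* I i t is the integral of h i over [0, t]. *)
Context (I : nat -> R -> W -> R).

(* Since hermite 0 = 1, indices outside the support contribute a factor 1. *)
Definition chaos_process (t : R) (w : W) : multiindex -> R :=
  fun a => \prod_(i <- finsupp a) hermite (a i) (I i t w).

Definition chaos_coef (T : R) (xi : W -> R) (a : multiindex) : R :=
  (mi_fact a)%:R * fine 'E_P[fun w => (xi w * chaos_process T w a)%R]%E.

Definition chaos_proj (T : R) (p M : nat) (xi : W -> R) (w : W) : R :=
  \sum_(a \in [set a : multiindex |
                (mi_size a <= p)%N /\ forall k, (M <= k)%N -> a k = 0%N])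
     chaos_coef T xi a * chaos_process T w a.

(* F^{p,M}(x, xi) := F(x, Pi_{p,M}(xi)) *)
Definition chaos_approx (U : Type) (T : R) (p M : nat)
    (F : RA R -> borel (L2space P) -> U) (x : RA R) (xi : L2space P) : U :=
  F x (toL2 P (chaos_proj T p M xi)).

End chaos.

Section scheme.
Context d (W : measurableType d) (R : realType) (P : probability W R).
Context (m : nat) (B : R -> W -> 'rV[R]_m).
Context (g : R -> R -> 'rV[R]_m -> R).

Definition is_partition (T : R) (n : nat) (t : nat -> R) : Prop :=
  [/\ t 0%N = 0, t n = T & forall i, (i < n)%N -> t i < t i.+1].

Definition mesh (n : nat) (t : nat -> R) : R :=
  \big[Num.max/0]_(i < n) (t i.+1 - t i).

Definition lipschitz_at (L s : R) : Prop :=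
  forall y1 y2 z1 z2,
    `|g s y1 z1 - g s y2 z2| <= L * (`|y1 - y2| + enorm (z1 - z2)).

Definition backward_scheme (n : nat) (t : nat -> R) (xi : W -> R)
    (Y : nat -> W -> R) (Z : nat -> W -> 'rV[R]_m) : Prop :=
  [/\ {ae P, forall w, Y n w = xi w},
      {ae P, forall w, Z n w = 0} &
      forall i, (i < n)%N ->
      [/\ measurable_wrt (filtration P B (t i)) (Y i),
          (forall k, exists2 C : W -> R,
             is_condexp P (filtration P B (t i))
               (fun w => Y i.+1 w * (B (t i.+1) w - B (t i) w) ord0 k) C &
             {ae P, forall w, Z i w ord0 k = (t i.+1 - t i)^-1 * C w}) &
          exists2 C : W -> R,
             is_condexp P (filtration P B (t i)) (Y i.+1) C &
             {ae P, forall w,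
                Y i w = C w + (t i.+1 - t i) * g (t i) (Y i w) (Z i w)}]].

End scheme.

(* Main.v *)
(* The backward scheme is L^2-stable in its terminal value: conditional
   expectation contracts L^2, and for f measurable up to time s the bound
   E[f^2 (B_t - B_s)^2] <= C (t - s) E[f^2] gives, by duality, the estimate of
   the Z-component; the implicit step is inverted because |pi| [g]_L < 1.
   Hence the left-hand side is at most C E|xi - Pi_{p,M}(xi)|^2, with C
   independent of xi, and it remains to make this small uniformly on K.  Since
   Pi_{p,M} is a best approximation, a finite net of K reduces the question to
   the density of chaos sums in L^2(F_T).

   Density: polynomials in Gaussian variables X are stable under
   multiplication by X, so that their L^2 closure is stable under
   multiplication by sin(c X) (dominated convergence of the series), hence by
   the indicators of the sets of the generated sigma-algebra.  Orthogonality
   of the X^a and the increment bound both come from Gaussian integration by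
   parts E[X f] = E[D_X f]. *)

Require Import Defs.
From HB Require Import structures.
From mathcomp Require Import all_boot all_order all_algebra.
From mathcomp Require Import finmap.
From mathcomp Require Import all_classical all_reals all_analysis.
From mathcomp Require Import measurable_realfun.
From mathcomp Require Import ring lra.
Set Implicit Arguments.
Unset Strict Implicit.
Unset Printing Implicit Defensive.
Import Order.TTheory GRing.Theory Num.Theory.
Import numFieldNormedType.Exports.
Local Open Scope classical_set_scope.
Local Open Scope ring_scope.

(** * Random variables with all moments *)

(** Independence of increments is used once, to compute the moment generating function of a step
    integral. From then on a Gaussian space is a linear space of variables with generating function
    exp(c^2 s / 2): the form survives L^2 limits, and moment identities are obtained by
    differentiating it. Independence of an increment from the past, or of the integrals of the h_i
    among themselves, enters only as orthogonality: a zero covariance removes the derivative term of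
    the integration by parts.

    For density, the target sigma-algebra is reached through the completeness of (h_i): by the
    isometry a step integral is an a.s. limit of combinations of the integrals of the h_i. Such a.s.
    arguments require that the sets handled contain the null sets, which is where completeness of
    the probability space enters.

    The duality for Z tests a conditional expectation against truncations of itself, and the
    increment bound passes from polynomials to f by Fatou's lemma, because f (B_t - B_s) is not
    known in advance to be square-integrable. *)

Section moments.
Context d (W : measurableType d) (R : realType) (P : probability W R).
Implicit Types X Y : W -> R.

(** An algebra of random variables on which expectation is linear without side conditions;
    polynomials and exponentials in Gaussian variables belong to it. *)
Definition moments X := measurable_fun setT X /\
  forall k : nat, P.-integrable setT (fun w => (`|X w| ^+ k)%:E).

Lemma integrable_leE (f g : W -> R) : measurable_fun setT f ->
  (forall w, `|f w| <= g w) -> P.-integrable setT (EFin \o g) ->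
  P.-integrable setT (EFin \o f).
Proof.
move=> mf fg ig; apply: (le_integrable _ _ _ ig) => //.
  exact/measurable_EFinP.
move=> w _ /=; rewrite lee_fin (le_trans (fg w))// ler_norm//.
Qed.

Lemma integrable_funD X Y : P.-integrable setT (EFin \o X) -> P.-integrable setT (EFin \o Y) ->
  P.-integrable setT (EFin \o (fun w => X w + Y w)).
Proof. by move=> iX iY; have := integrableD measurableT iX iY; exact: eq_integrable. Qed.

Lemma integrable_funB X Y : P.-integrable setT (EFin \o X) -> P.-integrable setT (EFin \o Y) ->
  P.-integrable setT (EFin \o (fun w => X w - Y w)).
Proof. by move=> iX iY; have := integrableB measurableT iX iY; exact: eq_integrable. Qed.

Lemma integrable_funZ c X : P.-integrable setT (EFin \o X) ->
  P.-integrable setT (EFin \o (fun w => c * X w)).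
Proof. by move=> iX; have := integrableZl measurableT c iX; exact: eq_integrable. Qed.

Lemma moments_le X Y : measurable_fun setT X -> (forall w, `|X w| <= `|Y w|) ->
  moments Y -> moments X.
Proof.
move=> mX XY [mY iY]; split => // k.
apply: (@integrable_leE _ (fun w => `|Y w| ^+ k)); last exact: iY.
  by apply/measurable_funX/measurableT_comp.
by move=> w; rewrite normrX normr_id lerXn2r// ?nnegrE.
Qed.

Lemma moments_cst c : moments (cst c).
Proof.
split => // k.
have := @finite_measure_integrable_cst _ W R P setT (`|c| ^+ k) measurableT.
by apply.
Qed.

Lemma moments_scale c X : moments X -> moments (fun w => c * X w).
Proof.
move=> [mX iX]; split; first exact: measurable_funM.
move=> k; have := @integrableZl _ _ _ P _ measurableT (`|c| ^+ k) _ (iX k).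
by apply: eq_integrable => // w _; rewrite normrM exprMn EFinM.
Qed.

Lemma momentsD X Y : moments X -> moments Y -> moments (fun w => X w + Y w).
Proof.
move=> [mX iX] [mY iY]; split; first exact: measurable_funD.
move=> k.
apply: (@integrable_leE _ (fun w => 2 ^+ k * (`|X w| ^+ k + `|Y w| ^+ k))).
- by apply/measurable_funX/measurableT_comp => //; exact: measurable_funD.
- move=> w; rewrite normrX normr_id.
  have h : `|X w + Y w| <= 2 * Num.max `|X w| `|Y w|.
    by rewrite (le_trans (ler_normD _ _))// mulr_natl mulr2n lerD// le_max lexx ?orbT.
  rewrite (le_trans (lerXn2r _ _ _ h)) ?nnegrE// ?mulr_ge0// ?le_max ?normr_ge0//.
  rewrite exprMn ler_wpM2l// ?exprn_ge0//.
  by case: (leP `|X w| `|Y w|) => _; rewrite ?lerDl ?lerDr exprn_ge0.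
- exact: (integrable_funZ _ (integrable_funD (iX k) (iY k))).
Qed.

Lemma momentsM X Y : moments X -> moments Y -> moments (fun w => X w * Y w).
Proof.
move=> [mX iX] [mY iY]; split; first exact: measurable_funM.
move=> k.
apply: (@integrable_leE _ (fun w => `|X w| ^+ (k * 2) + `|Y w| ^+ (k * 2))).
- by apply/measurable_funX/measurableT_comp => //; exact: measurable_funM.
- move=> w; rewrite normrX normr_id normrM exprMn.
  have a0 : 0 <= `|X w| ^+ k by rewrite exprn_ge0.
  have b0 : 0 <= `|Y w| ^+ k by rewrite exprn_ge0.
  rewrite !exprM; nra.
- exact: (integrable_funD (iX _) (iY _)).
Qed.

Lemma momentsB X Y : moments X -> moments Y -> moments (fun w => X w - Y w).
Proof.
move=> mX mY; have := momentsD mX (moments_scale (-1) mY).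
by congr moments; apply/funext => w; rewrite mulN1r.
Qed.

Lemma momentsX X k : moments X -> moments (fun w => X w ^+ k).
Proof.
move=> mX; elim: k => [|k IH]; first exact: (moments_cst 1).
by have := momentsM mX IH; congr moments; apply/funext => w; rewrite exprS.
Qed.

Lemma moments_sum (I : Type) (s : seq I) (F : I -> W -> R) :
  (forall i, moments (F i)) -> moments (fun w => \sum_(i <- s) F i w).
Proof.
move=> mF; elim: s => [|i s IH].
  by under eq_fun do rewrite big_nil; exact: moments_cst.
by under eq_fun do rewrite big_cons; exact: momentsD.
Qed.

Lemma moments_prod (I : Type) (s : seq I) (F : I -> W -> R) :
  (forall i, moments (F i)) -> moments (fun w => \prod_(i <- s) F i w).
Proof.
move=> mF; elim: s => [|i s IH].
  by under eq_fun do rewrite big_nil; exact: moments_cst.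
by under eq_fun do rewrite big_cons; exact: momentsM.
Qed.

Lemma moments_horner (p : {poly R}) X : moments X -> moments (fun w => p.[X w]).
Proof.
move=> mX; elim/poly_ind: p => [|p c IH].
  by under eq_fun do rewrite horner0; exact: moments_cst.
under eq_fun do rewrite hornerMXaddC.
by apply: momentsD; [exact: momentsM|exact: moments_cst].
Qed.

Lemma moments_integrable X : moments X -> P.-integrable setT (EFin \o X).
Proof.
move=> [mX iX]; apply: (@integrable_leE _ (fun w => `|X w| ^+ 1)) => //.
exact: iX.
Qed.

Lemma moments_measurable X : moments X -> measurable_fun setT X.
Proof. by case. Qed.

(** Exponential moments dominate the partial sums of the series of [sin (c * X)] and the Taylor
    remainder of [expR (e * X)]. *)
Definition expmoments X := measurable_fun setT X /\
  forall c : R, P.-integrable setT (EFin \o (fun w => expR (c * `|X w|))).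

Lemma expmoments_expR X c : expmoments X -> moments (fun w => expR (c * `|X w|)).
Proof.
move=> [mX eX]; split.
  by apply: measurableT_comp => //; apply: measurable_funM => //; exact: measurableT_comp.
move=> k; apply: (@eq_integrable _ _ _ P _ measurableT (EFin \o (fun w => expR ((c *+ k) * `|X w|)))); last exact: eX.
move=> w _ /=; rewrite [X in X ^+ _]ger0_norm ?expR_ge0// -expRM_natl; congr (EFin (expR _)).
by rewrite mulr_natl mulrnAl.
Qed.

Lemma expmoments_moments X : expmoments X -> moments X.
Proof.
move=> eX; apply: (@moments_le _ (fun w => expR (1 * `|X w|))).
- by case: eX.
- move=> w; rewrite mul1r [leRHS]ger0_norm ?expR_ge0//.
  by rewrite (le_trans _ (expR_ge1Dx _))// lerDr.
- exact: expmoments_expR.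
Qed.

Lemma expmoments_expRZ X c : expmoments X -> moments (fun w => expR (c * X w)).
Proof.
move=> eX; apply: (@moments_le _ (fun w => expR (`|c| * `|X w|))).
- by apply: measurableT_comp => //; apply: measurable_funM => //; case: eX.
- move=> w; rewrite [leLHS]ger0_norm ?expR_ge0// [leRHS]ger0_norm ?expR_ge0// ler_expR -normrM.
  exact: ler_norm.
- exact: expmoments_expR.
Qed.

(** Extended-valued, so that bounds and limits can be stated before finiteness is known. *)
Definition L2sqn X : \bar R := (\int[P]_w ((X w) ^+ 2)%:E)%E.

Lemma sqn_ge0 X : (0 <= L2sqn X)%E.
Proof. by apply: integral_ge0 => w _; rewrite lee_fin sqr_ge0. Qed.

Lemma measurable_sqrE X : measurable_fun setT X ->
  measurable_fun setT (fun w => ((X w) ^+ 2)%:E).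
Proof. by move=> mX; apply/measurable_EFinP; exact: measurable_funX. Qed.

Lemma sqn_le X Y : measurable_fun setT X -> measurable_fun setT Y ->
  (forall w, `|X w| <= `|Y w|) -> (L2sqn X <= L2sqn Y)%E.
Proof.
move=> mX mY XY; apply: ge0_le_integral => //.
- by move=> w _; rewrite lee_fin sqr_ge0.
- exact: measurable_sqrE.
- exact: measurable_sqrE.
- by move=> w _; rewrite lee_fin -[X w ^+ 2]real_normK ?num_real// -[Y w ^+ 2]real_normK ?num_real// lerXn2r ?nnegrE.
Qed.

Lemma ae_sqn_le X Y : measurable_fun setT X -> measurable_fun setT Y ->
  {ae P, forall w, `|X w| <= `|Y w|} -> (L2sqn X <= L2sqn Y)%E.
Proof.
move=> mX mY XY; apply: ae_ge0_le_integral => //.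
- by move=> w _; rewrite lee_fin sqr_ge0.
- exact: measurable_sqrE.
- by move=> w _; rewrite lee_fin sqr_ge0.
- exact: measurable_sqrE.
- apply: filterS XY => w XY _; rewrite lee_fin -[X w ^+ 2]real_normK ?num_real// -[Y w ^+ 2]real_normK ?num_real// lerXn2r ?nnegrE//.
Qed.

Lemma ae_eq_sqn X Y : measurable_fun setT X -> measurable_fun setT Y ->
  {ae P, forall w, X w = Y w} -> L2sqn X = L2sqn Y.
Proof.
move=> mX mY XY; apply/eqP; rewrite eq_le; apply/andP; split; apply: ae_sqn_le => //; apply: filterS XY => w ->//.
Qed.

Lemma sqnZ c X : measurable_fun setT X ->
  (L2sqn (fun w => c * X w)%R = (c ^+ 2)%:E * L2sqn X)%E.
Proof.
move=> mX; rewrite /L2sqn -ge0_integralZl//.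
- by apply: eq_integral => w _; rewrite exprMn EFinM.
- exact: measurable_sqrE.
- by move=> w _; rewrite lee_fin sqr_ge0.
- by rewrite lee_fin sqr_ge0.
Qed.

Lemma sqnD X Y : measurable_fun setT X -> measurable_fun setT Y ->
  (L2sqn (fun w => X w + Y w)%R <= 2%:E * L2sqn X + 2%:E * L2sqn Y)%E.
Proof.
move=> mX mY.
have mX2 := measurable_sqrE mX; have mY2 := measurable_sqrE mY.
rewrite -!ge0_integralZl//; try by move=> w _; rewrite lee_fin sqr_ge0.
rewrite -ge0_integralD//; first last.
- exact: measurable_funeM.
- by move=> w _; rewrite -EFinM lee_fin mulr_ge0// sqr_ge0.
- exact: measurable_funeM.
- by move=> w _; rewrite -EFinM lee_fin mulr_ge0// sqr_ge0.
apply: ge0_le_integral => //.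
- by move=> w _; rewrite lee_fin sqr_ge0.
- by apply: measurable_sqrE; exact: measurable_funD.
- by apply: emeasurable_funD; exact: measurable_funeM.
- move=> w _; rewrite -!EFinM -EFinD lee_fin.
  by have := sqr_ge0 (X w - Y w); nra.
Qed.

Lemma sqnN X : L2sqn (fun w => - X w) = L2sqn X.
Proof. by apply: eq_integral => w _; rewrite sqrrN. Qed.

Lemma sqnBC X Y : L2sqn (fun w => X w - Y w) = L2sqn (fun w => Y w - X w).
Proof. by apply: eq_integral => w _; rewrite -sqrrN opprB. Qed.

Lemma sqnB X Y : measurable_fun setT X -> measurable_fun setT Y ->
  (L2sqn (fun w => X w - Y w)%R <= 2%:E * L2sqn X + 2%:E * L2sqn Y)%E.
Proof.
move=> mX mY; have := sqnD mX (measurableT_comp (@oppr_measurable R setT) mY).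
by rewrite [L2sqn (-%R \o Y)]sqnN.
Qed.

Lemma moments_sqn X : moments X -> (L2sqn X < +oo)%E.
Proof.
move=> mX; have /moments_integrable/integrableP[_] := momentsX 2 mX.
rewrite /L2sqn; congr (_ < _)%E; apply: eq_integral => w _.
by rewrite /= ger0_norm// sqr_ge0.
Qed.

Lemma integrable_sqr X : measurable_fun setT X -> (L2sqn X < +oo)%E ->
  P.-integrable setT (EFin \o (fun w => X w ^+ 2)).
Proof.
move=> mX sX; apply/integrableP; split; first exact: measurable_sqrE.
move: sX; rewrite /L2sqn; congr (_ < _)%E; apply: eq_integral => w _.
by rewrite /= ger0_norm// sqr_ge0.
Qed.

Lemma integrable_mul2 X Y : measurable_fun setT X -> measurable_fun setT Y ->
  (L2sqn X < +oo)%E -> (L2sqn Y < +oo)%E ->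
  P.-integrable setT (EFin \o (fun w => X w * Y w)).
Proof.
move=> mX mY sX sY; apply: (@integrable_leE _ (fun w => X w ^+ 2 + Y w ^+ 2)).
- exact: measurable_funM.
- move=> w; rewrite normrM -[X w ^+ 2]real_normK ?num_real// -[Y w ^+ 2]real_normK ?num_real//.
  have := normr_ge0 (X w); have := normr_ge0 (Y w); nra.
- by apply: integrable_funD; exact: integrable_sqr.
Qed.

Lemma integrable_sqn_lt X : measurable_fun setT X -> (L2sqn X < +oo)%E ->
  P.-integrable setT (EFin \o X).
Proof.
move=> mX sX.
have := integrable_mul2 mX (moments_measurable (moments_cst 1)) sX (moments_sqn (moments_cst 1)).
by apply: eq_integrable => // w _; rewrite /= mulr1.
Qed.

End moments.

(** * Measurability with respect to a sigma-algebra *)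

Section measurable_wrt.
Context d (W : measurableType d) (R : realType) (P : probability W R).
Context (G : set (set W)) (sG : sigma_algebra setT G).
Implicit Types f g : W -> R.

Lemma measurable_wrtP f :
  measurable_wrt G f <-> measurable_fun [set: g_sigma_algebraType G] f.
Proof.
have GE A : measurable (A : set (g_sigma_algebraType G)) = G A.
  by rewrite (measurable_g_measurableTypeE sG).
split; first by move=> mf _ D mD; rewrite setTI GE; exact: mf.
by move=> mf D mD; have := mf measurableT D mD; rewrite setTI GE.
Qed.

Lemma measurable_wrt_cst c : measurable_wrt G (cst c : W -> R).
Proof. by apply/measurable_wrtP; exact: measurable_cst. Qed.

Lemma measurable_wrtD f g : measurable_wrt G f -> measurable_wrt G g ->
  measurable_wrt G (fun w => f w + g w).
Proof.
move=> /measurable_wrtP mf /measurable_wrtP mg; apply/measurable_wrtP.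
exact: (measurable_funD mf mg).
Qed.

Lemma measurable_wrtM f g : measurable_wrt G f -> measurable_wrt G g ->
  measurable_wrt G (fun w => f w * g w).
Proof.
move=> /measurable_wrtP mf /measurable_wrtP mg; apply/measurable_wrtP.
exact: (measurable_funM mf mg).
Qed.

Lemma measurable_wrtB f g : measurable_wrt G f -> measurable_wrt G g ->
  measurable_wrt G (fun w => f w - g w).
Proof.
move=> /measurable_wrtP mf /measurable_wrtP mg; apply/measurable_wrtP.
exact: (measurable_funB mf mg).
Qed.

Lemma measurable_wrt_sum (J : Type) (s : seq J) (F : J -> W -> R) :
  (forall j, measurable_wrt G (F j)) ->
  measurable_wrt G (fun w => \sum_(j <- s) F j w).
Proof.
move=> mF; elim: s => [|i s IH].
  by under eq_fun do rewrite big_nil; exact: measurable_wrt_cst.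
by under eq_fun do rewrite big_cons; exact: measurable_wrtD.
Qed.

Lemma measurable_wrt_comp (phi : R -> R) f : measurable_fun setT phi ->
  measurable_wrt G f -> measurable_wrt G (phi \o f).
Proof.
move=> mphi mf D mD; rewrite comp_preimage; apply: mf.
by rewrite -[X in measurable X]setTI; exact: mphi.
Qed.

Lemma measurable_wrt_cvg (u : nat -> W -> R) f : (forall n, measurable_wrt G (u n)) ->
  (forall w, u n w @[n --> \oo] --> f w) -> measurable_wrt G f.
Proof.
move=> mu uf; apply/measurable_wrtP.
by apply: (@measurable_fun_cvg _ (g_sigma_algebraType G) R setT u f) => [n|w _];
  [exact/measurable_wrtP|exact: uf].
Qed.

Lemma measurable_wrt_indic A : G A -> measurable_wrt G (\1_A : W -> R).
Proof.
move=> GA; apply/measurable_wrtP; apply: measurable_indic.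
by rewrite (measurable_g_measurableTypeE sG).
Qed.

Context (G_negligible : forall A, P.-negligible A -> G A).

Lemma measurable_wrt_ae_eq f g : measurable_wrt G f -> {ae P, forall w, f w = g w} ->
  measurable_wrt G g.
Proof.
move=> mf fg D mD.
set N := [set w | f w <> g w].
have nN : P.-negligible N by exact: fg.
rewrite (_ : g @^-1` D = ((f @^-1` D) `&` ~` N) `|` (g @^-1` D `&` N)); last first.
  apply/seteqP; split => w /=.
    by have [e|e] := pselect (f w = g w) => h; [left; split; rewrite ?e//|right].
  by move=> [[fD /contrapT <-]|[]].
have GE A : measurable (A : set (g_sigma_algebraType G)) = G A.
  by rewrite (measurable_g_measurableTypeE sG).
rewrite -GE; apply: measurableU.
  apply: measurableI; rewrite GE; first exact: mf.
  by rewrite -GE; apply: measurableC; rewrite GE; exact: G_negligible.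
by rewrite GE; apply: G_negligible; apply: negligibleS nN => w [].
Qed.

Lemma measurable_wrt_ae_cvg (u : nat -> W -> R) f : (forall n, measurable_wrt G (u n)) ->
  {ae P, forall w, u n w @[n --> \oo] --> f w} -> measurable_wrt G f.
Proof.
move=> mu uf; set N := [set w | ~ (u n w @[n --> \oo] --> f w)].
have nN : P.-negligible N by exact: uf.
(* Setting everything to 0 on the exceptional set [N] turns a.e. convergence into convergence
   everywhere; [N] belongs to [G] as a null set. *)
have m1 : measurable_wrt G (\1_(~` N) : W -> R).
  apply: measurable_wrt_indic; rewrite -(measurable_g_measurableTypeE sG).
  by apply: measurableC; rewrite (measurable_g_measurableTypeE sG); exact: G_negligible.
apply: (@measurable_wrt_ae_eq (fun w => f w * \1_(~` N) w)).
  apply: (@measurable_wrt_cvg (fun n w => u n w * \1_(~` N) w)).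
    by move=> n; exact: measurable_wrtM.
  move=> w; rewrite indicE; have [Nw|Nw] := pselect (N w).
    rewrite memNset/=; last by move=> /(_ Nw).
    by under eq_fun do rewrite mulr0; rewrite mulr0; exact: cvg_cst.
  rewrite mem_set//=; under eq_fun do rewrite mulr1; rewrite mulr1.
  exact: contrapT.
by apply: filterS uf => w uw; rewrite indicE mem_set ?mulr1//= => /(_ uw).
Qed.

End measurable_wrt.

Lemma measurable_wrt_sub d (W : measurableType d) (R : realType) (G G' : set (set W)) (f : W -> R) :
  G `<=` G' -> measurable_wrt G f -> measurable_wrt G' f.
Proof. by move=> GG' mf D /mf/GG'. Qed.

(** * Density of polynomial spaces in L^2 *)

Section real_lemmas.
Context (R : realType).

Lemma bernoulli_ge (x : R) n : 0 <= x <= 1 -> 1 - x *+ n <= (1 - x) ^+ n.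
Proof.
move=> /andP[x0 x1]; elim: n => [|n IH]; first by rewrite mulr0n subr0 expr0.
rewrite exprS (le_trans _ (ler_wpM2l _ IH)) ?subr_ge0// mulrS.
have : 0 <= x * (x *+ n) by rewrite mulr_ge0// mulrn_wge0.
by lra.
Qed.

(** Bernoulli's inequality for 1 + x, combined with (1 - x)^n (1 + x)^n = (1 - x^2)^n <= 1. *)
Lemma bernoulli_le (x : R) n : 0 <= x <= 1 -> (1 - x) ^+ n * (1 + x *+ n) <= 1.
Proof.
move=> /andP[x0 x1].
have h : 1 + x *+ n <= (1 + x) ^+ n.
  elim: n => [|n IH]; first by rewrite mulr0n addr0 expr0.
  rewrite exprS (le_trans _ (ler_wpM2l _ IH)) ?addr_ge0// mulrS.
  have : 0 <= x * (x *+ n) by rewrite mulr_ge0// mulrn_wge0.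
  by lra.
rewrite (le_trans (ler_wpM2l _ h)) ?exprn_ge0 ?subr_ge0//.
rewrite -exprMn exprn_ile1//; nra.
Qed.

Lemma cvg_expr0 (x : R) : 0 <= x < 1 -> x ^+ n @[n --> \oo] --> (0 : R).
Proof. by move=> /andP[x0 x1]; apply: cvg_expr; rewrite ger0_norm. Qed.

(* The polynomials (1 - x^n)^(2^n) converge on [0, 1] to the indicator of
   x < 1/2, away from 1/2: this turns bounded multipliers into indicators. *)
Lemma bernstein_lt (x : R) : 0 <= x < 2^-1 ->
  (1 - x ^+ n) ^+ (2 ^ n) @[n --> \oo] --> (1 : R).
Proof.
move=> /andP[x0 x1].
apply: (@squeeze_cvgr _ _ _ _ (fun n => 1 - (2 * x) ^+ n) (cst 1)).
- near=> n.
  have xn1 : 0 <= x ^+ n <= 1 by rewrite exprn_ge0//= exprn_ile1//; lra.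
  apply/andP; split.
    apply: le_trans (bernoulli_ge _ xn1).
    by rewrite exprMn -[x ^+ n *+ _]mulr_natl natrX.
  by rewrite exprn_ile1//; move: xn1 => /andP[? ?]; lra.
- rewrite -[X in _ --> X](subr0 (1:R)); apply: cvgB; first exact: cvg_cst.
  by apply: cvg_expr0; lra.
- exact: cvg_cst.
Unshelve. all: by end_near. Qed.

Lemma bernstein_gt (x : R) : 2^-1 < x <= 1 ->
  (1 - x ^+ n) ^+ (2 ^ n) @[n --> \oo] --> (0 : R).
Proof.
move=> /andP[x0 x1].
apply: (@squeeze_cvgr _ _ _ _ (cst 0) (fun n => ((2 * x)^-1) ^+ n)).
- near=> n.
  have xp : 0 < x by lra.
  have xn1 : 0 <= x ^+ n <= 1 by rewrite exprn_ge0//= ?exprn_ile1//; lra.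
  have := bernoulli_le (2 ^ n)%N xn1.
  rewrite -[x ^+ n *+ _]mulr_natl natrX -exprMn => h.
  have p0 : 0 <= (1 - x ^+ n) ^+ (2 ^ n).
    by rewrite exprn_ge0// subr_ge0; case/andP: xn1.
  rewrite p0 /= exprVn -[leRHS]mul1r ler_pdivlMr ?exprn_gt0//; last lra.
  apply: le_trans h; rewrite ler_wpM2l// lerDr//.
- exact: cvg_cst.
- apply: cvg_expr0; rewrite invr_ge0 mulr_ge0//=; last lra.
  by rewrite invf_lt1//; lra.
Unshelve. all: by end_near. Qed.

(** The derivative of sin at 0 is 1. Applied to the values of a variable X, this recovers the
    unbounded X as a limit of bounded multipliers. *)
Lemma cvg_sin_scaled (x : R) :
  n.+1%:R * sin (n.+1%:R^-1 * x) @[n --> \oo] --> x.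
Proof.
have [->|x0] := eqVneq x 0.
  rewrite (_ : (fun n => _) = cst 0); first exact: cvg_cst.
  by apply/funext => n; rewrite mulr0 sin0 mulr0.
have h : (fun h : R => h^-1 *: (sin (h *: (1:R) + 0) - sin 0)) @ 0^' --> (1:R).
  have [d1 d2] := @is_derive_sin R 0; rewrite cos0 in d2.
  have : (fun h : R => h^-1 *: (sin (h *: (1:R) + 0) - sin 0)) @ 0^' --> 'D_1 (@sin R) 0.
    exact: d1.
  by rewrite d2.
move: h => /cvgr_dnbhsP/(_ (fun n => n.+1%:R^-1 * x)) h.
have {}h : n.+1%:R * x^-1 * sin (n.+1%:R^-1 * x) @[n --> \oo] --> (1 : R).
  rewrite (_ : (fun n => _) = (fun n => (n.+1%:R^-1 * x)^-1 *: (sin ((n.+1%:R^-1 * x)%:A + 0) - sin 0))); last first.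
    by apply/funext => n; rewrite sin0 subr0 addr0 invfM invrK /GRing.scale/= mulr1.
  apply: h; split.
    by move=> n; rewrite mulf_neq0// invr_eq0.
  rewrite -[X in _ --> X](mul0r x); apply: cvgM; last exact: cvg_cst.
  exact: cvg_harmonic.
have {}h : (fun n => x * (n.+1%:R / x * sin (n.+1%:R^-1 * x))) @ \oo --> x.
  by rewrite -[X in _ --> X]mulr1; apply: cvgM h; exact: cvg_cst.
rewrite (_ : (fun n => n.+1%:R * _) = (fun n => x * (n.+1%:R / x * sin (n.+1%:R^-1 * x))))//.
by apply/funext => n; rewrite !mulrA [x * _]mulrC mulfK.
Qed.

(** Termwise comparison with the exponential series. The bound is uniform in [n], hence a dominating
    function for the partial sums. *)
Lemma sin_series_le (x : R) n : `|series (sin_coeff x) n| <= expR `|x|.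
Proof.
apply: (@le_trans _ _ (series (exp_coeff `|x|) n)).
  rewrite /series/= (le_trans (ler_norm_sum _ _ _))//; apply: ler_sum => k _.
  rewrite /exp_coeff /sin_coeff /=.
  rewrite !normrM normfV !normr_nat !normrX normrN normr1 expr1n mulr1.
  by case: odd; [rewrite mul1r| rewrite !mul0r divr_ge0].
apply: nondecreasing_cvgn_le; last exact: is_cvg_series_exp_coeff.
by apply: nondecreasing_series => k _ _; rewrite /exp_coeff/= divr_ge0.
Qed.

Lemma cvge0_near_lt (u : nat -> \bar R) (e : R) : 0 < e ->
  u n @[n --> \oo] --> 0%E -> \forall n \near \oo, (u n < e%:E)%E.
Proof.
move=> e0 /fine_cvgP[fin /cvgrPdist_lt/(_ _ e0) H].
apply: filterS2 fin H => n fn; rewrite /= sub0r normrN => H.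
by rewrite -(fineK fn) lte_fin (le_lt_trans _ H)// ler_norm.
Qed.

End real_lemmas.

(** * L^2 closure of a polynomial space and its bounded multipliers *)

Section density.
Import HBSimple HBNNSimple.
Context d (W : measurableType d) (R : realType) (P : probability W R).
Context (P_complete : measure_is_complete P).
Implicit Types (f g h u v X : W -> R).
Local Notation sqn := (L2sqn P).
Local Notation moments := (moments P).

Lemma sqn_dom_cvg0 (u : nat -> W -> R) h : (forall n, measurable_fun setT (u n)) ->
  measurable_fun setT h -> (sqn h < +oo)%E ->
  (forall w, u n w @[n --> \oo] --> (0:R)) ->
  (forall n w, `|u n w| <= `|h w|) ->
  sqn (u n) @[n --> \oo] --> 0%E.
Proof.
move=> mu mh sh u0 uh.
have [] := @dominated_convergence _ W R P setT measurableT (fun n w => ((u n w) ^+ 2)%:E)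
  (cst 0%E) (fun w => ((h w)^+ 2)%:E).
- by move=> n; exact: measurable_sqrE.
- exact: measurable_cst.
- apply: aeW => w _; apply/fine_cvgP; split; first exact: nearW.
  rewrite (_ : _ \o _ = (fun n => u n w * u n w)) //.
  by rewrite -[X in _ --> X](mulr0 (0:R)); apply: cvgM; exact: u0.
- exact: integrable_sqr.
- apply: aeW => w n _; rewrite /= lee_fin ger0_norm ?sqr_ge0//.
  by rewrite -[X in _ <= X]real_normK ?num_real// -[leLHS]real_normK ?num_real// lerXn2r ?nnegrE//.
by move=> _ _; rewrite integral0.
Qed.

Context (Pol : set (W -> R)).
Context (PolM : forall p, Pol p -> moments p).
Context (Pol1 : Pol (cst 1)).
Context (PolD : forall p q, Pol p -> Pol q -> Pol (fun w => p w + q w)).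
Context (PolZ : forall c p, Pol p -> Pol (fun w => c * p w)).

(** [Pol] stays abstract because two spaces are needed: the chaos sums, and the polynomials in the
    step integrals up to a time [s]. *)
Definition L2closure (f : W -> R) := measurable_fun setT f /\
  forall e : R, 0 < e -> exists2 p, Pol p & (sqn (fun w => f w - p w)%R < e%:E)%E.

Local Notation cl := L2closure.

Lemma cl_measurable f : cl f -> measurable_fun setT f.
Proof. by case. Qed.

Lemma Pol_measurable p : Pol p -> measurable_fun setT p.
Proof. by move=> /PolM[]. Qed.

Lemma cl_Pol p : Pol p -> cl p.
Proof.
move=> Pp; split; first exact: Pol_measurable.
move=> e e0; exists p => //.
rewrite (_ : (fun w => _) = cst 0); last by apply/funext => w; rewrite subrr.
by rewrite /L2sqn; under eq_integral do rewrite expr0n/=; rewrite integral0.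
Qed.

Lemma cl_sqn f : cl f -> (sqn f < +oo)%E.
Proof.
move=> [mf /(_ 1 ltr01)[p Pp fp]].
have mp := Pol_measurable Pp.
rewrite (_ : f = (fun w => (f w - p w) + p w)); last by apply/funext => w; rewrite subrK.
apply: le_lt_trans (sqnD P (measurable_funB mf mp) mp) _.
by rewrite lte_add_pinfty// lte_mul_pinfty ?lee_fin// ?(lt_le_trans fp (leey _))// moments_sqn//; exact: PolM.
Qed.

Lemma cl_lim f : measurable_fun setT f ->
  (forall e : R, 0 < e -> exists2 g, cl g & (sqn (fun w => f w - g w)%R < e%:E)%E) ->
  cl f.
Proof.
move=> mf H; split => // e e0.
(* [sqnD] costs a factor 2 on each of the two errors. *)
have e4 : 0 < e / 4 by rewrite divr_gt0.
have [g [mg /(_ _ e4)[p Pp gp]] fg] := H _ e4.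
exists p => //; have mp := Pol_measurable Pp.
rewrite (_ : (fun w => _) = (fun w => (f w - g w) + (g w - p w))); last first.
  by apply/funext => w; rewrite addrA subrK.
apply: le_lt_trans (sqnD P (measurable_funB mf mg) (measurable_funB mg mp)) _.
have -> : (e%:E = 2%:E * (e/4)%:E + 2%:E * (e/4)%:E)%E.
  by rewrite -!EFinM -EFinD; congr EFin; field.
by apply: lteD; rewrite lte_pmul2l.
Qed.

Lemma clD f g : cl f -> cl g -> cl (fun w => f w + g w).
Proof.
move=> [mf cf] [mg cg]; split; first exact: measurable_funD.
move=> e e0; have e4 : 0 < e / 4 by rewrite divr_gt0.
have [p Pp fp] := cf _ e4; have [q Pq gq] := cg _ e4.
exists (fun w => p w + q w); first exact: PolD.
have mp := Pol_measurable Pp; have mq := Pol_measurable Pq.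
rewrite (_ : (fun w => _) = (fun w => (f w - p w) + (g w - q w))); last first.
  by apply/funext => w; rewrite opprD addrACA.
apply: le_lt_trans (sqnD P (measurable_funB mf mp) (measurable_funB mg mq)) _.
have -> : (e%:E = 2%:E * (e/4)%:E + 2%:E * (e/4)%:E)%E.
  by rewrite -!EFinM -EFinD; congr EFin; field.
by apply: lteD; rewrite lte_pmul2l.
Qed.

Lemma clZ c f : cl f -> cl (fun w => c * f w).
Proof.
move=> [mf cf]; split; first exact: measurable_funM.
(* The summand 1 covers the case [c = 0]. *)
move=> e e0; have c0 : 0 < c ^+ 2 + 1 by rewrite ltr_pwDr// sqr_ge0.
have [p Pp fp] := cf _ (divr_gt0 e0 c0); have mp := Pol_measurable Pp.
exists (fun w => c * p w); first exact: PolZ.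
rewrite (_ : (fun w => _) = (fun w => c * (f w - p w))); last first.
  by apply/funext => w; rewrite mulrBr.
rewrite sqnZ; last exact: measurable_funB.
apply: (@le_lt_trans _ _ ((c^+2)%:E * (e / (c ^+ 2 + 1))%:E)%E).
  by rewrite lee_wpmul2l ?lee_fin ?sqr_ge0// ltW.
rewrite -EFinM lte_fin mulrCA gtr_pMr// ltr_pdivrMr// mul1r ltrDl//.
Qed.

Lemma clB f g : cl f -> cl g -> cl (fun w => f w - g w).
Proof.
move=> cf cg; have := clD cf (clZ (-1) cg); congr cl.
by apply/funext => w; rewrite mulN1r.
Qed.

Lemma cl0 : cl (cst 0).
Proof.
have := clZ 0 (cl_Pol Pol1); congr cl; apply/funext => w /=.
by rewrite mul0r.
Qed.

Lemma cl_sum (I : Type) (s : seq I) (F : I -> W -> R) : (forall i, cl (F i)) ->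
  cl (fun w => \sum_(i <- s) F i w).
Proof.
move=> mF; elim: s => [|i s IH].
  by under eq_fun do rewrite big_nil; exact: cl0.
by under eq_fun do rewrite big_cons; exact: clD.
Qed.

Lemma cl_dominated (u : nat -> W -> R) f h : (forall n, cl (u n)) ->
  measurable_fun setT f -> measurable_fun setT h -> (sqn h < +oo)%E ->
  (forall w, u n w @[n --> \oo] --> f w) ->
  (forall n w, `|u n w| <= `|h w|) -> cl f.
Proof.
move=> cu mf mh sh uf uh; apply: cl_lim => // e e0.
have fh w : `|f w| <= `|h w|.
  by apply: (cvgr_to_le (cvg_norm (uf w))); apply: nearW => n.
have : sqn (fun w => f w - u n w) @[n --> \oo] --> 0%E.
  apply: (@sqn_dom_cvg0 _ (fun w => 2 * h w)).
  - by move=> n; apply: measurable_funB => //; exact: cl_measurable.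
  - exact: measurable_funM.
  - by rewrite sqnZ// lte_mul_pinfty ?lee_fin ?sqr_ge0.
  - move=> w; rewrite -(subrr (f w)); apply: cvgB; [exact: cvg_cst|exact: uf].
  - move=> n w; rewrite normrM ger0_norm// mulr_natl mulr2n.
    by rewrite (le_trans (ler_normB _ _))// lerD.
by move=> /(cvge0_near_lt e0) /filter_ex[n]; exists (u n).
Qed.

(** The multipliers form an algebra closed under uniformly bounded pointwise limits; their
    boundedness also allows the affine rescaling of a multiplier into [0, 1]. *)
Definition multiplier (f : W -> R) := [/\ measurable_fun setT f,
  exists M : R, forall w, `|f w| <= M &
  forall v, cl v -> cl (fun w => f w * v w)].

Local Notation mult := multiplier.

Lemma mult_cst c : mult (cst c).
Proof. by split; [exact: measurable_cst|exists (`|c|)|move=> v; exact: clZ]. Qed.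

Lemma multM f g : mult f -> mult g -> mult (fun w => f w * g w).
Proof.
move=> [mf [M fM] cf] [mg [N gN] cg]; split; first exact: measurable_funM.
  by exists (M * N) => w; rewrite normrM ler_pM.
move=> v /cg/cf; congr cl; apply/funext => w; rewrite mulrA//.
Qed.

Lemma multD f g : mult f -> mult g -> mult (fun w => f w + g w).
Proof.
move=> [mf [M fM] cf] [mg [N gN] cg]; split; first exact: measurable_funD.
  by exists (M + N) => w; rewrite (le_trans (ler_normD _ _))// lerD.
move=> v cv; have := clD (cf _ cv) (cg _ cv).
by congr cl; apply/funext => w; rewrite mulrDl//.
Qed.

Lemma multZ c f : mult f -> mult (fun w => c * f w).
Proof. by move=> mf; exact: (multM (mult_cst c)). Qed.

Lemma multB f g : mult f -> mult g -> mult (fun w => f w - g w).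
Proof.
move=> cf cg; have := multD cf (multZ (-1) cg); congr mult.
by apply/funext => w; rewrite mulN1r.
Qed.

Lemma multX f n : mult f -> mult (fun w => f w ^+ n).
Proof.
move=> mf; elim: n => [|n IH]; first exact: (mult_cst 1).
by have := multM mf IH; congr mult; apply/funext => w; rewrite exprS.
Qed.

Lemma mult_lim (u : nat -> W -> R) f (M : R) : (forall n, mult (u n)) ->
  (forall n w, `|u n w| <= M) -> (forall w, u n w @[n --> \oo] --> f w) ->
  mult f.
Proof.
move=> mu uM uf.
have mf : measurable_fun setT f.
  by apply: (measurable_fun_cvg (h := u)) => [n|w _]; [case: (mu n)|exact: uf].
have fM w : `|f w| <= M.
  by apply: (cvgr_to_le (cvg_norm (uf w))); apply: nearW => n.
split => //; first by exists M.
move=> v cv; have mv := cl_measurable cv.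
apply: (@cl_dominated (fun n w => u n w * v w) _ (fun w => M * v w)).
- by move=> n; case: (mu n) => _ _; exact.
- exact: measurable_funM.
- exact: measurable_funM.
- by rewrite sqnZ// lte_mul_pinfty ?lee_fin ?sqr_ge0//; exact: cl_sqn.
- by move=> w; apply: cvgM; [exact: uf|exact: cvg_cst].
- move=> n w; rewrite !normrM ler_wpM2r// (le_trans (uM n w))//.
  exact: ler_norm.
Qed.

(** The polynomials [1 - (1 - f w) ^+ k] increase to the indicator. *)
Lemma mult_neq0 f : mult f -> (forall w, 0 <= f w <= 1) ->
  mult (\1_[set w | f w != 0]).
Proof.
move=> mf f01; apply: (@mult_lim (fun k w => 1 - (1 - f w) ^+ k) _ 1).
- by move=> n; apply: multB; [exact: mult_cst|apply: multX; apply: multB => //; exact: mult_cst].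
- move=> n w; have /andP[f0 f1] := f01 w.
  have h0 : 0 <= (1 - f w) ^+ n by rewrite exprn_ge0// subr_ge0.
  have h1 : (1 - f w) ^+ n <= 1 by rewrite exprn_ile1//; lra.
  by rewrite ger0_norm; lra.
- move=> w; rewrite indicE; have /andP[f0 f1] := f01 w.
  have [fw0|fw0] := eqVneq (f w) 0.
    rewrite memNset/= ?fw0 ?eqxx//= (_ : (fun n => _) = cst 0); first exact: cvg_cst.
    by apply/funext => k; rewrite subr0 expr1n subrr.
  rewrite mem_set//= -[X in _ --> X](subr0 (1:R)); apply: cvgB; first exact: cvg_cst.
  by apply: cvg_expr0; rewrite subr_ge0 f1/=; rewrite ltrBlDr ltrDl lt_neqAle eq_sym fw0.
Qed.

Lemma mult_lt_half f : mult f -> (forall w, 0 <= f w <= 1) ->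
  mult (\1_[set w | f w < 2^-1]).
Proof.
(* Where [f w = 2^-1] the polynomials below tend to 1/e; the indicator of [A] sends them to 0 there,
   as the strict inequality demands. *)
move=> mf f01; set A := [set w | (f w - 2^-1) ^+ 2 != 0].
have mA : mult \1_A.
  apply: (@mult_neq0 (fun w => (f w - 2^-1) ^+ 2)).
    by apply: multX; apply: multB => //; exact: mult_cst.
  by move=> w; have /andP[f0 f1] := f01 w; rewrite sqr_ge0/=; nra.
apply: (@mult_lim (fun k w => (1 - f w ^+ k) ^+ (2 ^ k) * \1_A w) _ 1).
- move=> n; apply: multM => //; apply: multX; apply: multB; first exact: mult_cst.
  exact: multX.
- move=> n w; have /andP[f0 f1] := f01 w.
  have h0 : 0 <= f w ^+ n <= 1 by rewrite exprn_ge0//= exprn_ile1.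
  have h1 : 0 <= (1 - f w ^+ n) ^+ (2 ^ n) <= 1.
    by rewrite exprn_ge0 ?exprn_ile1//; lra.
  by rewrite normrM ger0_norm ?mulr_ile1//; [case/andP: h1|case/andP: h1|rewrite indicE; case: (_ \in _); rewrite ?normr1 ?normr0|case/andP: h1].
- move=> w; have /andP[f0 f1] := f01 w.
  have [fw|fw|fw] := ltgtP (f w) 2^-1.
  + rewrite !indicE !mem_set//; last by rewrite /A/= expf_neq0// subr_eq0 lt_eqF.
    rewrite /=.
    under eq_fun do rewrite mulr1.
    by apply: bernstein_lt; rewrite f0.
  + have -> : \1_[set w0 | f w0 < 2^-1] w = 0 :> R.
      by rewrite indicE memNset//= => /lt_trans/(_ fw); rewrite ltxx.
    rewrite indicE.
    rewrite mem_set//=; last by rewrite /A/= expf_neq0// subr_eq0 gt_eqF.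
    under eq_fun do rewrite mulr1.
    by apply: bernstein_gt; rewrite fw.
  + have -> : \1_[set w0 | f w0 < 2^-1] w = 0 :> R.
      by rewrite indicE memNset//= fw ltxx.
    rewrite indicE memNset; last by rewrite /A/= fw subrr expr0n/= eqxx.
    by under eq_fun do rewrite mulr0; exact: cvg_cst.
Qed.

Lemma mult_lt f c : mult f -> mult (\1_[set w | f w < c]).
Proof.
move=> mf; have [_ [M fM] _] := mf.
(* [K] bounds the distance of [f] to [c], so the affine map below sends [f] into [0, 1] and [c] to
   1/2; the summand 1 makes [K] positive. *)
pose K := `|M| + `|c| + 1.
have K0 : 0 < K by rewrite /K ltr_pwDr// addr_ge0.
have := @mult_lt_half (fun w => 2^-1 + (2 * K)^-1 * (f w - c)).
rewrite (_ : [set w | _] = [set w | f w < c]); first apply.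
- apply: multD; first exact: mult_cst.
  by apply: multZ; apply: multB => //; exact: mult_cst.
- move=> w; have h : `|f w - c| <= K.
    by rewrite (le_trans (ler_normB _ _))// /K -[leLHS]addr0 lerD// lerD// (le_trans (fM w))// ler_norm.
  have h' : `|(2 * K)^-1 * (f w - c)| <= 2^-1.
    by rewrite normrM ger0_norm ?invr_ge0 ?mulr_ge0 ?(ltW K0)// ler_pdivrMl ?mulr_gt0// mulrAC mulfV// mul1r.
  by move: h'; rewrite ler_norml => /andP[h1 h2]; apply/andP; split; lra.
- apply/seteqP; split => w /=.
    by rewrite gtrDl pmulr_rlt0 ?invr_gt0 ?mulr_gt0// subr_lt0.
  by rewrite gtrDl pmulr_rlt0 ?invr_gt0 ?mulr_gt0// subr_lt0.
Qed.

Definition multiplier_sets : set (set W) := [set A | mult \1_A].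
Local Notation Sg := multiplier_sets.

Lemma Sg_measurable A : Sg A -> measurable A.
Proof. by case => /measurable_indicP. Qed.

Lemma Sg_setU A B : Sg A -> Sg B -> Sg (A `|` B).
Proof.
move=> SA SB; have := multB (multD SA SB) (multM SA SB).
rewrite /Sg/=; congr mult; apply/funext => w; rewrite !indicE.
rewrite in_setU; case: (_ \in A); case: (_ \in B) => /=; lra.
Qed.

Lemma Sg_set0 : Sg set0.
Proof. by rewrite /Sg/= indic0; exact: (mult_cst 0). Qed.

Lemma Sg_setC A : Sg A -> Sg (~` A).
Proof.
move=> SA; have := multB (mult_cst 1) SA.
rewrite /Sg/=; congr mult; apply/funext => w; rewrite !indicE in_setC.
by case: (_ \in A) => /=; rewrite ?subrr ?subr0.
Qed.

Lemma Sg_bigcup (F : nat -> set W) : (forall n, Sg (F n)) -> Sg (\bigcup_k F k).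
Proof.
move=> SF; pose G n := \big[setU/set0]_(k < n) F k.
apply: (@mult_lim (fun n => \1_(G n)) _ 1).
- move=> n; rewrite /G; elim: n => [|n IH]; first by rewrite big_ord0; exact: Sg_set0.
  by rewrite big_ord_recr; exact: Sg_setU.
- by move=> n w; rewrite indicE; case: (_ \in _); rewrite ?normr1 ?normr0.
- move=> w; rewrite /G indicE; have [[n _ Fnw]|h] := pselect ((\bigcup_k F k) w).
    rewrite mem_set; last by exists n.
    apply: cvg_near_cst; near=> k; rewrite indicE mem_set// -bigcup_mkord.
    by exists n => //=; near: k; exists n.+1.
  rewrite memNset// (_ : (fun n => _) = cst 0); first exact: cvg_cst.
  apply/funext => n; rewrite indicE memNset// => H; apply: h.
  by move: H; rewrite -bigcup_mkord => -[k _ ?]; exists k.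
Unshelve. all: by end_near. Qed.

Lemma Sg_sigma_algebra : sigma_algebra setT Sg.
Proof.
split; [exact: Sg_set0|move=> A SA; rewrite setTD; exact: Sg_setC|exact: Sg_bigcup].
Qed.

Lemma Sg_negligible A : P.-negligible A -> Sg A.
Proof.
move=> nA; have mA := P_complete nA; split.
- exact: measurable_indic.
- by exists 1 => w; rewrite indicE; case: (_ \in _); rewrite ?normr1 ?normr0.
- move=> v cv; have mv := cl_measurable cv.
  have mAv : measurable_fun setT (fun w => \1_A w * v w).
    by apply: measurable_funM => //; exact: measurable_indic.
  apply: cl_lim => // e e0; exists (cst 0); first exact: cl0.
  rewrite (@ae_eq_sqn _ _ _ _ _ (cst 0)).
  + by rewrite /L2sqn; under eq_integral do rewrite expr0n/=; rewrite integral0 lte_fin.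
  + by apply: measurable_funB.
  + exact: measurable_cst.
  + have : {ae P, forall w, ~ A w} by apply: negligibleS nA => w /= /contrapT.
    by apply: filterS => w nAw; rewrite indicE memNset//= mul0r subr0.
Qed.

Lemma Sg_measurableE (A : set W) : measurable (A : set (g_sigma_algebraType Sg)) = Sg A.
Proof. by rewrite (measurable_g_measurableTypeE Sg_sigma_algebra). Qed.

Local Notation measS := (measurable_wrt Sg).

Lemma measS_measurable f : measS f -> measurable_fun setT f.
Proof. by move=> mf _ D mD; rewrite setTI; exact/Sg_measurable/mf. Qed.

Lemma mult_measS f : mult f -> measS f.
Proof.
move=> mf; apply/(measurable_wrtP Sg_sigma_algebra).
apply: (measurability _ (RGenInftyO.measurableE R)) => _ [_ [c ->] <-].
rewrite setTI Sg_measurableE; have := mult_lt c mf.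
by congr Sg; apply/seteqP; split => w /=; rewrite in_itv.
Qed.

Lemma cl_indic A : Sg A -> cl (\1_A).
Proof.
by move=> [_ _ /(_ _ (cl_Pol Pol1))]; congr cl; apply/funext => w /=; rewrite mulr1.
Qed.

Lemma cl_measS_ge0 f : measS f -> (forall w, 0 <= f w) -> (sqn f < +oo)%E -> cl f.
Proof.
move=> mSf f0 sf; have mf := measS_measurable mSf.
have mf' : measurable_fun [set: g_sigma_algebraType Sg] (EFin \o f).
  exact/measurable_EFinP/(measurable_wrtP Sg_sigma_algebra).
(* The simple functions are taken over the sigma-algebra [Sg]: their level sets are multiplier sets,
   whose indicators lie in the closure. *)
pose u := nnsfun_approx measurableT mf'.
apply: (@cl_dominated (fun n w => u n w) f f) => //.
- move=> n; rewrite (_ : (u n : W -> R) = (fun w => \sum_(y <- fset_set (range (u n))) y * \1_(u n @^-1` [set y]) w)).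
    apply: cl_sum => y; apply: clZ; apply: cl_indic.
    by rewrite -Sg_measurableE; exact: measurable_sfunP.
  by apply/funext => w; rewrite fimfunE fsbig_finite.
- move=> w; have := @cvg_nnsfun_approx _ _ R setT measurableT _ mf' (fun w _ => f0 w) w I.
  by move=> /fine_cvgP[].
- move=> n w; rewrite !ger0_norm//.
  have := @le_approx _ (g_sigma_algebraType Sg) R setT (EFin \o f) n w (fun w _ => f0 w) I.
  by rewrite /u nnsfun_approxE lee_fin.
Qed.

(** With this, a density proof reduces to checking that the generators of the target sigma-algebra
    are measurable with respect to [Sg]. *)
Lemma cl_measS f : measS f -> (sqn f < +oo)%E -> cl f.
Proof.
move=> mSf sf; have mf := measS_measurable mSf.
have fE : f = (fun w => Num.max (f w) 0 - Num.max (- f w) 0).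
  by apply/funext => w; rewrite /Num.max; case: ifPn; case: ifPn => //; lra.
have mx : measurable_fun [set: R] (fun x => Num.max x 0) by exact: measurable_maxr.
have mx' : measurable_fun [set: R] (fun x => Num.max (- x) 0).
  by apply: measurable_maxr => //; exact: measurableT_comp.
rewrite fE; apply: clB; apply: cl_measS_ge0.
- exact: (measurable_wrt_comp (phi := fun x => Num.max x 0)).
- by move=> w; rewrite le_max lexx orbT.
- apply: le_lt_trans sf; apply: sqn_le => //; first exact: (measurableT_comp mx).
  by move=> w; rewrite ger0_norm ?le_max ?lexx ?orbT// ge_max ler_norm normr_ge0.
- exact: (measurable_wrt_comp (phi := fun x => Num.max (- x) 0)).
- by move=> w; rewrite le_max lexx orbT.
- apply: le_lt_trans sf; apply: sqn_le => //; first exact: (measurableT_comp mx').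
  by move=> w; rewrite ger0_norm ?le_max ?lexx ?orbT// ge_max normr_ge0 andbT -normrN ler_norm.
Qed.

Lemma mult_sin X c : expmoments P X ->
  (forall p, Pol p -> Pol (fun w => X w * p w)) -> mult (fun w => sin (c * X w)).
Proof.
move=> eX XP; have mX : measurable_fun setT X by case: eX.
have msin : measurable_fun setT (fun w => sin (c * X w)).
  apply: (@measurableT_comp _ _ _ _ _ _ (@sin R)); last exact: measurable_funM.
  by apply: continuous_measurable_fun; exact: continuous_sin.
have sin1 w : `|sin (c * X w)| <= 1.
  by rewrite ler_norml sin_geN1 sin_le1.
split => //; first by exists 1.
have Psum (J : Type) (s : seq J) (F : J -> W -> R) : (forall i, Pol (F i)) ->
    Pol (fun w => \sum_(i <- s) F i w).
  move=> PF; elim: s => [|i s IH].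
    under eq_fun do rewrite big_nil.
    by have := PolZ 0 Pol1; congr Pol; apply/funext => w /=; rewrite mul0r.
  by under eq_fun do rewrite big_cons; exact: PolD.
have PX k p : Pol p -> Pol (fun w => X w ^+ k * p w).
  move=> Pp; elim: k => [|k IH]; first by under eq_fun do rewrite mul1r.
  by under eq_fun do rewrite exprS -mulrA; exact: XP.
have clp p : Pol p -> cl (fun w => sin (c * X w) * p w).
  move=> Pp; have mp := Pol_measurable Pp.
  have mh : moments (fun w => expR (`|c| * `|X w|) * p w).
    by apply: momentsM; [exact: expmoments_expR|exact: PolM].
  apply: (@cl_dominated (fun n w => series (sin_coeff (c * X w)) n * p w) _
    (fun w => expR (`|c| * `|X w|) * p w)).
  - move=> n; apply: cl_Pol; rewrite /series/=.
    under eq_fun do rewrite mulr_suml.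
    apply: (@Psum _ _ (fun k w => sin_coeff (c * X w) k * p w)) => k.
    have := PolZ ((odd k)%:R * (-1) ^+ k.-1./2 / k`!%:R * c ^+ k) (PX k _ Pp).
    by congr Pol; apply/funext => w; rewrite /sin_coeff/= exprMn; ring.
  - exact: measurable_funM.
  - exact: (moments_measurable mh).
  - exact: (moments_sqn mh).
  - move=> w; apply: cvgM; last exact: cvg_cst.
    by rewrite unlock; exact: is_cvg_series_sin_coeff.
  - move=> n w; rewrite !normrM ler_wpM2r// [leRHS]ger0_norm ?expR_ge0//.
    by rewrite -normrM; exact: sin_series_le.
(* From [Pol] to its closure: the sine is bounded by 1, so multiplying by it does not increase the
   L^2 distance. *)
move=> v [mv cv]; have mX' := measurable_funM msin mv.
apply: cl_lim => // e e0; have [p Pp vp] := cv _ e0.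
have mp := Pol_measurable Pp.
exists (fun w => sin (c * X w) * p w); first exact: clp.
apply: le_lt_trans vp; apply: sqn_le.
- by apply: measurable_funB => //; exact: measurable_funM.
- exact: measurable_funB.
- by move=> w; rewrite -mulrBr normrM ler_piMl.
Qed.

Lemma measS_generator X : expmoments P X ->
  (forall p, Pol p -> Pol (fun w => X w * p w)) -> measS X.
Proof.
move=> eX XP; apply: (@measurable_wrt_cvg _ _ _ _ Sg_sigma_algebra (fun n w => n.+1%:R * sin (n.+1%:R^-1 * X w))).
  by move=> n; apply: mult_measS; apply: multZ; exact: mult_sin.
by move=> w; exact: cvg_sin_scaled.
Qed.

End density.

(** * Gaussian spaces and Stein's identity *)

Section taylor.
Context (R : realType).

Lemma expR_taylor1 (x : R) : `|expR x - 1 - x| <= x ^+ 2 * expR `|x|.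
Proof.
have h1 (y : R) : expR y - 1 <= y * expR y.
  have := expR_ge1Dx (- y); have := expR_gt0 y.
  by have := expRxMexpNx_1 y; nra.
rewrite ger0_norm; last by have := expR_ge1Dx x; lra.
have e0 := expR_gt0 x.
have h2 := h1 x.
have [x0|x0] := lerP 0 x.
  by rewrite ger0_norm//; nra.
rewrite ltr0_norm//.
have := expR_ge1Dx x; have := expR_ge1Dx (- x); nra.
Qed.

(** A quadratic remainder is an inequality between expectations, so that differentiating under the
    expectation takes no limit theorem. *)
Lemma is_derive_quadratic (f : R -> R) (l C : R) :
  (forall e, `|e| <= 1 -> `|f e - f 0 - e * l| <= C * e ^+ 2) ->
  is_derive (0 : R) (1 : R) f l.
Proof.
move=> H.
have C0 : 0 <= C.
  by have := H 1; rewrite normr1 lexx expr1n mulr1 => /(_ isT); apply: le_trans.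
suff cv : (fun h : R => h^-1 *: (f (h *: (1:R) + 0) - f 0)) @ 0^' --> l.
  apply: DeriveDef; first by apply/cvg_ex; exists l.
  by apply/cvg_lim.
apply/cvgrPdist_le => e e0.
have d0 : 0 < e / (C + 1) by rewrite divr_gt0// ltr_wpDl.
near=> h.
have h0 : h != 0 by near: h; exact: nbhs_dnbhs_neq.
rewrite /GRing.scale/= mulr1 addr0.
have h1 : `|h| <= 1.
  by near: h; exact: dnbhs0_le.
have h2 : `|h| <= e / (C + 1).
  by near: h; apply: dnbhs0_le.
have -> : l - h^-1 * (f h - f 0) = - (h^-1 * (f h - f 0 - h * l)) by field.
rewrite normrN normrM normfV ler_pdivrMl ?normr_gt0//.
apply: le_trans (H _ h1) _.
rewrite -[h ^+ 2]real_normK ?num_real// expr2 mulrCA ler_wpM2l//.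
apply: (@le_trans _ _ ((C + 1) * `|h|)); first by rewrite ler_wpM2r// lerDl.
by rewrite -ler_pdivlMl 1?mulrC ?ltr_wpDl// mulrC.
Unshelve. all: by end_near. Qed.

(** The source of the moment identities below: one function of a real parameter is written in two
    ways and differentiated at 0. *)
Lemma is_derive_unique (f g : R -> R) a (l l' : R) :
  f =1 g -> is_derive a (1:R) f l -> is_derive a (1:R) g l' -> l = l'.
Proof. by move=> /funext -> [_ <-] [_ <-]. Qed.

End taylor.

(** * Expectations, Gaussian spaces and integration by parts *)

Section expectation.
Context d (W : measurableType d) (R : realType) (P : probability W R).
Implicit Types A B D X Y Z : W -> R.
Local Notation moments := (moments P).
Local Notation expmoments := (expmoments P).
Local Notation "''E' X" := (Rintegral P setT X) (at level 10, X at level 9).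

Lemma RintD A B : moments A -> moments B -> 'E (fun w => A w + B w) = 'E A + 'E B.
Proof. by move=> mA mB; apply: RintegralD => //; exact: moments_integrable. Qed.

Lemma RintB A B : moments A -> moments B -> 'E (fun w => A w - B w) = 'E A - 'E B.
Proof. by move=> mA mB; apply: RintegralB => //; exact: moments_integrable. Qed.

Lemma RintZ c A : moments A -> 'E (fun w => c * A w) = c * 'E A.
Proof. by move=> mA; apply: RintegralZl => //; exact: moments_integrable. Qed.

Lemma Rint_ext A B : (forall w, A w = B w) -> 'E A = 'E B.
Proof. by move=> /funext ->. Qed.

Lemma Rint_norm_le A B : moments A -> moments B -> (forall w, `|A w| <= B w) ->
  `|'E A| <= 'E B.
Proof.
move=> mA mB AB; apply: le_trans (le_normr_Rintegral _ _) _ => //.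
  exact: moments_integrable.
apply: le_Rintegral => //.
  by apply: integrable_norm; exact: moments_integrable.
exact: moments_integrable.
Qed.

(** Young's inequality with a free weight [l] stands in for Cauchy-Schwarz: no square roots, and
    each use picks its own [l]. *)
Lemma expectation_mul_le (X Y : W -> R) l : measurable_fun setT X -> measurable_fun setT Y ->
  (L2sqn P X < +oo)%E -> (L2sqn P Y < +oo)%E -> 0 < l ->
  'E (fun w => X w * Y w) <= l * 'E (fun w => X w ^+ 2) + (4 * l)^-1 * 'E (fun w => Y w ^+ 2).
Proof.
move=> mX mY sX sY l0; have iX := integrable_sqr mX sX; have iY := integrable_sqr mY sY.
rewrite -!RintegralZl// -RintegralD//; [|exact: integrable_funZ|exact: integrable_funZ].
apply: le_Rintegral => //; first exact: integrable_mul2.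
  by apply: integrable_funD; exact: integrable_funZ.
move=> w _; rewrite -subr_ge0 (_ : _ - _ = (4 * l)^-1 * (2 * l * X w - Y w) ^+ 2).
  by rewrite mulr_ge0 ?sqr_ge0// invr_ge0 mulr_ge0// ltW.
by field; rewrite gt_eqF.
Qed.

Lemma RintcstE c : 'E (cst c) = c.
Proof.
transitivity (c * fine (P setT)); first exact: Rintegral_cst.
by rewrite probability_setT mulr1.
Qed.

Lemma sqnE A : moments A -> L2sqn P A = ('E (fun w => A w ^+ 2))%:E.
Proof.
move=> mA; rewrite /Rintegral fineK//.
by apply: integrable_fin_num => //; exact/moments_integrable/momentsX.
Qed.

Lemma moments_norm A : moments A -> moments (fun w => `|A w|).
Proof.
move=> mA; apply: (@moments_le _ _ _ _ _ A) => //.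
  by apply: measurableT_comp => //; exact: moments_measurable mA.
by move=> w; rewrite normr_id.
Qed.

(** For |e| <= 1 the second-order remainder is dominated by |A| X^2 exp|X|, which is integrable. *)
Lemma is_derive_expectation A X : moments A -> expmoments X ->
  is_derive (0:R) (1:R) (fun e => 'E (fun w => A w * expR (e * X w)))
    ('E (fun w => A w * X w)).
Proof.
move=> mA eX; have mX := expmoments_moments eX.
apply: (@is_derive_quadratic _ _ _ ('E (fun w => `|A w| * (X w ^+ 2 * expR (1 * `|X w|))))).
move=> e e1.
have mAe c : moments (fun w => A w * expR (c * X w)).
  by apply: momentsM => //; exact: expmoments_expRZ.
have mAX : moments (fun w => A w * X w) by exact: momentsM.
have mb : moments (fun w => `|A w| * (X w ^+ 2 * expR (1 * `|X w|))).
  apply: momentsM; first exact: moments_norm.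
  by apply: momentsM; [exact: momentsX|exact: expmoments_expR].
rewrite -RintB// -RintZ// -RintB//; last 2 first.
  exact: momentsB.
  exact: moments_scale.
rewrite mulrC -RintZ//.
apply: Rint_norm_le.
- by apply: momentsB; [exact: momentsB|exact: moments_scale].
- exact: moments_scale.
move=> w.
have -> : A w * expR (e * X w) - A w * expR (0 * X w) - e * (A w * X w) =
    A w * (expR (e * X w) - 1 - e * X w) by rewrite mul0r expR0; ring.
rewrite normrM mulrCA ler_wpM2l//.
apply: le_trans (expR_taylor1 _) _.
rewrite exprMn -mulrA ler_wpM2l ?sqr_ge0// ler_wpM2l ?sqr_ge0// ler_expR.
by rewrite normrM ler_wpM2r.
Qed.

(** Centred Gaussian laws are encoded by the moment generating function, which passes to L^2 limits;
    closure under linear combinations makes the family jointly Gaussian. That [s] acts as the second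
    moment is derived in [gaussian_mgf]. *)
Definition gaussian_space (Gs : set (W -> R)) :=
  [/\ forall X Y, Gs X -> Gs Y -> Gs (fun w => X w + Y w),
      forall c X, Gs X -> Gs (fun w => c * X w) &
      forall X, Gs X -> measurable_fun setT X /\
        exists s : R, forall c : R,
          (\int[P]_w (expR (c * X w))%:E)%E = (expR (c ^+ 2 * s / 2))%:E].

Context (Gs : set (W -> R)) (GsG : gaussian_space Gs).

Let GsD X Y : Gs X -> Gs Y -> Gs (fun w => X w + Y w).
Proof. case: GsG => + _ _; exact. Qed.

Let GsZ c X : Gs X -> Gs (fun w => c * X w).
Proof. case: GsG => _ + _; exact. Qed.

Lemma gaussian_expmoments X : Gs X -> expmoments X.
Proof.
case: GsG => _ _ /[apply] -[mX [s sX]]; split => // c.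
have ic (e : R) : P.-integrable setT (EFin \o (fun w => expR (e * X w))).
  apply/integrableP; split.
    apply/measurable_EFinP; apply: measurableT_comp => //.
    exact: measurable_funM.
  rewrite (_ : (\int[P]_w _)%E = (expR (e ^+ 2 * s / 2))%:E) ?ltry// -sX.
  by apply: eq_integral => w _ /=; rewrite ger0_norm// expR_ge0.
apply: (@integrable_leE _ _ _ _ _ (fun w => expR (c * X w) + expR (- c * X w))).
- apply: measurableT_comp => //; apply: measurable_funM => //.
  exact: measurableT_comp.
- move=> w; rewrite ger0_norm ?expR_ge0//.
  have [X0|X0] := lerP 0 (X w).
    by rewrite ger0_norm// lerDl expR_ge0.
  by rewrite ltr0_norm// mulrN mulNr lerDr expR_ge0.
- apply: (@eq_integrable _ _ _ P _ measurableT
    (fun w => (expR (c * X w))%:E + (expR (- c * X w))%:E)%E).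
    by move=> w _ /=; rewrite EFinD.
  by apply: integrableD => //; exact: ic.
Qed.

Let GsM X : Gs X -> moments X.
Proof. by move=> /gaussian_expmoments/expmoments_moments. Qed.

Let GsE X : Gs X -> moments (fun w => expR (X w)).
Proof.
move=> /gaussian_expmoments/(expmoments_expRZ 1); congr moments.
by apply/funext => w; rewrite mul1r.
Qed.

Lemma gaussian_mgf X c : Gs X ->
  'E (fun w => expR (c * X w)) = expR (c ^+ 2 * 'E (fun w => X w ^+ 2) / 2).
Proof.
move=> GX; have [_ _ /(_ _ GX)[mX [s sX]]] := GsG.
have eX := gaussian_expmoments GX.
have EX e : 'E (fun w => expR (e * X w)) = expR (e ^+ 2 * s / 2).
  by rewrite /Rintegral sX.
(* The second moment is the second derivative at 0, so the first derivative is needed at every [e];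
   shifting [e] by [h] turns it into a derivative at 0. *)
have EX1 e : 'E (fun w => expR (e * X w) * X w) = e * s * expR (e ^+ 2 * s / 2).
  apply: (@is_derive_unique _ (fun h => 'E (fun w => expR (e * X w) * expR (h * X w)))
    (fun h => expR ((e + h) ^+ 2 * s / 2)) 0).
  - move=> h; rewrite -EX; apply: Rint_ext => w; rewrite -expRD; congr expR; ring.
  - by apply: is_derive_expectation => //; exact: expmoments_expRZ.
  - apply: is_derive_eq; rewrite /GRing.scale/=.
    by rewrite addr0; field.
suff sE : 'E (fun w => X w ^+ 2) = s by rewrite sE; exact: EX.
apply: (@is_derive_unique _ (fun h => 'E (fun w => X w * expR (h * X w)))
    (fun h => h * s * expR (h ^+ 2 * s / 2)) 0).
- by move=> h; rewrite -EX1; apply: Rint_ext => w; rewrite mulrC.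
- have := is_derive_expectation (GsM GX) eX.
  by congr is_derive; apply: Rint_ext => w; rewrite expr2.
- apply: is_derive_eq; rewrite /GRing.scale/=.
  by rewrite expr0n/= !mul0r expR0; field.
Qed.

Lemma gaussian_expR X : Gs X -> 'E (fun w => expR (X w)) = expR ('E (fun w => X w ^+ 2) / 2).
Proof.
move=> /(gaussian_mgf 1); rewrite expr1n mul1r => <-.
by apply: Rint_ext => w; rewrite mul1r.
Qed.

(** Derivative at [h = 0] of E[exp(Z + h X)], where Z + h X is again Gaussian. *)
Lemma gaussian_stein_expR X Z : Gs X -> Gs Z ->
  'E (fun w => X w * expR (Z w)) = 'E (fun w => X w * Z w) * 'E (fun w => expR (Z w)).
Proof.
move=> GX GZ.
pose v := 'E (fun w => Z w ^+ 2); pose c := 'E (fun w => X w * Z w).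
pose u := 'E (fun w => X w ^+ 2).
apply: (@is_derive_unique _ (fun h => 'E (fun w => expR (Z w) * expR (h * X w)))
    (fun h => expR ((v + 2 * h * c + h ^+ 2 * u) / 2)) 0).
- move=> h; transitivity ('E (fun w => expR (Z w + h * X w))).
    by apply: Rint_ext => w; rewrite expRD.
  rewrite gaussian_expR; last by apply: GsD => //; exact: GsZ.
  congr (expR (_ / 2)).
  have m1 := momentsX 2 (GsM GZ); have m2 := momentsX 2 (GsM GX).
  have m3 := momentsM (GsM GX) (GsM GZ).
  transitivity ('E (fun w => Z w ^+ 2 + (2 * h * (X w * Z w) + h ^+ 2 * X w ^+ 2))).
    by apply: Rint_ext => w; ring.
  rewrite RintD//; last by apply: momentsD; exact: moments_scale.
  by rewrite RintD ?RintZ ?addrA//; exact: moments_scale.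
- have := is_derive_expectation (GsE GZ) (gaussian_expmoments GX).
  by congr is_derive; apply: Rint_ext => w; rewrite mulrC.
- apply: is_derive_eq; rewrite /GRing.scale/= (gaussian_expR GZ) -/v -/c.
  by rewrite !(mulr0, mul0r, expr0n, addr0)/=; field.
Qed.

(* D stands for the derivative of A in the direction of X.  Testing against
   all exp Z makes the relation stable under multiplication of A by elements
   of Gs. *)
Definition stein_pair X A D := [/\ moments A, moments D &
  forall Z, Gs Z -> 'E (fun w => X w * A w * expR (Z w)) =
    'E (fun w => X w * Z w) * 'E (fun w => A w * expR (Z w)) +
    'E (fun w => D w * expR (Z w))].

Lemma stein_pair1 X : Gs X -> stein_pair X (cst 1) (cst 0).
Proof.
move=> GX; split; [exact: moments_cst|exact: moments_cst|move=> Z GZ].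
have -> : 'E (fun w => cst 0 w * expR (Z w)) = 0.
  by rewrite -[RHS](RintcstE 0); apply: Rint_ext => w; rewrite mul0r.
rewrite addr0.
have -> : 'E (fun w => X w * cst 1 w * expR (Z w)) = 'E (fun w => X w * expR (Z w)).
  by apply: Rint_ext => w; rewrite mulr1.
rewrite gaussian_stein_expR//; congr (_ * _).
by apply: Rint_ext => w; rewrite mul1r.
Qed.

Lemma stein_pairD X A D A' D' : Gs X -> stein_pair X A D -> stein_pair X A' D' ->
  stein_pair X (fun w => A w + A' w) (fun w => D w + D' w).
Proof.
move=> GX [mA mD H] [mA' mD' H']; split; [exact: momentsD|exact: momentsD|move=> Z GZ].
have mX := GsM GX; have mZ := GsE GZ.
have -> : 'E (fun w => X w * (A w + A' w) * expR (Z w)) =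
   'E (fun w => X w * A w * expR (Z w)) + 'E (fun w => X w * A' w * expR (Z w)).
  rewrite -RintD; first by apply: Rint_ext => w; rewrite mulrDr mulrDl.
  - exact: (momentsM (momentsM mX mA) mZ).
  - exact: (momentsM (momentsM mX mA') mZ).
have -> : 'E (fun w => (A w + A' w) * expR (Z w)) =
   'E (fun w => A w * expR (Z w)) + 'E (fun w => A' w * expR (Z w)).
  rewrite -RintD; first by apply: Rint_ext => w; rewrite mulrDl.
  - exact: (momentsM mA mZ).
  - exact: (momentsM mA' mZ).
have -> : 'E (fun w => (D w + D' w) * expR (Z w)) =
   'E (fun w => D w * expR (Z w)) + 'E (fun w => D' w * expR (Z w)).
  rewrite -RintD; first by apply: Rint_ext => w; rewrite mulrDl.
  - exact: (momentsM mD mZ).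
  - exact: (momentsM mD' mZ).
by rewrite (H _ GZ) (H' _ GZ); ring.
Qed.

Lemma stein_pairZ X c A D : Gs X -> stein_pair X A D ->
  stein_pair X (fun w => c * A w) (fun w => c * D w).
Proof.
move=> GX [mA mD H]; split; [exact: moments_scale|exact: moments_scale|move=> Z GZ].
have mX := GsM GX; have mZ := GsE GZ.
have -> : 'E (fun w => X w * (c * A w) * expR (Z w)) =
   c * 'E (fun w => X w * A w * expR (Z w)).
  rewrite -RintZ; first by apply: Rint_ext => w; ring.
  exact: (momentsM (momentsM mX mA) mZ).
have -> : 'E (fun w => (c * A w) * expR (Z w)) = c * 'E (fun w => A w * expR (Z w)).
  by rewrite -RintZ; [apply: Rint_ext => w; ring|exact: (momentsM mA mZ)].
have -> : 'E (fun w => (c * D w) * expR (Z w)) = c * 'E (fun w => D w * expR (Z w)).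
  by rewrite -RintZ; [apply: Rint_ext => w; ring|exact: (momentsM mD mZ)].
by rewrite (H _ GZ); ring.
Qed.

(** The relation tested against [Z + h * Y] and differentiated at [h = 0] brings down the factor
    [Y]; the covariance of [X] with [Z + h * Y] contributes the new term of the derivative. *)
Lemma stein_pairX X Y A D : Gs X -> Gs Y -> stein_pair X A D ->
  stein_pair X (fun w => Y w * A w)
    (fun w => Y w * D w + 'E (fun w => X w * Y w) * A w).
Proof.
move=> GX GY [mA mD H].
have mX := GsM GX; have mY := GsM GY.
have m0 : moments (fun w => Y w * D w + 'E (fun w => X w * Y w) * A w).
  by apply: momentsD; [exact: momentsM|exact: moments_scale].
split => //; first exact: momentsM.
move=> Z GZ; have mZ := GsE GZ; have mZ' := GsM GZ.
have eY := gaussian_expmoments GY.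
pose cXY := 'E (fun w => X w * Y w); pose cXZ := 'E (fun w => X w * Z w).
have mAZ := momentsM mA mZ; have mDZ := momentsM mD mZ.
have mXAZ := momentsM (momentsM mX mA) mZ.
have E1 := is_derive_expectation mXAZ eY.
have E2 := is_derive_expectation mAZ eY.
have E3 := is_derive_expectation mDZ eY.
have key : 'E (fun w => X w * A w * expR (Z w) * Y w) =
   cXY * 'E (fun w => A w * expR (Z w)) + cXZ * 'E (fun w => A w * expR (Z w) * Y w)
   + 'E (fun w => D w * expR (Z w) * Y w).
  apply: (is_derive_unique (f := fun h => 'E (fun w => X w * A w * expR (Z w) * expR (h * Y w)))
    (g := fun h => (cXZ + h * cXY) * 'E (fun w => A w * expR (Z w) * expR (h * Y w)) +
      'E (fun w => D w * expR (Z w) * expR (h * Y w)))) E1 _.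
  - move=> h; have GZY : Gs (fun w => Z w + h * Y w) by apply: GsD => //; exact: GsZ.
    have := H _ GZY.
    have -> : 'E (fun w => X w * (Z w + h * Y w)) = cXZ + h * cXY.
      rewrite /cXZ /cXY -RintZ; last exact: momentsM.
      rewrite -RintD; [|exact: momentsM|apply: moments_scale; exact: momentsM].
      by apply: Rint_ext => w; ring.
    have Ee V : 'E (fun w => V w * expR (Z w + h * Y w)) =
        'E (fun w => V w * expR (Z w) * expR (h * Y w)).
      by apply: Rint_ext => w; rewrite expRD mulrA.
    by rewrite (Ee (fun w => X w * A w)) !Ee.
  - apply: is_derive_eq; rewrite /GRing.scale/=.
    have e0 : 'E (fun w => A w * expR (Z w) * expR (0 * Y w)) = 'E (fun w => A w * expR (Z w)).
      by apply: Rint_ext => w; rewrite mul0r expR0 mulr1.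
    by rewrite e0; ring.
have -> : 'E (fun w => X w * (Y w * A w) * expR (Z w)) =
  'E (fun w => X w * A w * expR (Z w) * Y w) by apply: Rint_ext => w; ring.
have -> : 'E (fun w => Y w * A w * expR (Z w)) =
  'E (fun w => A w * expR (Z w) * Y w) by apply: Rint_ext => w; ring.
have -> : 'E (fun w => (Y w * D w + cXY * A w) * expR (Z w)) =
  'E (fun w => D w * expR (Z w) * Y w) + cXY * 'E (fun w => A w * expR (Z w)).
  rewrite -RintZ// -RintD; [|exact: (momentsM mDZ mY)|exact: moments_scale].
  by apply: Rint_ext => w; ring.
by rewrite key /cXZ /cXY; ring.
Qed.

Lemma stein_pair_horner X Y (p : {poly R}) A D : Gs X -> Gs Y -> stein_pair X A D ->
  stein_pair X (fun w => p.[Y w] * A w)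
    (fun w => p.[Y w] * D w + 'E (fun w => X w * Y w) * p^`().[Y w] * A w).
Proof.
move=> GX GY HA; elim/poly_ind: p => [|p c IH].
  have := stein_pairZ 0 GX HA; congr stein_pair; apply/funext => w.
    by rewrite horner0.
  by rewrite derivC horner0 !mul0r mulr0 mul0r addr0.
have := stein_pairD GX (stein_pairX GX GY IH) (stein_pairZ c GX HA).
congr stein_pair; apply/funext => w.
  by rewrite hornerMXaddC; ring.
by rewrite !(derivD, derivM, derivX, derivC, hornerE)/=; ring.
Qed.

(** The case of the zero test variable, which [Gs] contains as [0 * X]. *)
Lemma stein_pairE X A D : Gs X -> stein_pair X A D -> 'E (fun w => X w * A w) = 'E D.
Proof.
move=> GX [mA mD /(_ _ (GsZ 0 GX))].
have -> : 'E (fun w => X w * A w * expR (0 * X w)) = 'E (fun w => X w * A w).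
  by apply: Rint_ext => w; rewrite mul0r expR0 mulr1.
have -> : 'E (fun w => D w * expR (0 * X w)) = 'E D.
  by apply: Rint_ext => w; rewrite mul0r expR0 mulr1.
have -> : 'E (fun w => X w * (0 * X w)) = 0.
  by rewrite -[RHS](RintcstE 0); apply: Rint_ext => w; rewrite mul0r mulr0.
by rewrite mul0r add0r.
Qed.

End expectation.

(** * Step integrals of Brownian motion *)

Section integral_pair.
Import HBSimple HBNNSimple.
Context d (T : measurableType d) d1 (T1 : measurableType d1) d2 (T2 : measurableType d2).
Context (R : realType) (mu1 : {measure set T1 -> \bar R}) (mu2 : {measure set T2 -> \bar R}).
Context (X1 : T1 -> T) (X2 : T2 -> T) (h1 : T1 -> R) (h2 : T2 -> R).
Context (mX1 : measurable_fun setT X1) (mX2 : measurable_fun setT X2).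
Context (mh1 : measurable_fun setT h1) (mh2 : measurable_fun setT h2).
Context (h1_ge0 : forall x, 0 <= h1 x) (h2_ge0 : forall x, 0 <= h2 x).

(** The weights [h1] and [h2] allow three uses: a density with respect to Lebesgue measure, the
    remaining factors of an independent product, and the variable under a conditional
    expectation. *)
Lemma ge0_integral_ext_indic (f : T -> R) :
  (forall D, measurable D ->
    (\int[mu1]_x (\1_D (X1 x) * h1 x)%:E = \int[mu2]_x (\1_D (X2 x) * h2 x)%:E)%E) ->
  measurable_fun setT f -> (forall x, 0 <= f x) ->
  (\int[mu1]_x (f (X1 x) * h1 x)%:E = \int[mu2]_x (f (X2 x) * h2 x)%:E)%E.
Proof.
move=> HD mf f0.
have mf' : measurable_fun setT (EFin \o f) by exact/measurable_EFinP.
pose u := nnsfun_approx measurableT mf'.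
have simple d' (S : measurableType d') (mu : {measure set S -> \bar R}) (X : S -> T) (h : S -> R) n :
    measurable_fun setT X -> measurable_fun setT h -> (forall x, 0 <= h x) ->
    (\int[mu]_x (u n (X x) * h x)%:E = \sum_(y <- fset_set (range (u n)))
      y%:E * \int[mu]_x (\1_(u n @^-1` [set y]) (X x) * h x)%:E)%E.
  move=> mX mh h0.
  have y0 y : y \in fset_set (range (u n)) -> 0 <= y.
    by rewrite in_fset_set// inE => -[x _ <-].
  have m1 y : measurable_fun setT (fun x => (\1_(u n @^-1` [set y]) (X x) * h x)%:E).
    apply/measurable_EFinP; apply: measurable_funM => //.
    by apply: (measurableT_comp _ mX); apply: measurable_indic; exact: measurable_sfunP.
  have p0 y x : (0 <= (\1_(u n @^-1` [set y]) (X x) * h x)%:E)%E.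
    by rewrite lee_fin mulr_ge0// indicE; case: (_ \in _).
  under eq_integral => x _.
    rewrite fimfunE fsbig_finite//= mulr_suml -sumEFin.
    (* Only values in the range are known to be non-negative; [Num.max y 0] makes every summand
       so. *)
    rewrite (eq_big_seq (fun y => (Num.max y 0)%:E * (\1_(u n @^-1` [set y]) (X x) * h x)%:E)%E); last first.
      by move=> y /y0 yp; rewrite -EFinM mulrA /Num.max; case: ltgtP yp => // <-.
    over.
  rewrite ge0_integral_sum//; last 2 first.
  - by move=> y; exact: measurable_funeM.
  - by move=> y x _; apply: mule_ge0 => //; rewrite lee_fin le_max lexx orbT.
  apply: eq_big_seq => y /y0 yp; rewrite ge0_integralZl//; last by rewrite lee_fin le_max lexx orbT.
  by congr (_%:E * _)%E; rewrite /Num.max; case: ltgtP yp => // <-.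
have lim d' (S : measurableType d') (mu : {measure set S -> \bar R}) (X : S -> T) (h : S -> R) :
    measurable_fun setT X -> measurable_fun setT h -> (forall x, 0 <= h x) ->
    (\int[mu]_x (f (X x) * h x)%:E = limn (fun n => \int[mu]_x (u n (X x) * h x)%:E))%E.
  move=> mX mh h0; rewrite -monotone_convergence//.
  - apply: eq_integral => x _; apply/esym/cvg_lim => //.
    apply/fine_cvgP; split; first exact: nearW.
    rewrite /comp/=; apply: cvgM; last exact: cvg_cst.
    by have := @cvg_nnsfun_approx _ _ R setT measurableT _ mf' (fun w _ => f0 w) (X x) I; move=> /fine_cvgP[].
  - by move=> n; apply/measurable_EFinP; apply: measurable_funM => //; exact: measurableT_comp.
  - by move=> n x _; rewrite lee_fin mulr_ge0.
  - move=> x _ a b ab; rewrite lee_fin ler_wpM2r//.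
    by have := @nd_nnsfun_approx _ _ R setT measurableT _ mf' a b ab; move/lefP; exact.
rewrite (lim _ _ mu1)// (lim _ _ mu2)//; congr (limn _); apply/funext => n.
rewrite (simple _ _ mu1)// (simple _ _ mu2)//; apply: eq_bigr => y _; congr (_ * _)%E.
by apply: HD; exact: measurable_sfunP.
Qed.

End integral_pair.

Lemma probability_preimageE d (W : measurableType d) (R : realType) (P : probability W R)
    (X : W -> R) (D : set R) : measurable_fun setT X -> measurable D ->
  (P [set w | D (X w)] = \int[P]_w (\1_D (X w))%:E)%E.
Proof.
move=> mX mD.
rewrite (_ : (fun w => (\1_D (X w))%:E) = (fun w => (\1_[set w | D (X w)] w)%:E)).
  rewrite integral_indic ?setIT//.
  by rewrite -[X in measurable X]setTI; exact: mX.
by apply/funext => x; rewrite !indicE; congr (_%:R%:E); apply/idP/idP; rewrite !inE.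
Qed.

(** * Moment generating function of a normal law *)

Section normal_mgf.
Context (R : realType).

(** Completing the square: the exponential tilt moves the mean from 0 to [c * s ^+ 2]. *)
Lemma normal_pdf_tilt (c s x : R) : s != 0 ->
  expR (c * x) * normal_pdf 0 s x = expR (c ^+ 2 * s ^+ 2 / 2) * normal_pdf (c * s ^+ 2) s x.
Proof.
move=> s0; rewrite !normal_pdfE// /normal_fun mulrCA [RHS]mulrCA; congr (_ * _).
rewrite -!expRD; congr expR; rewrite -mulr_natr subr0; field.
by rewrite s0.
Qed.

Lemma normal_mgf d (W : measurableType d) (P : probability W R) (X : W -> R) (s c : R) :
  measurable_fun setT X -> s != 0 ->
  (forall D, measurable D -> P [set w | D (X w)] = normal_prob 0 s D) ->
  (\int[P]_w (expR (c * X w))%:E = (expR (c ^+ 2 * s ^+ 2 / 2))%:E)%E.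
Proof.
move=> mX s0 XD.
transitivity (\int[P]_w (expR (c * X w) * 1)%:E)%E.
  by apply: eq_integral => w _; rewrite mulr1.
rewrite (@ge0_integral_ext_indic _ _ _ _ _ _ R P (@lebesgue_measure R) X id
  (cst 1) (normal_pdf 0 s) _ _ _ _ _ _ (fun x => expR (c * x)) _ _ (fun x => expR_ge0 _)) //=; first last.
- by apply: measurableT_comp => //; exact: measurable_funM.
- move=> D mD.
  have -> : (\int[P]_x (\1_D (X x) * 1)%:E = P [set w | D (X w)])%E.
    by rewrite probability_preimageE//; under eq_integral do rewrite mulr1.
  rewrite XD// /normal_prob integral_mkcond.
  apply: eq_integral => x _; rewrite patchE indicE.
  by case: (x \in D); rewrite ?mul1r ?mul0r.
- by move=> x; exact: normal_pdf_ge0.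
- exact: measurable_normal_pdf.
transitivity (\int[lebesgue_measure]_x ((expR (c ^+ 2 * s ^+ 2 / 2))%:E * (normal_pdf (c * s ^+ 2) s x)%:E))%E.
  by apply: eq_integral => x _; rewrite -EFinM normal_pdf_tilt.
rewrite ge0_integralZl//.
- by rewrite integral_normal_pdf mule1.
- by apply/measurable_EFinP; exact: measurable_normal_pdf.
- by move=> x _; rewrite lee_fin normal_pdf_ge0.
Qed.

End normal_mgf.

(** * Expectation of a product of independent factors *)

Section factorization.
Context d (W : measurableType d) (R : realType) (P : probability W R).
Context (Q : finType) (X : Q -> W -> R) (mX : forall q, measurable_fun setT (X q)).
Context (indep : forall D : Q -> set R, (forall q, measurable (D q)) ->
  P [set w | forall q, D q (X q w)] = (\prod_q P [set w | D q (X q w)])%E).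
Context (f : Q -> R -> R) (mf : forall q, measurable_fun setT (f q)).
Context (f_ge0 : forall q x, 0 <= f q x) (a : Q -> R) (a_ge0 : forall q, 0 <= a q).
Context (fa : forall q, (\int[P]_w (f q (X q w))%:E = (a q)%:E)%E).

(** Independence is given for events only; the factors pass from indicators to functions one at a
    time, the list [s] recording those already replaced. *)
Lemma expectation_prod_indep :
  (\int[P]_w (\prod_q f q (X q w))%:E = (\prod_q a q)%:E)%E.
Proof.
suff H (s : seq Q) (D : Q -> set R) : uniq s -> (forall q, measurable (D q)) ->
    (\int[P]_w (\prod_q (if q \in s then f q (X q w) else \1_(D q) (X q w)))%:E =
      (\prod_q (if q \in s then a q else fine (P [set w | D q (X q w)])))%:E)%E.
  have := H (enum Q) (fun=> setT) (enum_uniq _) (fun=> measurableT).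
  under eq_integral do under eq_bigr do rewrite mem_enum/=.
  by move=> ->; congr EFin; apply: eq_bigr => q _; rewrite mem_enum.
elim: s D => [|q0 s IH] D us mD.
  rewrite (big_morph EFin (@EFinM R) erefl).
  transitivity (\prod_q P [set w | D q (X q w)])%E; last first.
    apply: eq_bigr => q _ /=; rewrite fineK//.
    by apply: fin_num_measure; rewrite -[X in measurable X]setTI; exact: mX.
  rewrite -indep//.
  have E w : \prod_q (\1_(D q) (X q w)) = \1_[set w | forall q, D q (X q w)] w :> R.
    rewrite indicE; have [H|/existsNP[q Hq]] := pselect (forall q, D q (X q w)).
      by rewrite mem_set// big1// => q _; rewrite indicE mem_set.
    rewrite memNset; last by move=> /(_ q).
    by rewrite (bigD1 q)//= indicE memNset// mul0r.
  have mA : measurable [set w | forall q, D q (X q w)].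
    apply/(@measurable_indicP _ W R); rewrite -(funext E).
    apply: measurable_prod => q _; apply: (measurableT_comp _ (mX q)).
    exact: measurable_indic.
  by under eq_integral do rewrite /= E; rewrite integral_indic// setIT.
move: us => /= /andP[q0s us].
pose F D' q w := if q \in s then f q (X q w) else \1_(D' q) (X q w).
pose h w := \prod_(q | q != q0) F D q w.
pose c := \prod_(q | q != q0) (if q \in s then a q else fine (P [set w | D q (X q w)])).
have F0 D' q w : 0 <= F D' q w.
  by rewrite /F; case: ifP => // _; rewrite indicE; case: (_ \in _).
have h0 w : 0 <= h w by apply: prodr_ge0 => q _.
have mh : measurable_fun setT h.
  rewrite /h; under eq_fun do rewrite big_mkcond/=.
  apply: (@measurable_prod _ W R setT _ (index_enum Q) (fun q w => if q != q0 then F D q w else 1)) => q _.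
  case: (q != q0); last exact: measurable_cst.
  rewrite /F; case: (q \in s); first exact: measurableT_comp.
  by apply: (measurableT_comp _ (mX q)); exact: measurable_indic.
have c0 : 0 <= c.
  by apply: prodr_ge0 => q _; case: ifP => // _; apply: fine_ge0.
transitivity (\int[P]_w (f q0 (X q0 w) * h w)%:E)%E.
  apply: eq_integral => w _; congr EFin.
  rewrite (bigD1 q0)//= inE eqxx/=; congr (_ * _).
  by apply: eq_bigr => q /negbTE qq0; rewrite inE qq0.
transitivity (\int[P]_w (f q0 (X q0 w) * cst c w)%:E)%E; last first.
  under eq_integral do rewrite /= mulrC EFinM.
  rewrite ge0_integralZl//.
  - rewrite fa -EFinM mulrC; congr EFin.
    rewrite [RHS](bigD1 q0)//= inE eqxx/=; congr (_ * _).
    by apply: eq_bigr => q /negbTE qq0; rewrite inE qq0.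
  - by apply/measurable_EFinP; exact: measurableT_comp.
  - by move=> w _; rewrite lee_fin.
apply: ge0_integral_ext_indic => // D0 mD0.
(* With the set [D0] in slot [q0] the product falls under the induction hypothesis, since [q0] is
   not in [s]. *)
pose D' q := if q == q0 then D0 else D q.
have mD' q : measurable (D' q) by rewrite /D'; case: ifP.
have e w : \1_D0 (X q0 w) * h w = \prod_q F D' q w.
  rewrite [RHS](bigD1 q0)//= {1}/F (negbTE q0s) /D' eqxx; congr (_ * _).
  by apply: eq_bigr => q /negbTE qq0; rewrite /F/= qq0.
under eq_integral do rewrite e.
rewrite IH//.
under eq_integral do rewrite /= mulrC EFinM.
rewrite ge0_integralZl//.
- rewrite -probability_preimageE// (bigD1 q0)//= (negbTE q0s) /D' eqxx.
  rewrite -[P _ in RHS]fineK; last first.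
    by apply: fin_num_measure; rewrite -[X in measurable X]setTI; exact: mX.
  rewrite -EFinM mulrC; congr (_ * _)%:E.
  by apply: eq_bigr => q /negbTE qq0; rewrite qq0.
- apply/measurable_EFinP; apply: (measurableT_comp _ (mX q0)).
  exact: measurable_indic.
Qed.

End factorization.

(** * Step integrands on a common grid *)

Section grid.
Context (R : realType).

Lemma sorted_grid (r : seq R) T : 0 <= T -> {in r, forall x, 0 <= x <= T} ->
  exists (N : nat) (s : nat -> R) (ix : R -> nat),
    [/\ 0 <= s 0%N, s N <= T, forall j, (j < N)%N -> s j < s j.+1 &
      {in r, forall x, (ix x <= N)%N /\ s (ix x) = x}].
Proof.
(* [T] keeps the list non-empty; [N] will count the cells, one less than the points. *)
move=> T0 rT; pose p := sort <=%R (undup (T :: r)).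
have mp x : (x \in p) = (x \in T :: r) by rewrite mem_sort mem_undup.
have sp : sorted <%R p by rewrite sort_lt_sorted undup_uniq.
have p0 : (0 < size p)%N.
  by rewrite (@leq_ltn_trans (index T p))// index_mem mp mem_head.
have pT x : x \in p -> 0 <= x <= T.
  by rewrite mp inE => /predU1P[->|/rT//]; rewrite T0/=.
exists (size p).-1, (nth 0 p), (index^~ p); split.
- by have /pT/andP[] : nth 0 p 0 \in p by exact: mem_nth.
- by have /pT/andP[] : nth 0 p (size p).-1 \in p by rewrite mem_nth// prednK.
- move=> j jN; apply: (sortedP 0 _); rewrite //.
  by rewrite -ltn_predRL.
- move=> x xr; have xp : x \in p by rewrite mp inE xr orbT.
  by rewrite nth_index// -ltnS prednK// index_mem.
Qed.

(** A telescoping sum, spread over the whole grid whatever [i] and [j] are, so that sums over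
    several intervals can be exchanged. [F] is used both as a path and as the function x -> 1_{u <=
    x}. *)
Lemma grid_increment (V : zmodType) (F : R -> V) (s : nat -> R) N (i j : nat) :
  (i <= j)%N -> (j <= N)%N ->
  F (s j) - F (s i) = \sum_(k < N) (F (s k.+1) - F (s k)) *+ (i <= k < j)%N.
Proof.
move=> ij jN.
rewrite -(big_mkord xpredT (fun k => (F (s k.+1) - F (s k)) *+ (i <= k < j)%N)).
rewrite (big_cat_nat (leq0n i) (leq_trans ij jN)) /= (big_cat_nat ij jN)/=.
rewrite big1_seq ?add0r; last first.
  by move=> k; rewrite mem_index_iota => /andP[_ /andP[_ ki]]; rewrite leqNgt ki.
rewrite [X in _ = _ + X]big1_seq ?addr0; last first.
  by move=> k; rewrite mem_index_iota => /andP[_ /andP[jk _]]; rewrite andbC ltnNge jk.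
rewrite -(telescope_sumr (fun k => F (s k)) ij).
apply: eq_big_nat => k kij; by rewrite kij.
Qed.

End grid.

Section step_functions.
Context (R : realType) (m : nat).
Implicit Types st : seq (R * R * 'rV[R]_m).

Lemma dotpDl (x y z : 'rV[R]_m) : dotp (x + y) z = dotp x z + dotp y z.
Proof. by rewrite /dotp -big_split; apply: eq_bigr => k _; rewrite mxE mulrDl. Qed.

Lemma dotpC (x y : 'rV[R]_m) : dotp x y = dotp y x.
Proof. by apply: eq_bigr => k _; rewrite mulrC. Qed.

Lemma dotpDr (x y z : 'rV[R]_m) : dotp z (x + y) = dotp z x + dotp z y.
Proof. by rewrite !(dotpC z) dotpDl. Qed.

Lemma dotpZl c (x z : 'rV[R]_m) : dotp (c *: x) z = c * dotp x z.
Proof. by rewrite /dotp mulr_sumr; apply: eq_bigr => k _; rewrite mxE mulrA. Qed.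

Lemma dotpZr c (x z : 'rV[R]_m) : dotp z (c *: x) = c * dotp z x.
Proof. by rewrite !(dotpC z) dotpZl. Qed.

Lemma dotp0l (z : 'rV[R]_m) : dotp 0 z = 0.
Proof. by rewrite -(scale0r (0 : 'rV_m)) dotpZl mul0r. Qed.

Lemma dotp_sumr (J : Type) (r : seq J) (Q : pred J) (F : J -> 'rV[R]_m) z :
  dotp z (\sum_(j <- r | Q j) F j) = \sum_(j <- r | Q j) dotp z (F j).
Proof.
elim/big_rec2: _ => [|j y x _ <-]; first by rewrite dotpC dotp0l.
by rewrite dotpDr.
Qed.

Lemma dotp_suml (J : Type) (r : seq J) (Q : pred J) (F : J -> 'rV[R]_m) z :
  dotp (\sum_(j <- r | Q j) F j) z = \sum_(j <- r | Q j) dotp (F j) z.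
Proof. by rewrite dotpC dotp_sumr; apply: eq_bigr => j _; rewrite dotpC. Qed.

Lemma dotp_ge0 (x : 'rV[R]_m) : 0 <= dotp x x.
Proof. by apply: sumr_ge0 => k _; rewrite -expr2 sqr_ge0. Qed.

Lemma enorm_sqr (x : 'rV[R]_m) : enorm x ^+ 2 = dotp x x.
Proof. by rewrite /enorm sqr_sqrtr// dotp_ge0. Qed.

Definition valid_steps (t : R) st :=
  all (fun q => (0 <= q.1.1) && (q.1.1 <= q.1.2 <= t)) st.

(** The intervals of a step integrand may overlap; on the grid of all their endpoints the cells are
    disjoint. [V j] adds the vectors of the intervals covering cell [j]. *)
Lemma steps_on_grid T st : 0 <= T -> valid_steps T st ->
  exists (N : nat) (s : nat -> R) (V : nat -> 'rV[R]_m),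
    [/\ 0 <= s 0%N, s N <= T, forall j, (j < N)%N -> s j < s j.+1,
      forall F : R -> 'rV[R]_m, \sum_(q <- st) dotp q.2 (F q.1.2 - F q.1.1) =
        \sum_(j < N) dotp (V j) (F (s j.+1) - F (s j)) &
      forall u, step_fun st u = \sum_(j < N) \1_(`]s j, s j.+1]) u *: V j].
Proof.
move=> T0 /allP vst.
have [|N [s [ix [s0 sN ss sx]]]] := @sorted_grid R
   ([seq q.1.1 | q <- st] ++ [seq q.1.2 | q <- st]) T T0.
  move=> x; rewrite mem_cat => /orP[] /mapP[q /vst]; move=> /andP[h1 /andP[h2 h3]] ->.
    by rewrite h1 (le_trans h2).
  by rewrite h3 (le_trans h1).
pose V j := \sum_(q <- st) q.2 *+ (ix q.1.1 <= j < ix q.1.2)%N.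
have smono i j : (i <= j)%N -> (j <= N)%N -> s i <= s j.
  move=> /subnK <-; elim: (j - i)%N => [|k IH] kN; first by rewrite add0n.
  rewrite addSn in kN *; exact: le_trans (IH (ltnW kN)) (ltW (ss _ kN)).
have smono' i j : (i < j)%N -> (j <= N)%N -> s i < s j.
  by move=> ij jN; apply: lt_le_trans (ss _ (leq_trans ij jN)) (smono _ _ ij jN).
have ixq q : q \in st -> [/\ (ix q.1.1 <= ix q.1.2)%N, (ix q.1.2 <= N)%N,
    s (ix q.1.1) = q.1.1 & s (ix q.1.2) = q.1.2].
  move=> qst; have /andP[h1 /andP[h2 h3]] := vst _ qst.
  have [|a1 a2] := sx q.1.1; first by rewrite mem_cat; apply/orP; left; apply/mapP; exists q.
  have [|b1 b2] := sx q.1.2; first by rewrite mem_cat; apply/orP; right; apply/mapP; exists q.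
  split => //; rewrite leqNgt; apply/negP => h.
  by have := smono' _ _ h a1; rewrite a2 b2 ltNge h2.
exists N, s, V; split => //.
- move=> F; rewrite /V; under [RHS]eq_bigr do rewrite dotp_suml.
  rewrite [RHS]exchange_big/= big_seq [RHS]big_seq; apply: eq_bigr => q /ixq[h1 h2 h3 h4].
  rewrite -{1}h3 -{1}h4 (grid_increment F s h1 h2) dotp_sumr; apply: eq_bigr => j _.
  by case: (_ <= _ < _)%N; rewrite ?mulr1n// !mulr0n dotp0l dotpC dotp0l.
- move=> u; rewrite /step_fun /V; under [RHS]eq_bigr do rewrite scaler_sumr.
  rewrite [RHS]exchange_big/= big_seq [RHS]big_seq; apply: eq_bigr => q qst; have [h1 h2 h3 h4] := ixq q qst.
  (* The indicator of a half-open interval is an increment of x -> 1_{u <= x}, so both claims rest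
     on the same telescoping sum. *)
  have cell (a b : R) : a <= b -> (\1_(`]a, b]) : R -> R) u = (u <= b)%R%:R - (u <= a)%R%:R.
    move=> ab; rewrite indicE; case: (lerP u a) => ua.
      by rewrite memNset ?(le_trans ua ab) ?subrr//= in_itv/= ltNge ua.
    case: (lerP u b) => ub; first by rewrite mem_set/= ?in_itv/= ?ua// subr0.
    by rewrite memNset/= ?subr0// in_itv/= ua/= leNgt ub.
  have /andP[_ /andP[q12 _]] := vst _ qst.
  rewrite (cell _ _ q12) -{1}h3 -{1}h4.
  rewrite (grid_increment (fun x : R => (u <= x)%R%:R : R) s h1 h2) scaler_suml.
  apply: eq_bigr => j _; rewrite (cell _ _ (ltW (ss _ (ltn_ord j)))).
  by case: (_ <= _ < _)%N; rewrite ?mulr1n// !mulr0n scale0r scaler0.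
Qed.

End step_functions.

Lemma lebesgue_measure_oc (R : realType) (a b t : R) : 0 <= a -> a <= b -> b <= t ->
  (lebesgue_measure (`]a, b] `&` `[0%R, t]) = (b - a)%:E)%E.
Proof.
move=> a0 ab bt; rewrite (_ : _ `&` _ = `]a, b]%classic); last first.
  apply/seteqP; split => x /=; first by case.
  rewrite !in_itv/= => /andP[ax xb].
  by split; [rewrite ax|rewrite (le_trans a0 (ltW ax)) (le_trans xb bt)].
rewrite lebesgue_measure_itv/= lte_fin; case: ltP => [_|ba]; first by rewrite EFinB.
by rewrite (@le_anti _ _ a b) ?subrr// ab ba.
Qed.

(** * Law and isometry of step integrals *)

Section brownian_steps.
Context d (W : measurableType d) (R : realType) (P : probability W R).
Context (m : nat) (B : R -> W -> 'rV[R]_m) (T : R) (B_bm : brownian_motion P B T).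
Implicit Types st : seq (R * R * 'rV[R]_m).

Lemma brownian_measurable t k : 0 <= t <= T -> measurable_fun setT (fun w => B t w ord0 k).
Proof. by case: B_bm => + _ _ _ _; exact. Qed.

Lemma brownian_increment_mgf s t k c : 0 <= s -> s < t -> t <= T ->
  (\int[P]_w (expR (c * (B t w ord0 k - B s w ord0 k)))%:E =
    (expR (c ^+ 2 * (t - s) / 2))%:E)%E.
Proof.
move=> s0 st tT; have [_ _ /(_ s t k) incr _ _] := B_bm.
have ts : 0 < t - s by rewrite subr_gt0.
rewrite (@normal_mgf _ _ _ _ (fun w => B t w ord0 k - B s w ord0 k) (Num.sqrt (t - s))).
- by rewrite sqr_sqrtr// ltW.
- apply: measurable_funB; apply: brownian_measurable.
    by rewrite tT (le_trans s0)// ltW.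
  by rewrite s0 (le_trans (ltW st)).
- by rewrite gt_eqF// sqrtr_gt0.
- by move=> D mD; exact: incr.
Qed.

Lemma grid_bounds N (s : nat -> R) : 0 <= s 0%N -> s N <= T ->
  (forall j, (j < N)%N -> s j < s j.+1) -> forall j, (j <= N)%N -> 0 <= s j <= T.
Proof.
move=> s0 sN ss.
have smono i j : (i <= j)%N -> (j <= N)%N -> s i <= s j.
  move=> /subnK <-; elim: (j - i)%N => [|k IH] kN; first by rewrite add0n.
  rewrite addSn in kN *; exact: le_trans (IH (ltnW kN)) (ltW (ss _ kN)).
by move=> j jN; rewrite (le_trans s0 (smono _ _ _ jN))//= (le_trans (smono _ _ jN _) sN).
Qed.

Lemma grid_mgf N (s : nat -> R) (V : nat -> 'rV[R]_m) c :
  0 <= s 0%N -> s N <= T -> (forall j, (j < N)%N -> s j < s j.+1) ->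
  (\int[P]_w (expR (c * \sum_(j < N) dotp (V j) (B (s j.+1) w - B (s j) w)))%:E =
    (expR (c ^+ 2 * (\sum_(j < N) dotp (V j) (V j) * (s j.+1 - s j)) / 2))%:E)%E.
Proof.
move=> s0 sN ss; have sT := grid_bounds s0 sN ss.
pose Q : finType := ('I_N * 'I_m)%type.
pose X (q : Q) w := B (s q.1.+1) w ord0 q.2 - B (s q.1) w ord0 q.2.
have := @expectation_prod_indep _ W R P Q X _ _ (fun q x => expR (c * V q.1 ord0 q.2 * x))
  _ _ (fun q => expR ((c * V q.1 ord0 q.2) ^+ 2 * (s q.1.+1 - s q.1) / 2)) _ _.
rewrite -expR_sum => H.
transitivity (\int[P]_w (\prod_(q : Q) expR (c * V q.1 ord0 q.2 * X q w))%:E)%E.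
  apply: eq_integral => w _; rewrite -expR_sum; congr (expR _)%:E.
  rewrite mulr_sumr; under eq_bigr do rewrite /dotp mulr_sumr.
  by rewrite pair_bigA/=; apply: eq_bigr => q _; rewrite !mxE /X mulrA.
rewrite H.
- congr (expR _)%:E; rewrite -mulrA mulr_suml mulr_sumr.
  under [RHS]eq_bigr do rewrite /dotp !mulr_suml mulr_sumr.
  rewrite pair_bigA/=; apply: eq_bigr => q _; rewrite exprMn; ring.
- move=> q; apply: measurable_funB; apply: brownian_measurable; apply: sT => //.
  exact: ltnW.
- move=> D mD; have [_ _ _ indep _] := B_bm.
  rewrite (_ : [set w | _] = [set w | forall j k, D (j, k) (B (s j.+1) w ord0 k - B (s j) w ord0 k)]).
    rewrite (indep N s (fun j k => D (j, k)))//.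
      by rewrite pair_bigA/=; apply: eq_bigr => -[].
    by move=> j jN; apply: ltW; exact: ss.
  by apply/seteqP; split => w /= h => [j k|[j k]]; [exact: (h (j, k))|exact: h].
- by move=> q; apply: measurableT_comp => //; exact: measurable_funM.
- by move=> q x; exact: expR_ge0.
- by move=> q; exact: expR_ge0.
- move=> q; rewrite /X brownian_increment_mgf//.
  + by have /andP[] := sT q.1 (ltnW (ltn_ord q.1)).
  + exact: ss.
  + by have /andP[] := sT q.1.+1 (ltn_ord q.1).
Qed.

Lemma grid_step_sqr_integral N (s : nat -> R) (V : nat -> 'rV[R]_m) t :
  0 <= s 0%N -> s N <= t -> t <= T -> (forall j, (j < N)%N -> s j < s j.+1) ->
  (\int[lebesgue_measure]_(u in `[0%R, t])
     (enorm (\sum_(j < N) (\1_(`]s j, s j.+1]) : R -> R) u *: V j) ^+ 2)%:E =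
    (\sum_(j < N) dotp (V j) (V j) * (s j.+1 - s j))%:E)%E.
Proof.
move=> s0 sN tT ss.
have smono i j : (i <= j)%N -> (j <= N)%N -> s i <= s j.
  move=> /subnK <-; elim: (j - i)%N => [|k IH] kN; first by rewrite add0n.
  rewrite addSn in kN *; exact: le_trans (IH (ltnW kN)) (ltW (ss _ kN)).
pose c j : R -> R := \1_(`]s j, s j.+1]).
have cc (i j : 'I_N) u : c i u * c j u = c i u *+ (i == j).
  have [->|ij] := eqVneq i j.
    by rewrite mulr1n /c indicE; case: (_ \in _); rewrite ?mulr1 ?mulr0.
  rewrite mulr0n /c !indicE; have [ui|ui] := boolP (u \in _); last by rewrite mul0r.
  rewrite mul1r memNset// => /=; move: ui; rewrite inE/= !in_itv/= => /andP[h1 h2] /andP[h3 h4].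
  have [{}ij|{}ij|/val_inj eij] := ltngtP i j; last by rewrite eij eqxx in ij.
    by have := smono _ _ ij (ltnW (ltn_ord j)); rewrite leNgt (lt_le_trans h3 h2).
  by have := smono _ _ ij (ltnW (ltn_ord i)); rewrite leNgt (lt_le_trans h1 h4).
transitivity (\int[lebesgue_measure]_(u in `[0%R, t])
    (\sum_(j < N) ((dotp (V j) (V j))%:E * (c j u)%:E)%E)%E)%E.
  apply: eq_integral => u _; rewrite enorm_sqr dotp_suml -sumEFin.
  apply: eq_bigr => i _; rewrite -EFinM; congr EFin; rewrite dotp_sumr (bigD1 i)//= dotpZl dotpZr mulrA.
  rewrite (cc i i) eqxx mulr1n big1 ?addr0; first by rewrite mulrC.
  by move=> j ij; rewrite dotpZl dotpZr mulrA (cc i j) eq_sym (negbTE ij) mul0r.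
rewrite ge0_integral_sum//.
- rewrite -sumEFin; apply: eq_bigr => j _; rewrite ge0_integralZl//.
  + rewrite integral_indic//.
    rewrite EFinM; congr (_ * _)%E; apply: lebesgue_measure_oc.
    * exact: le_trans s0 (smono _ _ _ (ltnW (ltn_ord j))).
    * exact/ltW/ss.
    * exact: le_trans (smono _ _ (ltn_ord j) _) sN.
  + by apply/measurable_EFinP; exact: measurable_indic.
  + by move=> x _; rewrite lee_fin /c indicE.
  + by rewrite lee_fin dotp_ge0.
- move=> j; apply: measurable_funeM; apply/measurable_EFinP.
  exact: measurable_indic.
- by move=> j x _; rewrite -EFinM lee_fin mulr_ge0 ?dotp_ge0// /c indicE.
Qed.

(** The same number [S] governs the law of the integral and the norm of the integrand: this becomes
    the isometry once [S] is recognised as the second moment. *)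
Lemma step_int_mgf t st : 0 <= t <= T -> valid_steps t st ->
  exists S : R, (forall c : R, (\int[P]_w (expR (c * step_int B st w))%:E = (expR (c ^+ 2 * S / 2))%:E)%E) /\
    (\int[lebesgue_measure]_(u in `[0%R, t]) (enorm (step_fun st u) ^+ 2)%:E = S%:E)%E.
Proof.
move=> /andP[t0 tT] vst.
have [N [s [V [s0 sN ss ie fe]]]] := steps_on_grid t0 vst.
exists (\sum_(j < N) dotp (V j) (V j) * (s j.+1 - s j)); split.
- move=> c; rewrite -(grid_mgf V c s0 (le_trans sN tT) ss).
  by apply: eq_integral => w _; rewrite /step_int (ie (B ^~ w)).
- rewrite -(grid_step_sqr_integral V s0 sN tT ss).
  by apply: eq_integral => u _; rewrite fe.
Qed.

Lemma measurable_step_int t st : 0 <= t <= T -> valid_steps t st ->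
  measurable_fun setT (step_int B st).
Proof.
move=> /andP[t0 tT] /allP vst; rewrite /step_int.
have -> : (fun w => \sum_(q <- st) dotp q.2 (B q.1.2 w - B q.1.1 w)) =
  (fun w => \sum_(q <- st) (if q \in st then dotp q.2 (B q.1.2 w - B q.1.1 w) else 0)).
  by apply/funext => w; rewrite big_seq [RHS]big_seq; apply: eq_bigr => q ->.
apply: measurable_sum => q; have [qst|qst] := boolP (q \in st); last exact: measurable_cst.
have /andP[h1 /andP[h2 h3]] := vst _ qst.
apply: measurable_sum => k; under eq_fun do rewrite !mxE.
apply: measurable_funM => //; apply: measurable_funB; apply: brownian_measurable.
  by rewrite (le_trans h1 h2) (le_trans h3).
by rewrite h1 (le_trans h2) ?(le_trans h3).
Qed.

Lemma step_int_cat st st' w : step_int B (st ++ st') w = step_int B st w + step_int B st' w.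
Proof. by rewrite /step_int big_cat. Qed.

Lemma step_fun_cat st st' (u : R) : step_fun (st ++ st') u = step_fun st u + step_fun st' u.
Proof. by rewrite /step_fun big_cat. Qed.

Definition scale_steps (c : R) st := [seq (q.1, c *: q.2) | q <- st].

Lemma step_int_scale c st w : step_int B (scale_steps c st) w = c * step_int B st w.
Proof.
by rewrite /step_int big_map mulr_sumr; apply: eq_bigr => q _; rewrite dotpZl.
Qed.

Lemma step_fun_scale c st (u : R) : step_fun (scale_steps c st) u = c *: step_fun st u.
Proof.
rewrite /step_fun big_map scaler_sumr; apply: eq_bigr => q _ /=.
by rewrite !scalerA mulrC.
Qed.

Lemma valid_steps_cat t st st' : valid_steps t st -> valid_steps t st' -> valid_steps t (st ++ st').
Proof. by rewrite /valid_steps all_cat => -> ->. Qed.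

Lemma valid_steps_scale t c st : valid_steps t st -> valid_steps t (scale_steps c st).
Proof. by rewrite /valid_steps all_map. Qed.

Definition step_integrals t : set (W -> R) :=
  [set X | exists2 st, valid_steps t st & X = step_int B st].

Lemma step_integrals_gaussian t : 0 <= t <= T -> gaussian_space P (step_integrals t).
Proof.
move=> tT; split.
- move=> _ _ [st vst ->] [st' vst' ->]; exists (st ++ st'); first exact: valid_steps_cat.
  by apply/funext => w; rewrite step_int_cat.
- move=> c _ [st vst ->]; exists (scale_steps c st); first exact: valid_steps_scale.
  by apply/funext => w; rewrite step_int_scale.
- move=> _ [st vst ->]; split; first exact: measurable_step_int vst.
  by have [S [HS _]] := step_int_mgf tT vst; exists S.
Qed.

Lemma step_int_isometry t st : 0 <= t <= T -> valid_steps t st ->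
  L2sqn P (step_int B st) =
    (\int[lebesgue_measure]_(u in `[0%R, t]) (enorm (step_fun st u) ^+ 2)%:E)%E.
Proof.
move=> tT vst; have [S [HS ->]] := step_int_mgf tT vst.
have G := step_integrals_gaussian tT; have Gst : step_integrals t (step_int B st) by exists st.
rewrite sqnE; last exact/expmoments_moments/(gaussian_expmoments G).
congr EFin; have := gaussian_mgf G 1 Gst.
by rewrite /Rintegral HS/= => /expR_inj; rewrite !expr1n !mul1r; lra.
Qed.

End brownian_steps.

(** * L^2 limits of Gaussian variables *)

Section fatou_subsequence.
Context d (W : measurableType d) (R : realType) (P : probability W R).

Lemma fatou_ae_le (f : nat -> W -> R) (g : W -> R) (K : \bar R) :
  (forall n, measurable_fun setT (f n)) -> measurable_fun setT g ->
  (forall n w, 0 <= f n w) -> (forall w, 0 <= g w) ->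
  {ae P, forall w, f n w @[n --> \oo] --> g w} ->
  (forall n, \int[P]_w (f n w)%:E <= K)%E -> (\int[P]_w (g w)%:E <= K)%E.
Proof.
move=> mf mg f0 g0 fg fK.
have mf' n : measurable_fun setT (fun w => (f n w)%:E) by exact/measurable_EFinP.
pose l w := limn_einf (fun n => (f n w)%:E).
have l0 w : (0 <= l w)%E.
  rewrite /l limn_einf_lim; apply: lime_ge; first exact: is_cvg_einfs.
  by apply: nearW => n; apply: le_ereal_inf_tmp => _ [k /= _ <-]; rewrite lee_fin.
apply: (@le_trans _ _ (\int[P]_w l w)%E).
  apply: ae_ge0_le_integral => //.
  - by move=> w _; rewrite lee_fin.
  - exact/measurable_EFinP.
  - rewrite /l; under eq_fun do rewrite limn_einf_lim.
    apply: (@emeasurable_fun_cvg _ _ _ _ (fun n w => einfs (fun k => (f k w)%:E) n)).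
      by move=> n; exact: (measurable_fun_einfs mf').
    by move=> w _; exact: is_cvg_einfs.
  - apply: filterS fg => w fw _; rewrite /l is_cvg_limn_einfE.
      rewrite (_ : limn _ = (g w)%:E)//; apply/cvg_lim => //.
      by apply/fine_cvgP; split; [exact: nearW|exact: fw].
    apply/cvg_ex; exists (g w)%:E.
    by apply/fine_cvgP; split; [exact: nearW|exact: fw].
apply: (le_trans (fatou P measurableT mf' _)) => /=.
  by move=> n w _; rewrite lee_fin.
rewrite limn_einf_lim; apply: lime_le; first exact: is_cvg_einfs.
apply: nearW => n; apply: le_trans (fK n).
by apply: ereal_inf_lbound; exists n => /=.
Qed.

(** The squared errors along [phi] have summable integrals, so their sum is a.e. finite and its
    terms tend to 0. [phi] comes from a choice at each [k] and is not claimed to be increasing. *)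
Lemma L2_ae_subsequence (u : nat -> W -> R) (X : W -> R) :
  (forall n, measurable_fun setT (u n)) -> measurable_fun setT X ->
  L2sqn P (fun w => X w - u n w) @[n --> \oo] --> 0%E ->
  exists phi : nat -> nat, {ae P, forall w, u (phi k) w @[k --> \oo] --> X w}.
Proof.
move=> mu mX uX.
have /choice[phi Hphi] : forall k : nat, exists n,
    (L2sqn P (fun w => X w - u n w)%R < (1 / (2 ^ k.+1)%:R)%:E)%E.
  move=> k; have : 0 < (1 / (2 ^ k.+1)%:R) :> R by rewrite divr_gt0.
  by move=> /cvge0_near_lt/(_ uX)/filter_ex.
exists phi.
pose a k w := (((X w - u (phi k) w) ^+ 2)%:E)%E.
have ma k : measurable_fun setT (a k).
  by apply: measurable_sqrE; exact: measurable_funB.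
have a0 k w : (0 <= a k w)%E by rewrite lee_fin sqr_ge0.
pose S w := (\sum_(k <oo) a k w)%E.
have mS : measurable_fun setT S.
  by apply: ge0_emeasurable_sum => // k w _ _.
have S0 w : (0 <= S w)%E by apply: nneseries_ge0.
have iS : P.-integrable setT S.
  apply/integrableP; split => //.
  under eq_integral do rewrite gee0_abs//.
  rewrite integral_nneseries//.
  apply: (@le_lt_trans _ _ (\sum_(k <oo) (1 / (2 ^ k.+1)%:R)%:E)%E).
    apply: lee_nneseries => [k *|k *]; first exact: integral_ge0.
    exact/ltW/Hphi.
  by apply: le_lt_trans (epsilon_trick0 xpredT (ler01 : 0 <= 1)) _; rewrite ltry.
have := integrable_ae measurableT iS; apply: filterS => w /(_ I) Sw.
have Sw' : (S w < +oo)%E by rewrite -ge0_fin_numE.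
have tail : (\sum_(N <= k <oo) a k w)%E @[N --> \oo] --> 0%E.
  exact: (nneseries_tail_cvg Sw').
apply/cvgrPdist_lt => e e0.
have e2 : 0 < e ^+ 2 by rewrite exprn_gt0.
have := cvge0_near_lt e2 tail; apply: filterS => N HN.
have : (a N w < (e ^+ 2)%:E)%E.
  apply: le_lt_trans HN.
  rewrite (@nneseries_split _ _ N 1%N)//.
  by rewrite addn1 big_nat1 leeDl//; apply: nneseries_ge0 => k _ _.
rewrite /a lte_fin -[X in X < _]real_normK ?num_real//.
by rewrite ltr_pXn2r// ?nnegrE// ltW.
Qed.

End fatou_subsequence.

(** * Comparing squared norms in the limit *)

Section sq_limits.
Context (R : realType).

Lemma expR_lipschitz (a b : R) : `|expR a - expR b| <= `|a - b| * (expR a + expR b).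
Proof.
wlog ab : a b / a <= b.
  move=> H; have [ab|ba] := leP a b; first exact: H.
  by rewrite distrC (distrC a) [expR a + _]addrC; apply: H; exact: ltW.
rewrite distrC (distrC a) !ger0_norm ?subr_ge0 ?ler_expR//.
have ea := expR_gt0 a; have eb := expR_gt0 b.
have h : expR b * (1 + (a - b)) <= expR a.
  have -> : expR a = expR b * expR (a - b) by rewrite -expRD addrC subrK.
  by rewrite ler_wpM2l ?expR_ge0// expR_ge1Dx.
nra.
Qed.

Lemma cvg_inv_succ : (k.+1%:R^-1 : R) @[k --> \oo] --> (0:R).
Proof. exact: cvg_harmonic. Qed.

(** The coefficient of [a ^+ 2] can be brought to 1, unlike the factor 2 of [sqnD]; equality of
    norms in the limit depends on it. *)
Lemma sqr_weighted (a b e : R) : 0 < e ->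
  (a + b) ^+ 2 <= (1 + e) * a ^+ 2 + (1 + e^-1) * b ^+ 2.
Proof.
move=> e0.
have : 0 <= (e * a - b) ^+ 2 / e by rewrite divr_ge0 ?sqr_ge0// ltW.
have -> : (e * a - b) ^+ 2 / e = e * a ^+ 2 - 2 * a * b + e^-1 * b ^+ 2.
  by field; rewrite gt_eqF.
by have := sqr_ge0 a; nra.
Qed.

(** [u n] is the squared norm of an approximant common to both sides, with errors [v] and [v']. Let
    [n] tend to infinity at fixed [e], and [e] to 0 afterwards. *)
Lemma weighted_limit_le (a a' : R) (u v v' : nat -> R) :
  (forall e n, 0 < e -> a <= (1 + e) * u n + (1 + e^-1) * v n) ->
  (forall e n, 0 < e -> u n <= (1 + e) * a' + (1 + e^-1) * v' n) ->
  v n @[n --> \oo] --> (0:R) -> v' n @[n --> \oo] --> (0:R) -> a <= a'.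
Proof.
move=> H1 H2 v0 v'0.
have H e : 0 < e -> a <= (1 + e) * ((1 + e) * a').
  move=> e0.
  have cv : (fun n => (1 + e) * ((1 + e) * a' + (1 + e^-1) * v' n) + (1 + e^-1) * v n) @ \oo
      --> (1 + e) * ((1 + e) * a').
    rewrite (_ : (1 + e) * ((1 + e) * a') = (1 + e) * ((1 + e) * a' + 0) + 0); last by rewrite !addr0.
    apply: cvgD; last by rewrite -(mulr0 (1 + e^-1)); apply: cvgM => //; exact: cvg_cst.
    apply: cvgM; first exact: cvg_cst.
    apply: cvgD; first exact: cvg_cst.
    by rewrite -(mulr0 (1 + e^-1)); apply: cvgM => //; exact: cvg_cst.
  apply: (cvgr_to_ge cv); apply: nearW => n; apply: le_trans (H1 _ n e0) _.
  by rewrite lerD2r ler_wpM2l ?addr_ge0 ?(ltW e0)//; exact: H2.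
have cv : (fun k => (1 + k.+1%:R^-1) * ((1 + k.+1%:R^-1) * a')) @ \oo --> a'.
  have h : (fun k => 1 + k.+1%:R^-1 : R) @ \oo --> (1:R).
    rewrite -[X in _ --> X]addr0; apply: cvgD; first exact: cvg_cst.
    exact: cvg_inv_succ.
  rewrite [X in _ --> X](_ : a' = 1 * (1 * a')); last by rewrite !mul1r.
  by apply: cvgM => //; apply: cvgM => //; exact: cvg_cst.
by apply: (cvgr_to_ge cv); apply: nearW => k; apply: H; rewrite invr_gt0.
Qed.

Lemma weighted_elimit_le (a a' : \bar R) (u : nat -> R) (v v' : nat -> \bar R) :
  (0 <= a)%E -> (0 <= a')%E -> (forall n, 0 <= v n)%E -> (forall n, 0 <= v' n)%E ->
  (forall e n, 0 < e -> (a <= (1 + e)%:E * (u n)%:E + (1 + e^-1)%:E * v n)%E) ->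
  (forall e n, 0 < e -> ((u n)%:E <= (1 + e)%:E * a' + (1 + e^-1)%:E * v' n)%E) ->
  v n @[n --> \oo] --> 0%E -> v' n @[n --> \oo] --> 0%E -> (a <= a')%E.
Proof.
move=> a0 a'0 v0 v'0 H1 H2 cv cv'.
(* Past [N] both errors are finite, which makes [a] finite; an infinite [a'] is trivial. The real
   case is applied to the shifted sequences. *)
have [N _ HN] := filterI (cvge0_near_lt ltr01 cv) (cvge0_near_lt ltr01 cv').
have vfin n : v (n + N)%N \is a fin_num.
  have [h _] := HN (n + N)%N (leq_addl _ _).
  by rewrite ge0_fin_numE// (lt_trans h)// ltry.
have v'fin n : v' (n + N)%N \is a fin_num.
  have [_ h] := HN (n + N)%N (leq_addl _ _).
  by rewrite ge0_fin_numE// (lt_trans h)// ltry.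
have afin : a \is a fin_num.
  rewrite ge0_fin_numE// (le_lt_trans (H1 1 N ltr01))// -(fineK (vfin 0%N)).
  by rewrite -!EFinM -EFinD ltry.
have [->|a'y] := eqVneq a' +oo%E; first exact: leey.
have a'fin : a' \is a fin_num by rewrite ge0_fin_numE// lt_neqAle a'y leey.
have cvf (w : nat -> \bar R) : w n @[n --> \oo] --> 0%E -> fine (w (n + N)%N) @[n --> \oo] --> (0:R).
  move=> /fine_cvgP[_ c]; exact: (cvg_comp _ _ (cvg_addnr N) c).
rewrite -(fineK afin) -(fineK a'fin) lee_fin.
apply: (@weighted_limit_le _ _ (fun n => u (n + N)%N) (fun n => fine (v (n + N)%N)) (fun n => fine (v' (n + N)%N))).
- move=> e n e0; have := H1 e (n + N)%N e0.
  by rewrite -{1}(fineK afin) -{1}(fineK (vfin n)) -!EFinM -EFinD lee_fin.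
- move=> e n e0; have := H2 e (n + N)%N e0.
  by rewrite -{1}(fineK a'fin) -{1}(fineK (v'fin n)) -!EFinM -EFinD lee_fin.
- exact: cvf.
- exact: cvf.
Qed.

End sq_limits.

(** * A Gaussian space stays Gaussian under L^2 limits *)

Section gaussian_closure.
Context d (W : measurableType d) (R : realType) (P : probability W R).
Context (Gs : set (W -> R)) (GsG : gaussian_space P Gs).
Local Notation "''E' X" := (Rintegral P setT X) (at level 10, X at level 9).
Local Notation sqn := (L2sqn P).

Definition L2limits : set (W -> R) := [set X : W -> R | measurable_fun setT X /\
  exists2 u : nat -> W -> R, (forall n, Gs (u n)) &
    sqn (fun w => X w - u n w) @[n --> \oo] --> 0%E].

Lemma sqn_weighted X Y e : measurable_fun setT X -> measurable_fun setT Y -> 0 < e ->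
  (sqn X <= (1 + e)%:E * sqn Y + (1 + e^-1)%:E * sqn (fun w => X w - Y w)%R)%E.
Proof.
move=> mX mY e0; have mXY := measurable_funB mX mY.
have h1 : 0 <= 1 + e by rewrite addr_ge0// ltW.
have h2 : 0 <= 1 + e^-1 by rewrite addr_ge0// invr_ge0 ltW.
rewrite -!ge0_integralZl ?lee_fin//; last 4 first.
- exact: measurable_sqrE.
- by move=> w _; rewrite lee_fin sqr_ge0.
- exact: measurable_sqrE.
- by move=> w _; rewrite lee_fin sqr_ge0.
rewrite -ge0_integralD//; first last.
- by apply: measurable_funeM; exact: measurable_sqrE.
- by move=> w _; rewrite -EFinM lee_fin mulr_ge0// sqr_ge0.
- by apply: measurable_funeM; exact: measurable_sqrE.
- by move=> w _; rewrite -EFinM lee_fin mulr_ge0// sqr_ge0.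
apply: ge0_le_integral => //.
- by move=> w _; rewrite lee_fin sqr_ge0.
- exact: measurable_sqrE.
- by apply: emeasurable_funD; apply: measurable_funeM; exact: measurable_sqrE.
- move=> w _; rewrite -!EFinM -EFinD lee_fin.
  by have := sqr_weighted (Y w) (X w - Y w) e0; rewrite addrC subrK.
Qed.

Lemma gaussian_measurable X : Gs X -> measurable_fun setT X.
Proof. by case: GsG => _ _ /[apply] -[]. Qed.

Lemma gaussian_moments X : Gs X -> moments P X.
Proof. by move=> /(gaussian_expmoments GsG)/expmoments_moments. Qed.

(** The exponential is not continuous in L^2. Bounded second moments bound E[exp(2 u_n)], Fatou's
    lemma along an a.e. convergent subsequence puts exp(X) in L^2, and |exp a - exp b| <= |a - b|
    (exp a + exp b) gives the limit. *)
Lemma L2limit_expR_cvg (u : nat -> W -> R) (X : W -> R) : (forall n, Gs (u n)) -> measurable_fun setT X ->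
  sqn (fun w => X w - u n w) @[n --> \oo] --> 0%E ->
  P.-integrable setT (EFin \o (fun w => expR (X w))) /\
  'E (fun w => expR (u n w)) @[n --> \oo] --> 'E (fun w => expR (X w)).
Proof.
move=> Gu mX cu.
have mu n := gaussian_measurable (Gu n).
have [N _ HN] := cvge0_near_lt ltr01 cu.
have sX : (sqn X < +oo)%E.
  apply: le_lt_trans (sqn_weighted mX (mu N) ltr01) _.
  rewrite lte_add_pinfty// lte_mul_pinfty ?lee_fin//.
    exact/moments_sqn/gaussian_moments.
  by rewrite (lt_trans (HN N (leqnn _)))// ltry.
have sXf : sqn X \is a fin_num by rewrite ge0_fin_numE// sqn_ge0.
(* Past [N] the squared error is below 1, so the second moment of [u n] is at most 2 E[X^2] + 2. *)
pose K := 2 * fine (sqn X) + 2.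
have uK n : (N <= n)%N -> 'E (fun w => u n w ^+ 2) <= K.
  move=> Nn; rewrite -lee_fin -sqnE; last exact: gaussian_moments.
  have h := sqn_weighted (mu n) mX ltr01.
  have -> : (K%:E = 2%:E * sqn X + 2%:E)%E by rewrite /K EFinD EFinM fineK.
  apply: le_trans h _; rewrite invr1 sqnBC (_ : 1 + 1 = 2 :> R); last by ring.
  rewrite leeD// -[X in (_ <= X)%E]mule1 lee_wpmul2l ?lee_fin//.
  exact: ltW (HN _ Nn).
have mexp (Y : W -> R) : measurable_fun setT Y -> measurable_fun setT (fun w => expR (Y w)).
  by move=> mY; apply: measurableT_comp.
have expuK n : (N <= n)%N -> (sqn (fun w => expR (u n w)) <= (expR (2 * K))%:E)%E.
  move=> Nn.
  have e2 : (fun w => (expR (u n w)) ^+ 2) = (fun w => expR (2 * u n w)).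
    by apply/funext => w; rewrite -expRM_natl.
  have mm : moments P (fun w => expR (u n w)).
    have := expmoments_expRZ 1 (gaussian_expmoments GsG (Gu n)).
    by congr moments; apply/funext => w; rewrite mul1r.
  rewrite sqnE// lee_fin e2 (gaussian_mgf GsG)// ler_expR.
  by have := uK n Nn; lra.
have [phi Hphi] : exists phi : nat -> nat, {ae P, forall w, u (phi k + N)%N w @[k --> \oo] --> X w}.
  apply: (@L2_ae_subsequence _ _ _ P (fun n => u (n + N)%N) X) => //.
  exact: (cvg_comp _ _ (cvg_addnr N) cu).
have expXK : (sqn (fun w => expR (X w)) <= (expR (2 * K))%:E)%E.
  apply: (@fatou_ae_le _ _ _ _ (fun k w => expR (u (phi k + N)%N w) ^+ 2)).
  - by move=> n; apply: measurable_funX; exact: mexp.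
  - by apply: measurable_funX; exact: mexp.
  - by move=> n w; exact: sqr_ge0.
  - by move=> w; exact: sqr_ge0.
  - apply: filterS Hphi => w Hw.
    have h : expR (u (phi k + N)%N w) @[k --> \oo] --> expR (X w).
      by apply: (cvg_comp _ _ Hw); exact: continuous_expR.
    by under eq_fun do rewrite expr2; rewrite expr2; exact: cvgM.
  - by move=> n; apply: expuK; exact: leq_addl.
have sE : (sqn (fun w => expR (X w)) < +oo)%E by rewrite (le_lt_trans expXK)// ltry.
have iX : P.-integrable setT (EFin \o (fun w => expR (X w))).
  by apply: integrable_sqn_lt => //; exact: mexp.
split => //.
have iu n : P.-integrable setT (EFin \o (fun w => expR (u n w))).
  have := expmoments_expRZ 1 (gaussian_expmoments GsG (Gu n)).
  move=> /moments_integrable; congr (P.-integrable); apply/funext => w /=.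
  by rewrite mul1r.
pose C := 4 * expR (2 * K).
have C0 : 0 < C by rewrite mulr_gt0// expR_gt0.
have key n (l : R) : (N <= n)%N -> 0 < l ->
    `|'E (fun w => expR (u n w)) - 'E (fun w => expR (X w))| <=
    l * C + (4 * l)^-1 * fine (sqn (fun w => X w - u n w)).
  move=> Nn l0; have mXu := measurable_funB mX (mu n).
  have sXu : (sqn (fun w => X w - u n w)%R < +oo)%E by rewrite (lt_trans (HN _ Nn))// ltry.
  have meu : measurable_fun setT (fun w => expR (u n w) + expR (X w)).
    by apply: measurable_funD; exact: mexp.
  have seu : (sqn (fun w => expR (u n w) + expR (X w))%R <= C%:E)%E.
    apply: le_trans (sqnD P (mexp _ (mu n)) (mexp _ mX)) _.
    have -> : (C%:E = 2%:E * (expR (2 * K))%:E + 2%:E * (expR (2 * K))%:E)%E.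
      by rewrite -!EFinM -EFinD /C; congr EFin; ring.
    by rewrite leeD// lee_wpmul2l ?lee_fin//; exact: expuK.
  have seu' : (sqn (fun w => expR (u n w) + expR (X w))%R < +oo)%E by rewrite (le_lt_trans seu)// ltry.
  have i1 := integrable_sqr meu seu'.
  have f1 : 'E (fun w => (expR (u n w) + expR (X w)) ^+ 2) <= C.
    by rewrite -lee_fin /Rintegral fineK//; exact: (integrable_fin_num measurableT i1).
  pose Y w : R := `|X w - u n w|.
  have mY : measurable_fun setT Y by exact: measurableT_comp.
  have Y2 w : Y w ^+ 2 = (X w - u n w) ^+ 2 by rewrite real_normK ?num_real.
  have sY : (sqn Y < +oo)%E by move: sXu; congr (_ < _)%E; apply: eq_integral => w _; rewrite Y2.
  rewrite -RintegralB//.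
  apply: le_trans (le_normr_Rintegral _ _) _ => //; first exact: integrable_funB.
  apply: (@le_trans _ _ ('E (fun w => (expR (u n w) + expR (X w)) * Y w))).
    apply: le_Rintegral => //.
    - by apply: integrable_norm; exact: integrable_funB.
    - exact: integrable_mul2.
    - by move=> w _; rewrite mulrC /Y (distrC (X w)); exact: expR_lipschitz.
  apply: le_trans (expectation_mul_le meu mY seu' sY l0) _.
  by rewrite (Rint_ext P Y2) lerD// ler_wpM2l// ltW.
apply/cvgrPdist_le => e e0.
(* [l * C] is e / 2, and a squared error below [2 * l * e] brings the other term below e / 2. *)
pose l := e / (2 * C).
have l0 : 0 < l by rewrite divr_gt0// mulr_gt0.
have d0 : 0 < 2 * l * e by rewrite mulr_gt0// mulr_gt0.
near=> n.
have Nn : (N <= n)%N by near: n; exists N.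
rewrite distrC; apply: le_trans (key n l Nn l0) _.
have -> : e = l * C + (4 * l)^-1 * (2 * l * e).
  by rewrite /l; field; rewrite !gt_eqF.
have l4 : 0 <= (4 * l)^-1 by rewrite invr_ge0 ltW// mulr_gt0.
rewrite lerD2l ler_wpM2l//.
have h : (sqn (fun w => X w - u n w)%R < (2 * l * e)%:E)%E.
  by near: n; exact: cvge0_near_lt.
have f : sqn (fun w => X w - u n w) \is a fin_num.
  by rewrite ge0_fin_numE ?sqn_ge0// (lt_trans h)// ltry.
by rewrite -lee_fin fineK// ltW.
Unshelve. all: by end_near. Qed.

(** Convergence of the variances is read off the limit [l] of the generating functions at [c = 1] by
    a logarithm, which requires [0 < l]; it then determines the limit at every [c]. *)
Lemma L2limits_gaussian : gaussian_space P L2limits.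
Proof.
have [GD GZ GM] := GsG.
have limD X Y : L2limits X -> L2limits Y -> L2limits (fun w => X w + Y w).
  move=> [mX [u Gu uX]] [mY [v Gv vY]]; split; first exact: measurable_funD.
  exists (fun n w => u n w + v n w); first by move=> n; exact: GD.
  apply: (@squeeze_cvge _ _ _ _ (cst 0%E) _ (fun n => 2%:E * sqn (fun w => X w - u n w)%R + 2%:E * sqn (fun w => Y w - v n w)%R)%E).
  - apply: nearW => n; rewrite sqn_ge0/=.
    rewrite (_ : (fun w => _) = (fun w => (X w - u n w) + (Y w - v n w))); last first.
      by apply/funext => w; rewrite opprD addrACA.
    by apply: sqnD; apply: measurable_funB => //; exact: gaussian_measurable.
  - exact: cvg_cst.
  - rewrite [X in _ --> X](_ : 0 = 2%:E * 0 + 2%:E * 0)%E; last by rewrite mule0 adde0.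
    by apply: cvgeD => //; apply: cvgeZl.
have limZ c X : L2limits X -> L2limits (fun w => c * X w).
  move=> [mX [u Gu uX]]; split; first exact: measurable_funM.
  exists (fun n w => c * u n w); first by move=> n; exact: GZ.
  rewrite (_ : (fun n => _) = (fun n => ((c ^+ 2)%:E * sqn (fun w => X w - u n w)%R)%E)); last first.
    apply/funext => n; rewrite -sqnZ; last by apply: measurable_funB => //; exact: gaussian_measurable.
    by congr L2sqn; apply/funext => w; rewrite mulrBr.
  by rewrite -[X in _ --> X](mule0 (c ^+ 2)%:E); apply: cvgeZl.
split => // X [mX [u Gu uX]]; split => //.
have lim c : P.-integrable setT (EFin \o (fun w => expR (c * X w))) /\
    expR (c ^+ 2 * 'E (fun w => u n w ^+ 2) / 2) @[n --> \oo] --> 'E (fun w => expR (c * X w)).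
  have cX : sqn (fun w => c * X w - c * u n w) @[n --> \oo] --> 0%E.
    rewrite (_ : (fun n => _) = (fun n => ((c ^+ 2)%:E * sqn (fun w => X w - u n w)%R)%E)); last first.
      apply/funext => n; rewrite -sqnZ; last by apply: measurable_funB => //; exact: gaussian_measurable.
      by congr L2sqn; apply/funext => w; rewrite mulrBr.
    by rewrite -[X in _ --> X](mule0 (c ^+ 2)%:E); apply: cvgeZl.
  have mcX : measurable_fun setT (fun w => c * X w) by exact: measurable_funM.
  have [i1 c1] := L2limit_expR_cvg (fun n => GZ c _ (Gu n)) mcX cX.
  split => //; move: c1; under eq_fun do rewrite (gaussian_mgf GsG c (Gu _)).
  exact.
pose l := 'E (fun w => expR (1 * X w)).
have l0 : 0 < l.
  have [i1 _] := lim 1.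
  rewrite lt_neqAle Rintegral_ge0 ?andbT; last by move=> w _; exact: expR_ge0.
  apply/eqP => l0.
  have /ae_eq_integral_abs H : (\int[P]_w `|(expR (1 * X w))%:E| = 0)%E.
    under eq_integral do rewrite gee0_abs ?lee_fin ?expR_ge0//.
    rewrite -[LHS]fineK ?(integrable_fin_num measurableT i1)//.
    by have := esym l0; rewrite /l /Rintegral => ->.
  have [|A [mA A0 sA]] := H measurableT; first by case/integrableP: i1.
  have : P setT = 1%E := probability_setT P.
  rewrite (_ : setT = A) ?A0; first by move/eqP; rewrite eq_sym onee_eq0.
  apply/seteqP; split => // w _; apply: sA => /=.
  by move=> /(_ Logic.I)/eqP; rewrite eqe expR_eq0.
exists (2 * ln l) => c.
have [i1 c1] := lim c.
have cs : 'E (fun w => u n w ^+ 2) @[n --> \oo] --> 2 * ln l.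
  have [_ h] := lim 1.
  have h' : ln (expR (1 ^+ 2 * 'E (fun w => u n w ^+ 2) / 2)) @[n --> \oo] --> ln l.
    by apply: (cvg_comp _ _ h); exact: continuous_ln.
  have : (fun n => 2 * ln (expR (1 ^+ 2 * 'E (fun w => u n w ^+ 2) / 2))) @ \oo --> 2 * ln l.
    by apply: cvgM h'; exact: cvg_cst.
  by under eq_fun do rewrite expRK expr1n mul1r mulrCA mulfV// mulr1.
have c2 : expR (c ^+ 2 * 'E (fun w => u n w ^+ 2) / 2) @[n --> \oo] --> expR (c ^+ 2 * (2 * ln l) / 2).
  apply: cvg_comp; last exact: continuous_expR.
  by apply: cvgM; [apply: cvgM => //; exact: cvg_cst|exact: cvg_cst].
rewrite -[LHS]fineK; last exact: (integrable_fin_num measurableT i1).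
by congr EFin; exact: (cvg_unique _ c1 c2).
Qed.

End gaussian_closure.

(** * Wiener integrals *)

Section path_space.
Context (R : realType) (m : nat) (t : R).
Implicit Types f g : R -> 'rV[R]_m.
Local Notation mu := (@lebesgue_measure R).

Definition path_measurable f := forall k, measurable_fun `[0, t] (fun u => f u ord0 k).

Definition path_sqn f : \bar R := (\int[mu]_(u in `[0%R, t]) (enorm (f u) ^+ 2)%:E)%E.

Lemma path_sqn_ge0 f : (0 <= path_sqn f)%E.
Proof. by apply: integral_ge0 => u _; rewrite lee_fin sqr_ge0. Qed.

Lemma path_measurableD f g : path_measurable f -> path_measurable g ->
  path_measurable (fun u => f u + g u).
Proof.
move=> mf mg k; rewrite (_ : (fun u => _) = (fun u => f u ord0 k + g u ord0 k)).
  exact: measurable_funD.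
by apply/funext => u; rewrite mxE.
Qed.

Lemma path_measurableZ c f : path_measurable f -> path_measurable (fun u => c *: f u).
Proof.
move=> mf k; rewrite (_ : (fun u => _) = (fun u => c * f u ord0 k)).
  exact: measurable_funM.
by apply/funext => u; rewrite mxE.
Qed.

Lemma path_measurableB f g : path_measurable f -> path_measurable g ->
  path_measurable (fun u => f u - g u).
Proof.
move=> mf mg; have := path_measurableD mf (path_measurableZ (-1) mg).
by congr path_measurable; apply/funext => u; rewrite scaleN1r.
Qed.

Lemma path_measurable_sum (J : Type) (s : seq J) (F : J -> R -> 'rV[R]_m) :
  (forall j, path_measurable (F j)) -> path_measurable (fun u => \sum_(j <- s) F j u).
Proof.
move=> mF; elim: s => [|j s IH].
  move=> k; rewrite (_ : (fun u => _) = cst 0); first exact: measurable_cst.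
  by apply/funext => u; rewrite big_nil mxE.
have := path_measurableD (mF j) IH; congr path_measurable; apply/funext => u.
by rewrite big_cons.
Qed.

Lemma path_measurable_step st : path_measurable (step_fun st).
Proof.
rewrite /step_fun; apply: path_measurable_sum => q k.
rewrite (_ : (fun u => _) = (fun u => (\1_(`]q.1.1, q.1.2]) : R -> R) u * q.2 ord0 k)).
  by apply: measurable_funM => //; exact: measurable_indic.
by apply/funext => u; rewrite mxE.
Qed.

Lemma measurable_dotp f g : path_measurable f -> path_measurable g ->
  measurable_fun `[0, t] (fun u => dotp (f u) (g u)).
Proof.
by move=> mf mg; apply: measurable_sum => k; exact: measurable_funM.
Qed.

Lemma measurable_enorm_sqr f : path_measurable f ->
  measurable_fun `[0, t] (fun u => (enorm (f u) ^+ 2)%:E).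
Proof.
move=> mf; rewrite (_ : (fun u => _) = (fun u => (dotp (f u) (f u))%:E)).
  by apply/measurable_EFinP; exact: measurable_dotp.
by apply/funext => u; rewrite enorm_sqr.
Qed.

Lemma enorm_weighted (x y : 'rV[R]_m) e : 0 < e ->
  enorm (x + y) ^+ 2 <= (1 + e) * enorm x ^+ 2 + (1 + e^-1) * enorm y ^+ 2.
Proof.
move=> e0; rewrite !enorm_sqr /dotp !mulr_sumr -big_split/=; apply: ler_sum => k _.
by rewrite mxE -!expr2; exact: sqr_weighted.
Qed.

Lemma path_sqn_weighted f g e : path_measurable f -> path_measurable g -> 0 < e ->
  (path_sqn f <= (1 + e)%:E * path_sqn g + (1 + e^-1)%:E * path_sqn (fun u => f u - g u)%R)%E.
Proof.
move=> mf mg e0; have mfg := path_measurableB mf mg.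
have h1 : 0 <= 1 + e by rewrite addr_ge0// ltW.
have h2 : 0 <= 1 + e^-1 by rewrite addr_ge0// invr_ge0 ltW.
have m1 := measurable_enorm_sqr mf; have m2 := measurable_enorm_sqr mg.
have m3 := measurable_enorm_sqr mfg.
rewrite -!ge0_integralZl ?lee_fin//; try by move=> w _; rewrite lee_fin sqr_ge0.
rewrite -ge0_integralD//; first last.
- exact: measurable_funeM.
- by move=> w _; rewrite -EFinM lee_fin mulr_ge0// sqr_ge0.
- exact: measurable_funeM.
- by move=> w _; rewrite -EFinM lee_fin mulr_ge0// sqr_ge0.
apply: ge0_le_integral => //.
- by move=> w _; rewrite lee_fin sqr_ge0.
- by apply: emeasurable_funD; exact: measurable_funeM.
- move=> w _; rewrite -!EFinM -EFinD lee_fin.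
  by have := enorm_weighted (g w) (f w - g w) e0; rewrite addrC subrK.
Qed.

Lemma path_sqnBC f g : path_sqn (fun u => f u - g u) = path_sqn (fun u => g u - f u).
Proof.
apply: eq_integral => u _; congr EFin; rewrite !enorm_sqr -opprB -scaleN1r.
by rewrite dotpZl dotpZr mulrA mulrNN !mul1r.
Qed.

Lemma path_sqnD f g : path_measurable f -> path_measurable g ->
  (path_sqn (fun u => f u + g u)%R <= 2%:E * path_sqn f + 2%:E * path_sqn g)%E.
Proof.
move=> mf mg; have := path_sqn_weighted (path_measurableD mf mg) mf ltr01.
rewrite invr1 (_ : 1 + 1 = 2 :> R); last by ring.
move=> /le_trans; apply; rewrite leeD// lee_wpmul2l ?lee_fin//.
rewrite [X in (X <= _)%E](_ : _ = path_sqn g)//.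
by apply: eq_integral => u _; rewrite addrC addKr.
Qed.

Lemma path_sqnZ c f : path_measurable f ->
  path_sqn (fun u => c *: f u) = ((c ^+ 2)%:E * path_sqn f)%E.
Proof.
move=> mf; rewrite -ge0_integralZl//.
- by apply: eq_integral => u _; rewrite -EFinM !enorm_sqr dotpZl dotpZr; congr EFin; ring.
- exact: measurable_enorm_sqr.
- by move=> u _; rewrite lee_fin sqr_ge0.
- by rewrite lee_fin sqr_ge0.
Qed.

Lemma L2path_integrable_dotp f g : L2path t f -> L2path t g ->
  mu.-integrable `[0, t] (EFin \o (fun u => dotp (f u) (g u))).
Proof.
move=> [mf sf] [mg sg].
have i (h : R -> 'rV[R]_m) : path_measurable h -> (path_sqn h < +oo)%E ->
    mu.-integrable `[0, t] (fun u => (enorm (h u) ^+ 2)%:E).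
  move=> mh sh; apply/integrableP; split; first exact: measurable_enorm_sqr.
  by under eq_integral do rewrite gee0_abs ?lee_fin ?sqr_ge0//.
have ifg : mu.-integrable `[0, t] (fun u => (enorm (f u) ^+ 2)%:E + (enorm (g u) ^+ 2)%:E)%E.
  by apply: integrableD => //; exact: i.
apply: (le_integrable _ _ _ ifg) => //.
  by apply/measurable_EFinP; exact: measurable_dotp.
move=> u _ /=; rewrite lee_fin [leRHS]ger0_norm ?addr_ge0 ?sqr_ge0//.
rewrite !enorm_sqr /dotp -big_split/= (le_trans (ler_norm_sum _ _ _))//.
apply: ler_sum => k _; rewrite normrM -!expr2.
rewrite -[f u ord0 k ^+ 2]real_normK ?num_real// -[g u ord0 k ^+ 2]real_normK ?num_real//.
have := normr_ge0 (f u ord0 k); have := normr_ge0 (g u ord0 k); nra.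
Qed.

Lemma L2path_dotDl f g h : L2path t f -> L2path t g -> L2path t h ->
  L2path_dot t (fun u => f u + g u) h = L2path_dot t f h + L2path_dot t g h.
Proof.
move=> Lf Lg Lh; rewrite /L2path_dot -RintegralD//; try exact: L2path_integrable_dotp.
by apply: eq_Rintegral => u _; rewrite dotpDl.
Qed.

Lemma L2path_dotC f g : L2path_dot t f g = L2path_dot t g f.
Proof. by apply: eq_Rintegral => u _; rewrite dotpC. Qed.

Lemma L2pathD f g : L2path t f -> L2path t g -> L2path t (fun u => f u + g u).
Proof.
move=> [mf sf] [mg sg]; split; first exact: path_measurableD.
apply: le_lt_trans (path_sqnD mf mg) _.
by rewrite lte_add_pinfty// lte_mul_pinfty ?lee_fin.
Qed.

Lemma path_sqn_dot f : L2path t f -> path_sqn f = (L2path_dot t f f)%:E.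
Proof.
move=> Lf; rewrite /L2path_dot /Rintegral.
rewrite fineK; last exact/integrable_fin_num/L2path_integrable_dotp.
by apply: eq_integral => u _; rewrite enorm_sqr.
Qed.

End path_space.

(** * Isometry and linearity of Wiener integrals *)

Section wiener_integrals.
Context d (W : measurableType d) (R : realType) (P : probability W R).
Context (m : nat) (B : R -> W -> 'rV[R]_m) (T : R) (B_bm : brownian_motion P B T).
Context (t : R) (tT : 0 <= t <= T).
Local Notation sqn := (L2sqn P).
Local Notation wiener f X := (is_wiener_integral P B f t X).
Implicit Types f g : R -> 'rV[R]_m.

Lemma wiener_L2limits f X : wiener f X -> L2limits P (step_integrals B t) X.
Proof.
move=> [mX [st [vst _ H]]]; split; first exact: mX.
exists (fun n => step_int B (st n)); last exact: H.
by move=> n; exists (st n) => //; exact: vst.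
Qed.

(** The approximating step integral and its integrand share the squared norm [u n]; comparing the
    two limits through it in both directions gives equality, infinite values included. *)
Lemma wiener_isometry f X : path_measurable t f -> wiener f X -> sqn X = path_sqn t f.
Proof.
move=> mf [mX [st [vst Hf HX]]].
have ms n := @path_measurable_step R m t (st n).
have mI n := measurable_step_int B_bm tT (vst n).
have uE n : (fine (sqn (step_int B (st n))))%:E = sqn (step_int B (st n)).
  have [S [_ ES]] := step_int_mgf B_bm tT (vst n).
  by rewrite (step_int_isometry B_bm tT (vst n)) ES.
pose u n := fine (sqn (step_int B (st n))).
pose v n := sqn (fun w => X w - step_int B (st n) w).
pose v' n := path_sqn t (fun r => f r - step_fun (st n) r).
have v0 n : (0 <= v n)%E by exact: sqn_ge0.
have v'0 n : (0 <= v' n)%E by exact: path_sqn_ge0.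
have sX := sqn_ge0 P X; have sf := path_sqn_ge0 t f.
apply/eqP; rewrite eq_le; apply/andP; split.
- apply: (@weighted_elimit_le _ _ _ u v v') => // e n e0; rewrite /u uE.
    exact: sqn_weighted.
  by rewrite (step_int_isometry B_bm tT (vst n)) /v' path_sqnBC; exact: path_sqn_weighted.
- apply: (@weighted_elimit_le _ _ _ u v' v) => // e n e0; rewrite /u uE.
    by rewrite (step_int_isometry B_bm tT (vst n)); exact: path_sqn_weighted.
  by rewrite /v sqnBC; exact: sqn_weighted.
Qed.

Lemma wienerD f g X Y : path_measurable t f -> path_measurable t g ->
  wiener f X -> wiener g Y -> wiener (fun u => f u + g u) (fun w => X w + Y w).
Proof.
move=> mf mg [mX [st [vst Hf HX]]] [mY [st' [vst' Hg HY]]].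
have cvg2 (a b : nat -> \bar R) : a n @[n --> \oo] --> 0%E -> b n @[n --> \oo] --> 0%E ->
    (2%:E * a n + 2%:E * b n)%E @[n --> \oo] --> 0%E.
  move=> ca cb; rewrite [X in _ --> X](_ : 0 = 2%:E * 0 + 2%:E * 0)%E; last by rewrite mule0 adde0.
  by apply: cvgeD => //; apply: cvgeZl.
split; first exact: measurable_funD.
exists (fun n => st n ++ st' n); split.
- by move=> n; exact: (valid_steps_cat (vst n) (vst' n)).
- apply: (@squeeze_cvge _ _ _ _ (cst 0%E) _ _ _ _ _ (cvg2 _ _ Hf Hg)); last exact: cvg_cst.
  apply: nearW => n; rewrite (path_sqn_ge0 t (fun u => f u + g u - step_fun (st n ++ st' n) u))/=.
  rewrite [X in (X <= _)%E](_ : _ = path_sqn t (fun u => (f u - step_fun (st n) u) + (g u - step_fun (st' n) u))).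
    by apply: path_sqnD; apply: path_measurableB => //; exact: path_measurable_step.
  by apply: eq_integral => u _; rewrite step_fun_cat opprD addrACA.
- apply: (@squeeze_cvge _ _ _ _ (cst 0%E) _ _ _ _ _ (cvg2 _ _ HX HY)); last exact: cvg_cst.
  apply: nearW => n; rewrite (sqn_ge0 P (fun w => X w + Y w - step_int B (st n ++ st' n) w))/=.
  rewrite [X in (X <= _)%E](_ : _ = sqn (fun w => (X w - step_int B (st n) w) + (Y w - step_int B (st' n) w))).
    by apply: sqnD; apply: measurable_funB => //; [exact: (measurable_step_int B_bm tT (vst n))|exact: (measurable_step_int B_bm tT (vst' n))].
  by apply: eq_integral => w _; rewrite step_int_cat opprD addrACA.
Qed.

Lemma wienerZ c f X : path_measurable t f -> wiener f X ->
  wiener (fun u => c *: f u) (fun w => c * X w).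
Proof.
move=> mf [mX [st [vst Hf HX]]]; split; first exact: measurable_funM.
exists (fun n => scale_steps c (st n)); split.
- by move=> n; exact: (valid_steps_scale c (vst n)).
- rewrite [X in X @ _ --> _](_ : _ = (fun n => (c ^+ 2)%:E * path_sqn t (fun u => f u - step_fun (st n) u)%R)%E).
    by rewrite -[X in _ --> X](mule0 (c ^+ 2)%:E); apply: cvgeZl.
  apply/funext => n; rewrite -path_sqnZ; last by apply: path_measurableB => //; exact: path_measurable_step.
  by apply: eq_integral => u _; rewrite step_fun_scale scalerBr.
- rewrite [X in X @ _ --> _](_ : _ = (fun n => (c ^+ 2)%:E * sqn (fun w => X w - step_int B (st n) w)%R)%E).
    by rewrite -[X in _ --> X](mule0 (c ^+ 2)%:E); apply: cvgeZl.
  apply/funext => n; rewrite -sqnZ; last by apply: measurable_funB => //; exact: (measurable_step_int B_bm tT (vst n)).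
  by apply: eq_integral => w _; rewrite step_int_scale mulrBr.
Qed.

Lemma wiener_step st : valid_steps t st -> wiener (step_fun st) (step_int B st).
Proof.
move=> vst; split; first exact: (measurable_step_int B_bm tT).
exists (fun=> st); split => //.
- rewrite (_ : (fun n => _) = cst 0%E); first exact: cvg_cst.
  apply/funext => n; under eq_integral do rewrite subrr enorm_sqr dotp0l.
  by rewrite integral0.
- rewrite (_ : (fun n => _) = cst 0%E); first exact: cvg_cst.
  apply/funext => n; under eq_integral do rewrite subrr expr0n/=.
  by rewrite integral0.
Qed.

Lemma wiener_sum N (F : nat -> R -> 'rV[R]_m) (X : nat -> W -> R) :
  (forall i, path_measurable t (F i)) -> (forall i, wiener (F i) (X i)) ->
  wiener (fun u => \sum_(i < N) F i u) (fun w => \sum_(i < N) X i w).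
Proof.
move=> mF wF; elim: N => [|N IH].
  rewrite (_ : (fun u => _) = step_fun [::]); last first.
    by apply/funext => u; rewrite /step_fun big_nil big_ord0.
  rewrite (_ : (fun w => _) = step_int B [::]); first exact: wiener_step.
  by apply/funext => w; rewrite /step_int big_nil big_ord0.
rewrite (_ : (fun u => _) = (fun u => (\sum_(i < N) F i u) + F N u)); last first.
  by apply/funext => u; rewrite big_ord_recr.
rewrite (_ : (fun w => _) = (fun w => (\sum_(i < N) X i w) + X N w)); last first.
  by apply/funext => w; rewrite big_ord_recr.
by apply: wienerD => //; exact: path_measurable_sum.
Qed.

Lemma wiener_moments f X : wiener f X -> moments P X.
Proof.
move=> /wiener_L2limits; have := L2limits_gaussian (step_integrals_gaussian B_bm tT).
by move=> /gaussian_moments/[apply].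
Qed.

(** Polarization: the isometry for [f], for [g] and for their sum. *)
Lemma wiener_dot f g X Y : L2path t f -> L2path t g -> wiener f X -> wiener g Y ->
  (\int[P]_w (X w * Y w))%R = L2path_dot t f g.
Proof.
move=> Lf Lg wX wY; have [mf _] := Lf; have [mg _] := Lg.
have mX := wiener_moments wX; have mY := wiener_moments wY.
have Lfg := L2pathD Lf Lg.
have e1 := wiener_isometry (path_measurableD mf mg) (wienerD mf mg wX wY).
have e2 := wiener_isometry mf wX; have e3 := wiener_isometry mg wY.
move: e1 e2 e3; rewrite !sqnE//; last exact: momentsD.
rewrite !path_sqn_dot// => -[e1] [e2] [e3].
move: e1; rewrite (L2path_dotDl Lf Lg Lfg).
rewrite (L2path_dotC t f) (L2path_dotDl Lf Lg Lf) (L2path_dotC t g (fun u => f u + g u)) (L2path_dotDl Lf Lg Lg).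
rewrite -e2 -e3 (L2path_dotC t g f).
have mX2 := momentsX 2 mX; have mY2 := momentsX 2 mY; have mXY := momentsM mX mY.
have -> : (\int[P]_w ((X w + Y w) ^+ 2))%R =
   \int[P]_w (X w ^+ 2) + (2 * \int[P]_w (X w * Y w) + \int[P]_w (Y w ^+ 2)).
  rewrite -RintZ// -RintD//; last exact: moments_scale.
  rewrite -RintD//; last by apply: momentsD => //; exact: moments_scale.
  by apply: Rint_ext => w; ring.
by move=> H; lra.
Qed.

End wiener_integrals.

(** * Hermite polynomials *)

Section hermite_polynomials.
Context (R : realType).

(** The polynomial factor of the derivatives of exp(-u^2 / 2): one more differentiation sends p to
    p' - u p. Up to the sign (-1)^n these are the probabilists' Hermite polynomials. *)
Fixpoint gauss_deriv_poly (n : nat) : {poly R} :=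
  if n is k.+1 then (gauss_deriv_poly k)^`() - 'X * gauss_deriv_poly k else 1.

Definition hermite_poly (n : nat) : {poly R} :=
  ((-1) ^+ n / n`!%:R) *: gauss_deriv_poly n.

Lemma is_derive_horner (p : {poly R}) (x : R) : is_derive x (1:R) (fun y : R => p.[y]) p^`().[x].
Proof.
elim/poly_ind: p => [|p c IH].
  rewrite derivC horner0 (_ : (fun y => _) = cst 0); last by apply/funext => y; rewrite horner0.
  exact: is_derive_cst.
rewrite (_ : (fun y => _) = (fun y : R => p.[y] * y + c)); last first.
  by apply/funext => y; rewrite hornerMXaddC.
apply: is_derive_eq; rewrite /GRing.scale/= derivD derivM derivX derivC !hornerE/=.
by ring.
Qed.

Lemma gauss_derive1n n :
  ((fun u : R => expR (- (u ^+ 2 / 2)))^`(n))%classic =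
  (fun x => (gauss_deriv_poly n).[x] * expR (- (x ^+ 2 / 2))).
Proof.
elim: n => [|n IH]; first by apply/funext => x; rewrite derive1n0 /= hornerC mul1r.
rewrite derive1nS IH; apply/funext => x; rewrite derive1E.
have H := is_derive_horner (gauss_deriv_poly n) x.
have D : is_derive x (1:R) (fun y : R => (gauss_deriv_poly n).[y] * expR (- (y ^+ 2 / 2)))
    ((gauss_deriv_poly n.+1).[x] * expR (- (x ^+ 2 / 2))).
  by apply: is_derive_eq; rewrite /GRing.scale/= !hornerE/=; field.
by case: D.
Qed.

Lemma hermiteE n (x : R) : hermite n x = (hermite_poly n).[x].
Proof.
rewrite /hermite gauss_derive1n /hermite_poly hornerZ.
rewrite -[in LHS]mulrA [expR _ * _]mulrCA -expRD subrr expR0 mulr1//.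
Qed.

Lemma gauss_deriv_polyS_deriv n :
  (gauss_deriv_poly n.+1)^`() = - (n.+1%:R *: gauss_deriv_poly n).
Proof.
elim: n => [|n IH].
  have d1 : (1 : {poly R})^`() = 0 by rewrite -polyC1 derivC.
  by rewrite /= mulr1 d1 sub0r derivN derivX scale1r.
have E : gauss_deriv_poly n.+2 = (gauss_deriv_poly n.+1)^`() - 'X * gauss_deriv_poly n.+1 by [].
rewrite E IH derivB derivN derivZ derivM derivX IH mul1r.
have -> : (gauss_deriv_poly n)^`() = gauss_deriv_poly n.+1 + 'X * gauss_deriv_poly n by rewrite /= subrK.
rewrite -[in n.+2%:R]addn1 natrD scalerDl scale1r scalerDr mulrN scalerAr.
by ring.
Qed.

Lemma hermite_poly0 : hermite_poly 0 = 1.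
Proof. by rewrite /hermite_poly expr0 fact0 divr1 scale1r. Qed.

Lemma hermite_polyS_deriv n : (hermite_poly n.+1)^`() = hermite_poly n.
Proof.
rewrite /hermite_poly derivZ gauss_deriv_polyS_deriv scalerN -scaleNr scalerA.
congr (_ *: _); rewrite exprS factS natrM; field.
by rewrite nat1r !pnatr_eq0 -lt0n fact_gt0.
Qed.

Lemma hermite_polyS n : n.+1%:R *: hermite_poly n.+1 = 'X * hermite_poly n - (hermite_poly n)^`().
Proof.
rewrite /hermite_poly derivZ -scalerAr -scalerBr -[X in _ = _ *: X]opprB scalerN -scaleNr scalerA.
congr (_ *: _); rewrite exprS factS natrM; field.
by rewrite nat1r !pnatr_eq0 -lt0n fact_gt0.
Qed.

(* On products of Hermite polynomials, the identity [L ('X * p) = L p^`()]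
   determines [L] up to the value [L 1]: it lowers both degrees at once. *)
Lemma hermite_orthogonal (L : {poly R} -> R) :
  (forall p q, L (p + q) = L p + L q) -> (forall c p, L (c *: p) = c * L p) ->
  (forall p, L ('X * p) = L p^`()) ->
  forall a b, L (hermite_poly a * hermite_poly b) = (a == b)%:R / a`!%:R * L 1.
Proof.
move=> LD LZ LX.
have L0 : L 0 = 0 by rewrite -(scale0r 0) LZ mul0r.
have LB p q : L (p - q) = L p - L q by rewrite LD -scaleN1r LZ mulN1r.
have step a b : a.+1%:R * L (hermite_poly a.+1 * hermite_poly b) =
    L (hermite_poly a * (hermite_poly b)^`()).
  rewrite -LZ scalerAl hermite_polyS mulrBl LB -mulrA LX derivM LD; ring.
have a1 (a : nat) : a.+1%:R != 0 :> R by rewrite pnatr_eq0.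
elim=> [|a IH] [|b].
- by rewrite hermite_poly0 mulr1 eqxx fact0 divr1 mul1r.
- apply: (mulfI (a1 b)); rewrite [hermite_poly 0 * _]mulrC step.
  by rewrite hermite_poly0 derivC mulr0 L0 mul0r !mul0r mulr0.
- apply: (mulfI (a1 a)); rewrite step hermite_poly0 derivC mulr0 L0.
  by rewrite !mul0r mulr0.
- apply: (mulfI (a1 a)); rewrite step hermite_polyS_deriv IH eqSS factS natrM.
  by field; rewrite nat1r !pnatr_eq0 -lt0n fact_gt0.
Qed.

End hermite_polynomials.

(** * Expectations of products of Hermite polynomials *)

Section gaussian_orthogonality.
Context d (W : measurableType d) (R : realType) (P : probability W R).
Context (Gs : set (W -> R)) (GsG : gaussian_space P Gs).
Context (I : nat -> W -> R) (GI : forall i, Gs (I i)).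
Local Notation "''E' X" := (Rintegral P setT X) (at level 10, X at level 9).
Context (Iorth : forall i j, 'E (fun w => I i w * I j w) = (i == j)%:R).

Let mI i : moments P (I i).
Proof. exact: expmoments_moments (gaussian_expmoments GsG (GI i)). Qed.

Lemma moments_prod_horner (r : nat -> {poly R}) M :
  moments P (fun w => \prod_(i < M) (r i).[I i w]).
Proof. by apply: moments_prod => i; exact: moments_horner. Qed.

(** By orthonormality the derivative in the direction [I k] sees only the factor [k], which is
    present exactly when [k < M]. *)
Lemma stein_pair_prod (r : nat -> {poly R}) k M :
  stein_pair P Gs (I k) (fun w => \prod_(i < M) (r i).[I i w])
    (fun w => (k < M)%:R * \prod_(i < M) (if i == k :> nat then (r i)^`() else r i).[I i w]).
Proof.
elim: M => [|M IH].
  have := stein_pair1 GsG (GI k); congr stein_pair; apply/funext => w.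
    by rewrite big_ord0.
  by rewrite ltn0 mul0r.
have := stein_pair_horner GsG (r M) (GI k) (GI M) IH.
congr stein_pair; apply/funext => w.
  by rewrite big_ord_recr/= mulrC.
rewrite Iorth big_ord_recr/=.
have [kM|kM|->] := ltngtP k M.
- by rewrite ltnS (ltnW kM)/= !mul1r !mul0r addr0 mulrC.
- by rewrite ltnS leqNgt kM/= !mul0r mulr0 addr0.
- rewrite ltnSn/= !mul0r mulr0 add0r !mul1r mulrC; congr (_ * _).
  by apply: eq_bigr => i _; rewrite ltn_eqF.
Qed.

(** In [Phi k] the first [k] factors are already replaced by their expectations. As a functional of
    the polynomial in slot [k], the expectation satisfies the relation that [hermite_orthogonal]
    asks for, whatever the other factors are; this takes the place of independence of the [I i]. *)
Lemma hermite_prod_expectation (a b : nat -> nat) M :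
  'E (fun w => \prod_(i < M) ((hermite_poly R (a i)).[I i w] * (hermite_poly R (b i)).[I i w])) =
  \prod_(i < M) ((a i == b i)%:R / (a i)`!%:R).
Proof.
pose c i : R := (a i == b i)%:R / (a i)`!%:R.
pose r (k i : nat) : {poly R} := if (i < k)%N then (c i)%:P else hermite_poly R (a i) * hermite_poly R (b i).
pose Phi k := 'E (fun w => \prod_(i < M) (r k i).[I i w]).
have step k : (k < M)%N -> Phi k = Phi k.+1.
  move=> kM.
  pose s p (i : nat) : {poly R} := if i == k then p else r k i.
  pose L p := 'E (fun w => \prod_(i < M) (s p i).[I i w]).
  have pull p : L p = 'E (fun w => p.[I k w] * \prod_(i < M | i != Ordinal kM) (r k i).[I i w]).
    apply: Rint_ext => w; rewrite (bigD1 (Ordinal kM))//= /s eqxx; congr (_ * _).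
    by apply: eq_bigr => i ik; rewrite -(inj_eq val_inj)/= in ik; rewrite (negbTE ik).
  have mrest : moments P (fun w => \prod_(i < M | i != Ordinal kM) (r k i).[I i w]).
    under eq_fun do rewrite big_mkcond/=.
    apply: moments_prod => i; case: (i != Ordinal kM); last exact: moments_cst.
    exact: moments_horner.
  have mp p : moments P (fun w => p.[I k w] * \prod_(i < M | i != Ordinal kM) (r k i).[I i w]).
    by apply: momentsM => //; exact: moments_horner.
  have LD p q : L (p + q) = L p + L q.
    by rewrite !pull -RintD//; apply: Rint_ext => w; rewrite hornerD mulrDl.
  have LZ e p : L (e *: p) = e * L p.
    by rewrite !pull -RintZ//; apply: Rint_ext => w; rewrite hornerZ mulrA.
  have LX p : L ('X * p) = L p^`().
    transitivity ('E (fun w => I k w * \prod_(i < M) (s p i).[I i w])).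
      apply: Rint_ext => w; rewrite (bigD1 (Ordinal kM))//= [in RHS](bigD1 (Ordinal kM))//=.
      rewrite /s eqxx hornerM hornerX mulrA; congr (_ * _).
      by apply: eq_bigr => i ik; rewrite -(inj_eq val_inj)/= in ik; rewrite (negbTE ik).
    rewrite (stein_pairE GsG (GI k) (stein_pair_prod (s p) k M)).
    apply: Rint_ext => w; rewrite kM mul1r; apply: eq_bigr => i _.
    by rewrite /s; case: eqP.
  have := hermite_orthogonal LD LZ LX (a k) (b k).
  rewrite -/(c k) -LZ alg_polyC => E.
  transitivity (L (hermite_poly R (a k) * hermite_poly R (b k))).
    apply: Rint_ext => w; apply: eq_bigr => i _.
    by rewrite /s /r; case: eqP => [->|//]; rewrite ltnn.
  rewrite E; apply: Rint_ext => w; apply: eq_bigr => i _.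
  rewrite /s /r ltnS [in RHS]leq_eqVlt; case: eqP => [->|_] //=.
have all k : (k <= M)%N -> Phi 0%N = Phi k.
  by elim: k => // k IH kM; rewrite IH ?(ltnW kM)//; exact: step.
transitivity (Phi 0%N).
  by apply: Rint_ext => w; apply: eq_bigr => i _; rewrite /r hornerM.
rewrite (all M (leqnn M)); transitivity ('E (cst (\prod_(i < M) c i))); last exact: RintcstE.
apply: Rint_ext => w; apply: eq_bigr => i _.
by rewrite /r ltn_ord hornerC.
Qed.

End gaussian_orthogonality.

(** * Chaos sums *)

Section multiindices.

Definition mi_box (p M : nat) : set multiindex :=
  [set a : multiindex | (mi_size a <= p)%N /\ forall k, (M <= k)%N -> a k = 0%N].

(** Replaces the support by a range [M] that several multi-indices can share. *)
Lemma big_finsupp (S : Type) (idx : S) (op : Monoid.com_law idx) (F : nat -> nat -> S)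
    (a : multiindex) M : (forall i, F i 0%N = idx) -> (forall k, (M <= k)%N -> a k = 0%N) ->
  \big[op/idx]_(i <- finsupp a) F i (a i) = \big[op/idx]_(i < M) F i (a i).
Proof.
move=> F0 aM; rewrite -(big_mkord xpredT (fun i => F i (a i))) /index_iota subn0.
rewrite [RHS](bigID (fun i => a i != 0%N))/= [X in op _ X]big1; last first.
  by move=> i; rewrite negbK => /eqP ->.
rewrite Monoid.mulm1 -[RHS]big_filter; apply: perm_big.
apply: uniq_perm; first exact: fset_uniq.
  by rewrite filter_uniq// iota_uniq.
move=> i; rewrite mem_finsupp mem_filter mem_iota add0n/=.
by have [//|/aM->] := ltnP i M; rewrite ?andbT// eqxx.
Qed.

Lemma mi_bounded (a : multiindex) : exists M, forall k, (M <= k)%N -> a k = 0%N.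
Proof.
exists (\max_(i <- finsupp a) i).+1 => k Mk; apply: fsfun_dflt.
by apply/negP => ka; move: Mk; rewrite ltnNge (@leq_bigmax_seq _ _ xpredT id k ka).
Qed.

Lemma mi_box_finite p M : finite_set (mi_box p M).
Proof.
(* Bounding each entry instead of the size lets the last entry be split off in the induction. *)
pose D M' := [set a : multiindex | (forall k, a k <= p)%N /\ forall k, (M' <= k)%N -> a k = 0%N].
suff H M' : finite_set (D M').
  apply: sub_finite_set (H M) => a [ap aM]; split => // k.
  have [kM|/aM->//] := ltnP k M.
  apply: leq_trans ap; rewrite /mi_size (@big_finsupp _ _ _ (fun _ n => n) a M)//.
  by rewrite (bigD1 (Ordinal kM))//= leq_addr.
elim: M' => [|M' IH].
  apply: sub_finite_set (finite_set1 ([fsfun] : multiindex)) => a [_ a0].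
  by apply/fsfunP => k; rewrite a0// fsfun_dflt// inE.
pose f (a : multiindex) (k : nat) : multiindex := [fsfun a with M' |-> k].
apply: sub_finite_set (finite_image (fun q => f q.1 q.2) (finite_setX IH (finite_II p.+1))) => a [ap aM].
exists ([fsfun a with M' |-> 0%N], a M') => /=.
  split; last by rewrite /= ltnS.
  split=> k; first by rewrite fsfun_withE; case: eqP.
  move=> Mk; rewrite fsfun_withE; case: eqP => // /eqP kM; apply: aM.
  by rewrite ltn_neqAle eq_sym kM.
apply/fsfunP => k; rewrite /f !fsfun_withE; case: eqP => // ->//.
Qed.

Lemma mi_box_sub p p' M M' : (p <= p')%N -> (M <= M')%N -> mi_box p M `<=` mi_box p' M'.
Proof.
move=> pp MM a [ap aM]; split; first exact: leq_trans pp.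
by move=> k Mk; apply: aM; exact: leq_trans Mk.
Qed.

End multiindices.

(** * Chaos sums: orthogonality, best approximation, multiplication *)

Section chaos_expansion.
Context d (W : measurableType d) (R : realType) (P : probability W R).
Context (Gs : set (W -> R)) (GsG : gaussian_space P Gs).
Context (I : nat -> R -> W -> R) (T : R) (GI : forall i, Gs (I i T)).
Local Notation "''E' X" := (Rintegral P setT X) (at level 10, X at level 9).
Context (Iorth : forall i j, 'E (fun w => I i T w * I j T w) = (i == j)%:R).
Local Notation X a := (fun w => chaos_process I T w a).
Local Notation sqn := (L2sqn P).

Lemma chaos_processE (a : multiindex) M w : (forall k, (M <= k)%N -> a k = 0%N) ->
  chaos_process I T w a = \prod_(i < M) (hermite_poly R (a i)).[I i T w].
Proof.
move=> aM; rewrite /chaos_process.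
rewrite (@big_finsupp _ _ _ (fun i n => hermite n (I i T w)) a M)//.
  by apply: eq_bigr => i _; rewrite hermiteE.
by move=> i; rewrite hermiteE hermite_poly0 hornerC.
Qed.

Lemma chaos_moments a : moments P (X a).
Proof.
have [M aM] := mi_bounded a; rewrite (_ : X a = fun w => \prod_(i < M) (hermite_poly R (a i)).[I i T w]).
  exact: (@moments_prod_horner _ _ _ _ _ GsG (fun i => I i T) GI (fun i => hermite_poly R (a i))).
by apply/funext => w; rewrite (chaos_processE w aM).
Qed.

Lemma mi_fact_gt0 a : 0 < (mi_fact a)%:R :> R.
Proof. by rewrite ltr0n; apply: prodn_gt0 => i; exact: fact_gt0. Qed.

Lemma chaos_orthogonal a b : 'E (fun w => X a w * X b w) = (a == b)%:R / (mi_fact a)%:R.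
Proof.
have [Ma aM] := mi_bounded a; have [Mb bM] := mi_bounded b.
pose M := maxn Ma Mb.
have aM' k : (M <= k)%N -> a k = 0%N by rewrite geq_max => /andP[+ _]; exact: aM.
have bM' k : (M <= k)%N -> b k = 0%N by rewrite geq_max => /andP[_]; exact: bM.
transitivity ('E (fun w => \prod_(i < M) ((hermite_poly R (a i)).[I i T w] * (hermite_poly R (b i)).[I i T w]))).
  by apply: Rint_ext => w; rewrite (chaos_processE w aM') (chaos_processE w bM') big_split.
rewrite (hermite_prod_expectation GsG GI Iorth a b M).
have [->|ab] := eqVneq a b.
  rewrite mul1r /mi_fact (@big_finsupp _ _ _ (fun _ n => n`!) b M)//.
  rewrite natr_prod -prodfV; apply: eq_bigr => i _; rewrite eqxx mul1r//.
have [k abk] : exists k, a k != b k.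
  apply/not_existsP => H; move/eqP: ab; apply; apply/fsfunP => k.
  by apply/eqP/negP => /negP; exact: H.
have kM : (k < M)%N by rewrite ltnNge; apply/negP => Mk; rewrite (aM' _ Mk) (bM' _ Mk) eqxx in abk.
by rewrite (bigD1 (Ordinal kM))//= (negbTE abk) !mul0r.
Qed.

Definition chaos_sum (p M : nat) (c : multiindex -> R) (w : W) : R :=
  \sum_(a \in mi_box p M) c a * X a w.

Lemma chaos_sumE p M c w : chaos_sum p M c w = \sum_(a <- fset_set (mi_box p M)) c a * X a w.
Proof. by rewrite /chaos_sum fsbig_finite//; exact: mi_box_finite. Qed.

Lemma chaos_projE p M xi w : chaos_proj P I T p M xi w = chaos_sum p M (chaos_coef P I T xi) w.
Proof. by []. Qed.

Lemma chaos_sum_moments p M c : moments P (chaos_sum p M c).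
Proof.
rewrite (_ : chaos_sum p M c = fun w => \sum_(a <- fset_set (mi_box p M)) c a * X a w).
  by apply: moments_sum => a; apply: moments_scale; exact: chaos_moments.
by apply/funext => w; rewrite chaos_sumE.
Qed.

Lemma integrable_Rint_sum (J : Type) (s : seq J) (F : J -> W -> R) :
  (forall j, P.-integrable setT (EFin \o F j)) ->
  P.-integrable setT (EFin \o (fun w => \sum_(j <- s) F j w)) /\
  'E (fun w => \sum_(j <- s) F j w) = \sum_(j <- s) 'E (F j).
Proof.
move=> iF; elim: s => [|j s [IH1 IH2]].
  rewrite big_nil (_ : (fun w => _) = cst 0); last by apply/funext => w; rewrite big_nil.
  split; first exact: (moments_integrable (moments_cst P 0)).
  by rewrite (RintcstE P 0).
rewrite big_cons -IH2 -RintegralD//; split.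
  by have := integrable_funD (iF j) IH1; apply: eq_integrable => // w _ /=; rewrite big_cons.
by apply: Rint_ext => w; rewrite big_cons.
Qed.

(** By orthogonality the squared distance separates into one quadratic polynomial per coefficient,
    minimal at [chaos_coef]; best approximation is then a comparison term by term. *)
Lemma chaos_sum_sqn p M (c : multiindex -> R) (xi : W -> R) :
  measurable_fun setT xi -> (sqn xi < +oo)%E ->
  sqn (fun w => xi w - chaos_sum p M c w) =
  ('E (fun w => xi w ^+ 2) +
    \sum_(a <- fset_set (mi_box p M))
      ((c a ^+ 2 - 2 * c a * chaos_coef P I T xi a) / (mi_fact a)%:R))%:E.
Proof.
move=> mxi sxi; set s := fset_set _.
have mX a := chaos_moments a.
have ixX a : P.-integrable setT (EFin \o (fun w => xi w * X a w)).
  by apply: integrable_mul2 => //; [exact: moments_measurable (mX a)|exact: moments_sqn].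
have icxX a : P.-integrable setT (EFin \o (fun w => - 2 * c a * (xi w * X a w))).
  exact: integrable_funZ.
have ix2 := integrable_sqr mxi sxi.
have mms := chaos_sum_moments p M c.
have iv2 : P.-integrable setT (EFin \o (fun w => chaos_sum p M c w ^+ 2)).
  exact/moments_integrable/momentsX.
have [iS ES] := integrable_Rint_sum s icxX.
have mdiff : measurable_fun setT (fun w => xi w - chaos_sum p M c w).
  by apply: measurable_funB => //; exact: moments_measurable mms.
have sdiff : (sqn (fun w => xi w - chaos_sum p M c w)%R < +oo)%E.
  apply: le_lt_trans (sqnB P mxi (moments_measurable mms)) _.
  by rewrite lte_add_pinfty// lte_mul_pinfty ?lee_fin// moments_sqn.
have -> : sqn (fun w => xi w - chaos_sum p M c w) = ('E (fun w => (xi w - chaos_sum p M c w) ^+ 2))%:E.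
  by rewrite /Rintegral fineK//; exact: (integrable_fin_num measurableT (integrable_sqr mdiff sdiff)).
congr EFin.
transitivity ('E (fun w => xi w ^+ 2 + (\sum_(a <- s) (- 2 * c a * (xi w * X a w)) + chaos_sum p M c w ^+ 2))).
  apply: Rint_ext => w; rewrite sqrrB addrA; congr (_ + _ + _).
  rewrite chaos_sumE -/s -mulr_natl mulr_sumr mulr_sumr -sumrN; apply: eq_bigr => a _; ring.
have i3 : P.-integrable setT (EFin \o (fun w => \sum_(a <- s) (- 2 * c a * (xi w * X a w)) + chaos_sum p M c w ^+ 2)).
  exact: integrable_funD.
rewrite RintegralD// RintegralD// ES; congr (_ + _).
have EX a b : 'E (fun w => c a * X a w * (c b * X b w)) = c a * c b * ((a == b)%:R / (mi_fact a)%:R).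
  rewrite -chaos_orthogonal -RintZ; first by apply: Rint_ext => w; ring.
  exact: momentsM.
have -> : 'E (fun w => chaos_sum p M c w ^+ 2) = \sum_(a <- s) (c a ^+ 2 / (mi_fact a)%:R).
  transitivity ('E (fun w => \sum_(a <- s) \sum_(b <- s) (c a * X a w * (c b * X b w)))).
    apply: Rint_ext => w; rewrite chaos_sumE -/s expr2 mulr_suml; apply: eq_bigr => a _.
    by rewrite mulr_sumr.
  have mab a b : moments P (fun w => c a * X a w * (c b * X b w)).
    by apply: momentsM; apply: moments_scale.
  have [_ ->] := @integrable_Rint_sum _ s (fun a w => \sum_(b <- s) (c a * X a w * (c b * X b w)))
     (fun a => moments_integrable (moments_sum s (mab a))).
  rewrite big_seq [RHS]big_seq; apply: eq_bigr => a sa.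
  have [_ ->] := @integrable_Rint_sum _ s _ (fun b => moments_integrable (mab a b)).
  rewrite (bigD1_seq a)//= EX eqxx mul1r big1 ?addr0 ?expr2//.
  by move=> b ba; rewrite EX eq_sym (negbTE ba) mul0r mulr0.
rewrite -big_split/=; apply: eq_bigr => a _.
rewrite RintegralZl// /chaos_coef [in RHS]unlock -/(Rintegral P setT (fun w => xi w * X a w)).
by field; rewrite gt_eqF// mi_fact_gt0.
Qed.

Lemma chaos_proj_best p M (c : multiindex -> R) (xi : W -> R) :
  measurable_fun setT xi -> (sqn xi < +oo)%E ->
  (sqn (fun w => xi w - chaos_proj P I T p M xi w)%R <= sqn (fun w => xi w - chaos_sum p M c w)%R)%E.
Proof.
move=> mxi sxi.
have -> : sqn (fun w => xi w - chaos_proj P I T p M xi w) =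
    sqn (fun w => xi w - chaos_sum p M (chaos_coef P I T xi) w) by [].
rewrite !chaos_sum_sqn// lee_fin lerD2l; apply: ler_sum => a _.
rewrite ler_pM2r ?invr_gt0 ?mi_fact_gt0//.
by have := sqr_ge0 (c a - chaos_coef P I T xi a); nra.
Qed.

Definition chaos_span : set (W -> R) := [set v | exists p M c, v = chaos_sum p M c].

Lemma chaos_sum_widen p p' M M' c : (p <= p')%N -> (M <= M')%N ->
  exists c', chaos_sum p M c = chaos_sum p' M' c'.
Proof.
move=> pp MM; exists (fun a => if a \in mi_box p M then c a else 0).
apply/funext => w; rewrite /chaos_sum.
transitivity (\sum_(a \in mi_box p M) (if a \in mi_box p M then c a else 0) * X a w).
  by apply: eq_fsbigr => a ap; rewrite ap.
apply: fsbig_widen; first exact: mi_box_sub.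
by move=> a [_ ap] /=; rewrite memNset ?mul0r.
Qed.

Lemma chaos_spanD u v : chaos_span u -> chaos_span v -> chaos_span (fun w => u w + v w).
Proof.
move=> [p [M [c ->]]] [p' [M' [c' ->]]]; exists (maxn p p'), (maxn M M').
have [e ->] := chaos_sum_widen c (leq_maxl p p') (leq_maxl M M').
have [e' ->] := chaos_sum_widen c' (leq_maxr p p') (leq_maxr M M').
exists (fun a => e a + e' a); apply/funext => w; rewrite !chaos_sumE -big_split/=.
by apply: eq_bigr => a _; rewrite mulrDl.
Qed.

Lemma chaos_spanZ c v : chaos_span v -> chaos_span (fun w => c * v w).
Proof.
move=> [p [M [e ->]]]; exists p, M, (fun a => c * e a); apply/funext => w.
by rewrite !chaos_sumE mulr_sumr; apply: eq_bigr => a _; rewrite mulrA.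
Qed.

Lemma chaos_span_process a : chaos_span (X a).
Proof.
have [M aM] := mi_bounded a; exists (mi_size a), M, (fun b => (b == a)%:R).
apply/funext => w; rewrite chaos_sumE (bigD1_seq a)//=.
- by rewrite eqxx mul1r big1 ?addr0// => b /negbTE ->; rewrite mul0r.
- by rewrite in_fset_set ?inE//; exact: mi_box_finite.
- exact: fset_uniq.
Qed.

Lemma chaos_span_moments v : chaos_span v -> moments P v.
Proof. by move=> [p [M [c ->]]]; exact: chaos_sum_moments. Qed.

Lemma chaos_span1 : chaos_span (cst 1).
Proof.
have := chaos_span_process [fsfun]; congr chaos_span; apply/funext => w.
by rewrite (@chaos_processE _ 0) ?big_ord0// => k _; rewrite fsfun_dflt// inE.
Qed.

(** Three-term recurrence x H_n = (n + 1) H_{n+1} + H_{n-1} in the factor [i]; for n = 0 it reads x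
    H_0 = H_1. *)
Lemma chaos_spanM i v : chaos_span v -> chaos_span (fun w => I i T w * v w).
Proof.
move=> [p [M [c ->]]].
have sum0 : chaos_span (cst 0).
  have := chaos_spanZ 0 chaos_span1; congr chaos_span; apply/funext => w.
  by rewrite mul0r.
have sum (s : seq multiindex) (F : multiindex -> W -> R) : (forall a, chaos_span (F a)) ->
    chaos_span (fun w => \sum_(a <- s) F a w).
  move=> sF; elim: s => [|a s IH]; first by under eq_fun do rewrite big_nil.
  by under eq_fun do rewrite big_cons; exact: chaos_spanD.
rewrite (_ : (fun w => _) = fun w => \sum_(a <- fset_set (mi_box p M)) c a * (I i T w * X a w)); last first.
  by apply/funext => w; rewrite chaos_sumE mulr_sumr; apply: eq_bigr => a _; rewrite mulrCA.
apply: sum => a; apply: chaos_spanZ.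
have [M0 aM0] := mi_bounded a; pose N := maxn M0 i.+1.
have iN : (i < N)%N by rewrite leq_max ltnSn orbT.
have aN k : (N <= k)%N -> a k = 0%N by rewrite geq_max => /andP[+ _]; exact: aM0.
have upd n w : chaos_process I T w [fsfun a with i |-> n] =
    (hermite_poly R n).[I i T w] * \prod_(j < N | j != Ordinal iN) (hermite_poly R (a j)).[I j T w].
  rewrite (@chaos_processE _ N).
    rewrite (bigD1 (Ordinal iN))//= fsfun_withE eqxx; congr (_ * _).
    by apply: eq_bigr => j; rewrite -(inj_eq val_inj)/= => ji; rewrite fsfun_withE (negbTE ji).
  by move=> k Nk; rewrite fsfun_withE gtn_eqF ?aN// (leq_trans iN).
have aE : [fsfun a with i |-> a i] = a by exact: fsfun_with_id.
case ai : (a i) => [|n].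
  have := chaos_span_process [fsfun a with i |-> 1%N]; congr chaos_span; apply/funext => w.
  rewrite upd -[in RHS]aE upd ai hermite_poly0 hornerC mul1r; congr (_ * _).
  have := hermite_polyS R 0; rewrite hermite_poly0 scale1r => ->.
  by rewrite mulr1 -polyC1 derivC subr0 hornerX.
have := chaos_spanD (chaos_spanZ n.+2%:R (chaos_span_process [fsfun a with i |-> n.+2]))
  (chaos_span_process [fsfun a with i |-> n]).
congr chaos_span; apply/funext => w.
rewrite !upd -[in RHS]aE upd ai mulrA -mulrDl mulrA; congr (_ * _).
by rewrite -hornerZ hermite_polyS hermite_polyS_deriv !hornerE/= subrK.
Qed.

End chaos_expansion.

(** * Completeness of the chaos *)

Section filtrations.
Context d (W : measurableType d) (R : realType) (P : probability W R).
Context (m : nat) (B : R -> W -> 'rV[R]_m) (T : R) (B_bm : brownian_motion P B T).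
Local Notation Ft := (filtration P B).

Lemma filtration_sigma_algebra t : sigma_algebra setT (Ft t).
Proof. exact: smallest_sigma_algebra. Qed.

Lemma filtration_negligible t A : P.-negligible A -> Ft t A.
Proof. by move=> NA; apply: sub_gen_smallest; right. Qed.

Lemma brownian_wrt_filtration s t k : 0 <= s <= t ->
  measurable_wrt (Ft t) (fun w => B s w ord0 k).
Proof. by move=> st D mD; apply: sub_gen_smallest; left; exists s, k, D. Qed.

Lemma filtration_min t (G : set (set W)) : sigma_algebra setT G ->
  (forall A, P.-negligible A -> G A) ->
  (forall s k, 0 <= s <= t -> measurable_wrt G (fun w => B s w ord0 k)) -> Ft t `<=` G.
Proof.
move=> sG NG BG; apply: smallest_sub => // A [[s [k [D [st mD ->]]]]|/NG//].
exact: BG.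
Qed.

Lemma filtration_measurable (P_complete : measure_is_complete P) t A :
  0 <= t <= T -> Ft t A -> measurable A.
Proof.
move=> /andP[t0 tT]; move: A; apply: filtration_min.
- have := sigma_algebra_measurable W; rewrite /sigma_algebra; exact.
- by move=> A NA; exact: P_complete.
- move=> s k /andP[s0 st] D mD; rewrite -[X in measurable X]setTI.
  by apply: (brownian_measurable B_bm) => //; rewrite s0 (le_trans st).
Qed.

Lemma measurable_wrt_filtration (P_complete : measure_is_complete P) t (f : W -> R) :
  0 <= t <= T -> measurable_wrt (Ft t) f -> measurable_fun setT f.
Proof. by move=> tT mf _ D mD; rewrite setTI; apply: (filtration_measurable P_complete tT); exact: mf. Qed.

Lemma step_int_wrt_filtration t st : 0 <= t <= T -> valid_steps t st ->
  measurable_wrt (Ft t) (step_int B st).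
Proof.
move=> tT; have sF := filtration_sigma_algebra t.
rewrite /step_int => vst.
have -> : (fun w => \sum_(q <- st) dotp q.2 (B q.1.2 w - B q.1.1 w)) =
    (fun w => \sum_(q <- [seq q <- st | (0 <= q.1.1) && (q.1.1 <= q.1.2 <= t)])
        \sum_(k < m) q.2 ord0 k * (B q.1.2 w ord0 k - B q.1.1 w ord0 k)).
  apply/funext => w; move/all_filterP: vst => ->; apply: eq_bigr => q _.
  by apply: eq_bigr => k _; rewrite !mxE.
have : all (fun q : R * R * 'rV[R]_m => (0 <= q.1.1) && (q.1.1 <= q.1.2 <= t))
   [seq q <- st | (0 <= q.1.1) && (q.1.1 <= q.1.2 <= t)] by exact: filter_all.
elim: [seq _ <- _ | _] => [_|q s IH /= /andP[/and3P[q0 q1 q2] /IH ms]].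
  by rewrite (_ : (fun w => _) = cst 0); [exact: measurable_wrt_cst|apply/funext => w; rewrite big_nil].
rewrite (_ : (fun w => _) = fun w => (\sum_(k < m) q.2 ord0 k * (B q.1.2 w ord0 k - B q.1.1 w ord0 k)) +
  \sum_(q <- s) \sum_(k < m) q.2 ord0 k * (B q.1.2 w ord0 k - B q.1.1 w ord0 k)); last first.
  by apply/funext => w; rewrite big_cons.
apply: measurable_wrtD => //; apply: measurable_wrt_sum => // k.
apply: measurable_wrtM => //; first exact: measurable_wrt_cst.
apply: measurable_wrtB => //; apply: brownian_wrt_filtration; first by rewrite q2 (le_trans q0).
by rewrite q0 (le_trans q1).
Qed.

(** An a.e. convergent subsequence suffices, because the filtration contains the null sets. *)
Lemma L2limits_wrt_filtration t X : 0 <= t <= T ->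
  L2limits P (step_integrals B t) X -> measurable_wrt (Ft t) X.
Proof.
move=> tT [mX [u uS uX]].
have mu n : measurable_fun setT (u n).
  by have [st vst ->] := uS n; exact: (measurable_step_int B_bm tT vst).
have [phi phiP] := L2_ae_subsequence mu mX uX.
apply: (measurable_wrt_ae_cvg (filtration_sigma_algebra t) (@filtration_negligible t) _ phiP).
by move=> n; have [st vst ->] := uS (phi n); exact: step_int_wrt_filtration.
Qed.

(* B 0 vanishes almost surely only, so the Brownian coordinates are step
   integrals up to a null set. *)
Lemma brownian_step s k :
  {ae P, forall w, step_int B [:: ((0, s), delta_mx ord0 k)] w = B s w ord0 k}.
Proof.
have [_ B0 _ _ _] := B_bm; apply: filterS B0 => w B0w.
rewrite /step_int big_cons big_nil addr0 B0w subr0 /dotp (bigD1 k)//= mxE !eqxx mul1r big1 ?addr0//.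
by move=> j jk; rewrite mxE eqxx (negbTE jk) mul0r.
Qed.

Lemma filtration_steps_min t (G : set (set W)) : sigma_algebra setT G ->
  (forall A, P.-negligible A -> G A) ->
  (forall X, step_integrals B t X -> measurable_wrt G X) -> Ft t `<=` G.
Proof.
move=> sG NG SG; apply: filtration_min => // s k /andP[s0 st].
apply: (measurable_wrt_ae_eq sG NG _ (brownian_step s k)); apply: SG.
by exists [:: ((0, s), delta_mx ord0 k)] => //; rewrite /valid_steps /= lexx s0 st.
Qed.

End filtrations.

(** * Density of chaos sums among terminal values *)

Section chaos_density.
Context d (W : measurableType d) (R : realType) (P : probability W R).
Context (P_complete : measure_is_complete P).
Context (m : nat) (B : R -> W -> 'rV[R]_m) (T : R) (B_bm : brownian_motion P B T).
Context (T_ge0 : 0 <= T).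
Context (h : nat -> R -> 'rV[R]_m) (h_basis : orthonormal_basis T h).
Context (I : nat -> R -> W -> R).
Context (I_int : forall i, is_wiener_integral P B (h i) T (I i T)).
Local Notation sqn := (L2sqn P).

Let TT : 0 <= T <= T. Proof. by rewrite T_ge0 lexx. Qed.

Definition wiener_space := L2limits P (step_integrals B T).

Lemma wiener_space_gaussian : gaussian_space P wiener_space.
Proof. exact/L2limits_gaussian/(step_integrals_gaussian B_bm TT). Qed.

Lemma wiener_spaceI i : wiener_space (I i T).
Proof. exact: (wiener_L2limits (I_int i)). Qed.

Lemma wiener_orthonormal i j : (\int[P]_w (I i T w * I j T w))%R = (i == j)%:R.
Proof.
have [hL hD _] := h_basis; rewrite -hD.
exact: (wiener_dot B_bm TT (hL i) (hL j) (I_int i) (I_int j)).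
Qed.

Local Notation span := (chaos_span I T).

Let spanM := fun v => @chaos_span_moments _ _ _ _ _ wiener_space_gaussian I T wiener_spaceI v.
Let span1 := @chaos_span1 _ W R I T.
Let spanD := @chaos_spanD _ W R I T.
Let spanZ := @chaos_spanZ _ W R I T.

Local Notation Sg := (multiplier_sets P span).

Let SgS : sigma_algebra setT Sg := Sg_sigma_algebra spanM spanD spanZ.
Let SgN := fun A => @Sg_negligible _ _ _ _ P_complete _ spanM span1 spanZ A.

Lemma chaos_generatorS i : measurable_wrt Sg (I i T).
Proof.
apply: (measS_generator spanM span1 spanD spanZ).
- exact: (gaussian_expmoments wiener_space_gaussian (wiener_spaceI i)).
- exact: chaos_spanM.
Qed.

Lemma step_int_L2path (st : seq (R * R * 'rV[R]_m)) : valid_steps T st -> L2path T (step_fun st).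
Proof.
move=> vst; split; first exact: path_measurable_step.
by have [S [_ ->]] := step_int_mgf B_bm TT vst; exact: ltry.
Qed.

(** The integrand is expanded in the basis [h]; by the isometry the combinations [u N] of the [I i]
    converge in L^2 to the step integral, and along a selection of indices also a.e. *)
Lemma chaos_step_intS st : valid_steps T st -> measurable_wrt Sg (step_int B st).
Proof.
move=> vst; have [hL hD hB] := h_basis.
have fL := step_int_L2path vst.
pose c i := L2path_dot T (step_fun st) (h i).
pose u N w := \sum_(i < N) c i * I i T w.
have mI i : measurable_fun setT (I i T) by case: (I_int i).
have mf := measurable_step_int B_bm TT vst.
have mu N : measurable_fun setT (u N).
  by apply: measurable_sum => i; exact: measurable_funM.
have uf : sqn (fun w => step_int B st w - u N w) @[N --> \oo] --> 0%E.
  have := hB _ fL; apply: cvg_trans; apply: near_eq_cvg; near=> N.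
  have mhN : path_measurable T (fun v => \sum_(i < N) c i *: h i v).
    by apply: path_measurable_sum => i; apply: path_measurableZ; case: (hL i).
  have wN : is_wiener_integral P B (fun v => \sum_(i < N) c i *: h i v) T (u N).
    apply: (@wiener_sum _ _ _ _ _ _ _ B_bm _ TT N (fun i v => c i *: h i v) (fun i w => c i * I i T w)).
    - by move=> i; apply: path_measurableZ; case: (hL i).
    - by move=> i; apply: (wienerZ B_bm TT) => //; case: (hL i).
  have wD := wienerD B_bm TT fL.1 (path_measurableZ (-1) mhN) (wiener_step B_bm TT vst)
    (wienerZ B_bm TT (-1) mhN wN).
  have := wiener_isometry B_bm TT (path_measurableD fL.1 (path_measurableZ (-1) mhN)) wD.
  rewrite [X in _ = sqn X](_ : _ = fun w => step_int B st w + -1 * u N w); last first.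
    by apply/funext => w; rewrite mulN1r.
  by move=> ->; apply: eq_integral => v _; rewrite scaleN1r.
have [phi phiP] := L2_ae_subsequence mu mf uf.
apply: (measurable_wrt_ae_cvg _ _ _ phiP).
- exact: SgS.
- exact: SgN.
- move=> k; apply: measurable_wrt_sum; first exact: SgS.
  move=> i; apply: measurable_wrtM; [exact: SgS| |exact: chaos_generatorS].
  by apply: measurable_wrt_cst; exact: SgS.
Unshelve. all: by end_near. Qed.

Lemma chaos_dense xi : measurable_wrt (filtration P B T) xi -> (sqn xi < +oo)%E ->
  L2closure P span xi.
Proof.
move=> mxi sxi; apply: (cl_measS spanM span1 spanD spanZ) => //.
apply: measurable_wrt_sub mxi; apply: (filtration_steps_min B_bm).
- exact: SgS.
- exact: SgN.
- by move=> _ [st vst ->]; exact: chaos_step_intS.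
Qed.

Lemma chaos_process_wrt a : measurable_wrt (filtration P B T) (fun w => chaos_process I T w a).
Proof.
have sF := filtration_sigma_algebra P B T.
rewrite /chaos_process; elim: (finsupp a : seq nat) => [|i s IH].
  rewrite (_ : (fun w => _) = cst 1); first exact: measurable_wrt_cst.
  by apply/funext => w; rewrite big_nil.
rewrite (_ : (fun w => _) = fun w => (hermite_poly R (a i)).[I i T w] * \prod_(i <- s) hermite (a i) (I i T w)); last first.
  by apply/funext => w; rewrite big_cons hermiteE.
apply: measurable_wrtM => //.
apply: (@measurable_wrt_comp _ _ _ _ (horner (hermite_poly R (a i)))); first exact: measurable_poly.
exact: (L2limits_wrt_filtration B_bm TT (wiener_spaceI i)).
Qed.

Lemma chaos_proj_wrt p M xi :
  measurable_wrt (filtration P B T) (chaos_proj P I T p M xi).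
Proof.
have sF := filtration_sigma_algebra P B T.
rewrite (_ : chaos_proj _ _ _ _ _ _ = fun w => \sum_(a <- fset_set (mi_box p M))
  chaos_coef P I T xi a * chaos_process I T w a); last first.
  by apply/funext => w; rewrite chaos_projE chaos_sumE.
apply: measurable_wrt_sum => // a; apply: measurable_wrtM => //; first exact: measurable_wrt_cst.
exact: chaos_process_wrt.
Qed.

Lemma chaos_proj_moments p M xi : moments P (chaos_proj P I T p M xi).
Proof. exact: (chaos_sum_moments wiener_space_gaussian wiener_spaceI). Qed.

End chaos_density.

(** * Brownian increments against the past *)

Section polynomial_span.
Context d (W : measurableType d) (R : realType) (P : probability W R).
Context (Gs : set (W -> R)).

(** Multiplication is by one Gaussian variable at a time, matching [stein_pairX], so that
    derivatives are computed by induction on the construction. *)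
Inductive poly_span : (W -> R) -> Prop :=
| poly_span1 : poly_span (cst 1)
| poly_spanM X p : Gs X -> poly_span p -> poly_span (fun w => X w * p w)
| poly_spanD p q : poly_span p -> poly_span q -> poly_span (fun w => p w + q w)
| poly_spanZ c p : poly_span p -> poly_span (fun w => c * p w).

Lemma poly_span_mul p q : poly_span p -> poly_span q -> poly_span (fun w => p w * q w).
Proof.
move=> Pp Pq; elim: Pp => [|X {}p GX _ IH|p1 p2 _ IH1 _ IH2|c {}p _ IH].
- by move: Pq; congr poly_span; apply/funext => w; rewrite mul1r.
- by have := poly_spanM GX IH; congr poly_span; apply/funext => w; rewrite mulrA.
- by have := poly_spanD IH1 IH2; congr poly_span; apply/funext => w; rewrite mulrDl.
- by have := poly_spanZ c IH; congr poly_span; apply/funext => w; rewrite mulrA.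
Qed.

Lemma poly_span_moments p : (forall X, Gs X -> moments P X) -> poly_span p -> moments P p.
Proof.
move=> GM; elim=> [|X {}p GX _ IH|p1 p2 _ IH1 _ IH2|c {}p _ IH].
- exact: moments_cst.
- by apply: momentsM => //; exact: GM.
- exact: momentsD.
- exact: moments_scale.
Qed.

Local Notation "''E' X" := (Rintegral P setT X) (at level 10, X at level 9).

(** Every variable entering [p] is orthogonal to [X], so each application of the product rule
    contributes 0. *)
Lemma poly_span_stein_orthogonal (Hs : set (W -> R)) X p : gaussian_space P Hs -> Gs `<=` Hs ->
  Hs X -> (forall Y, Gs Y -> 'E (fun w => X w * Y w) = 0) ->
  poly_span p -> stein_pair P Hs X p (cst 0).
Proof.
move=> HsG GH HX XG; elim=> [|Y {}p GY _ IH|p1 p2 _ IH1 _ IH2|c {}p _ IH].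
- exact: stein_pair1.
- have := stein_pairX HsG HX (GH _ GY) IH; congr (stein_pair P Hs X _ _).
  by apply/funext => w; rewrite XG// mulr0 mul0r addr0.
- have := stein_pairD HsG HX IH1 IH2; congr (stein_pair P Hs X _ _).
  by apply/funext => w; rewrite addr0.
- have := stein_pairZ HsG c HX IH; congr (stein_pair P Hs X _ _).
  by apply/funext => w; rewrite mulr0.
Qed.

End polynomial_span.

Section increments.
Context d (W : measurableType d) (R : realType) (P : probability W R).
Context (P_complete : measure_is_complete P).
Context (m : nat) (B : R -> W -> 'rV[R]_m) (T : R) (B_bm : brownian_motion P B T).
Context (s t : R) (s_ge0 : 0 <= s) (st : s <= t) (tT : t <= T) (k : 'I_m).
Local Notation sqn := (L2sqn P).
Local Notation "''E' X" := (Rintegral P setT X) (at level 10, X at level 9).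
Local Notation dB := (fun w => (B t w - B s w) ord0 k).

Let TT : 0 <= T <= T. Proof. by rewrite lexx (le_trans s_ge0) ?(le_trans st). Qed.
Let sT : 0 <= s <= T. Proof. by rewrite s_ge0 (le_trans st). Qed.

Let inc : seq (R * R * 'rV[R]_m) := [:: ((s, t), delta_mx ord0 k)].

Let vinc : valid_steps T inc. Proof. by rewrite /valid_steps /= s_ge0 st tT. Qed.

Let incE : dB = step_int B inc.
Proof.
apply/funext => w; rewrite /step_int big_cons big_nil addr0 /dotp (bigD1 k)//= !mxE !eqxx mul1r big1 ?addr0//.
by move=> j jk; rewrite mxE eqxx (negbTE jk) mul0r.
Qed.

Let dotp_delta : dotp (delta_mx ord0 k) (delta_mx ord0 k : 'rV[R]_m) = 1.
Proof.
rewrite /dotp (bigD1 k)//= mxE !eqxx mulr1 big1 ?addr0//.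
by move=> j jk; rewrite mxE eqxx (negbTE jk) mul0r.
Qed.

Lemma increment_sqn : sqn dB = (t - s)%:E.
Proof.
rewrite incE (step_int_isometry B_bm TT vinc).
transitivity (\int[lebesgue_measure]_(u in `[0%R, T]) ((\1_(`]s, t]) : R -> R) u)%:E)%E.
  apply: eq_integral => u _; rewrite /step_fun big_cons big_nil addr0 enorm_sqr dotpZl dotpZr dotp_delta mulr1.
  by rewrite indicE; case: (u \in _); rewrite ?mulr1 ?mulr0.
by rewrite integral_indic//= lebesgue_measure_oc.
Qed.

Lemma step_integrals_widen : step_integrals B s `<=` step_integrals B T.
Proof.
move=> _ [u vu ->]; exists u => //; move: vu; apply: sub_all => q /and3P[-> -> qs] /=.
by rewrite (le_trans qs)//; case/andP: sT.
Qed.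

Lemma increment_orthogonal Y : step_integrals B s Y -> 'E (fun w => dB w * Y w) = 0.
Proof.
move=> [u vu ->]; have vuT : valid_steps T u.
  move: vu; apply: sub_all => q /and3P[-> -> qs] /=.
  by rewrite (le_trans qs)//; case/andP: sT.
transitivity ('E (fun w => step_int B inc w * step_int B u w)); first by rewrite -incE.
rewrite (wiener_dot B_bm TT (step_int_L2path B_bm _ vinc) (step_int_L2path B_bm _ vuT)
  (wiener_step B_bm TT vinc) (wiener_step B_bm TT vuT)); try by case/andP: TT.
rewrite /L2path_dot /Rintegral (eq_integral (cst 0%E)) ?integral0// => v _; congr EFin; rewrite /step_fun big_cons big_nil addr0 /=.
(* Up to time [s] the integrand of the increment vanishes; after [s] that of [Y] does. *)
have [us|us] := leP v s.
  by rewrite indicE memNset ?scale0r ?dotp0l//= in_itv/= ltNge us.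
rewrite big_seq big1 => [|q qu]; first by rewrite dotpC dotp0l.
move/allP: vu => /(_ _ qu)/and3P[_ _ qs]; rewrite indicE memNset ?scale0r//= in_itv/=.
by rewrite [X in _ && X]leNgt (le_lt_trans qs us) andbF.
Qed.

(** Integration by parts for X (X p^2), with X the increment: only the explicit factor X has a
    derivative, which leaves E[X^2] E[p^2]. *)
Lemma poly_span_increment p : poly_span (step_integrals B s) p ->
  sqn (fun w => p w * dB w) = ((t - s)%:E * sqn p)%E.
Proof.
move=> Pp; have HsG := step_integrals_gaussian B_bm TT.
have HX : step_integrals B T dB by exists inc.
have GM X : step_integrals B s X -> moments P X.
  by move=> /step_integrals_widen; exact: gaussian_moments.
have mX := gaussian_moments HsG HX.
have mp := poly_span_moments GM Pp.
have spp := poly_span_stein_orthogonal HsG step_integrals_widen HX increment_orthogonal (poly_span_mul Pp Pp).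
have := stein_pairE HsG HX (stein_pairX HsG HX HX spp).
have -> : 'E (fun w => dB w * dB w) = t - s.
  apply: EFin_inj; rewrite -increment_sqn sqnE//.
move=> E2; rewrite !sqnE//; last exact: momentsM.
rewrite -EFinM; congr EFin.
transitivity ('E (fun w => dB w * (dB w * (p w * p w)))).
  by apply: Rint_ext => w; ring.
rewrite E2 -RintZ; last exact: momentsX.
by apply: Rint_ext => w; rewrite mulr0 add0r expr2.
Qed.

Lemma filtration_poly_dense f : measurable_wrt (filtration P B s) f -> (sqn f < +oo)%E ->
  L2closure P (poly_span (step_integrals B s)) f.
Proof.
have HsG := step_integrals_gaussian B_bm sT.
have GM X : step_integrals B s X -> moments P X by exact: gaussian_moments.
pose Pol := poly_span (step_integrals B s).
have PolM p : Pol p -> moments P p by exact: poly_span_moments.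
have Pol1 : Pol (cst 1) by exact: poly_span1.
have PolD p q : Pol p -> Pol q -> Pol (fun w => p w + q w) by exact: poly_spanD.
have PolZ c p : Pol p -> Pol (fun w => c * p w) by exact: poly_spanZ.
move=> mf sf; apply: (cl_measS PolM Pol1 PolD PolZ) => //.
apply: measurable_wrt_sub mf; apply: (filtration_steps_min B_bm).
- exact: Sg_sigma_algebra.
- by move=> A; exact: Sg_negligible.
- move=> X GX; apply: (measS_generator PolM Pol1 PolD PolZ).
    exact: (gaussian_expmoments HsG).
  by move=> p Pp; exact: poly_spanM.
Qed.

(* The sharp constant is t - s, by independence; a rougher bound is enough
   and avoids weighting the approximation error. *)
Lemma increment_sqn_le f : measurable_wrt (filtration P B s) f ->
  (sqn (fun w => f w * dB w)%R <= (2 * (t - s))%:E * sqn f)%E.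
Proof.
move=> mwf; have mf := measurable_wrt_filtration B_bm P_complete sT mwf.
have ts0 : 0 <= t - s by rewrite subr_ge0.
have [E|/eqP ts] := eqVneq (t - s) 0.
  rewrite E mulr0 mul0e le_eqVlt; apply/orP; left; apply/eqP.
  rewrite (_ : sqn _ = sqn (cst 0)).
    by rewrite /L2sqn; under eq_integral do rewrite expr0n; rewrite integral0.
  have /eqP := E; rewrite subr_eq0 => /eqP ->; congr L2sqn.
  by apply/funext => w; rewrite subrr mxE mulr0.
have [->|sf] := eqVneq (sqn f) +oo%E.
  by rewrite gt0_muley ?leey// lte_fin mulr_gt0// lt_neqAle eq_sym ts0 andbT; exact/eqP.
have {}sf : (sqn f < +oo)%E by rewrite lt_neqAle sf leey.
have [_ fcl] := filtration_poly_dense mwf sf.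
have mdB : measurable_fun setT dB.
  rewrite incE; exact: (measurable_step_int B_bm TT vinc).
have GM X : step_integrals B s X -> moments P X.
  exact: (gaussian_moments (step_integrals_gaussian B_bm sT)).
apply/lee_addgt0Pr => e e0; move: (e : R) e0 => {}e e0.
pose K0 := (2 * (t - s))%:E.
(* The error of [p n] enters the final bound as [2 * (t - s) * del n], which is at most [e]; the
   division by [n.+1%:R] makes the errors tend to 0. *)
pose del (n : nat) := e / (2 * (t - s) + 1) / n.+1%:R.
have del0 n : 0 < del n by rewrite !divr_gt0//; lra.
have /choice[p pP] : forall n, exists p, poly_span (step_integrals B s) p /\ (sqn (fun w => f w - p w)%R < (del n)%:E)%E.
  by move=> n; have [p Pp fp] := fcl _ (del0 n); exists p.
have mp n : measurable_fun setT (p n).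
  exact: (moments_measurable (poly_span_moments GM (pP n).1)).
have cv : sqn (fun w => f w - p n w) @[n --> \oo] --> 0%E.
  apply: (@squeeze_cvge _ _ _ _ (cst 0%E) _ (fun n => (del n)%:E)).
  - by near=> n; rewrite sqn_ge0/= ltW// (pP n).2.
  - exact: cvg_cst.
  - apply: cvg_EFin; first exact: nearW.
    rewrite -[X in _ --> X](mulr0 (e / (2 * (t - s) + 1))).
    by apply: cvgM; [exact: cvg_cst|exact: cvg_inv_succ].
have [phi phiP] := L2_ae_subsequence mp mf cv.
(* The product of [f] and the increment is not known to be square-integrable beforehand, so the
   bound is carried over by Fatou's lemma. *)
rewrite /L2sqn; apply: (@fatou_ae_le _ _ _ P (fun n w => (p (phi n) w * dB w) ^+ 2)).
- by move=> n; apply: measurable_funX; exact: measurable_funM.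
- by apply: measurable_funX; exact: measurable_funM.
- by move=> n w; exact: sqr_ge0.
- by move=> w; exact: sqr_ge0.
- apply: filterS phiP => w pw; rewrite expr2.
  under eq_cvg do rewrite expr2.
  by apply: cvgM; (apply: cvgM; [exact: pw|exact: cvg_cst]).
move=> n; have := poly_span_increment (pP (phi n)).1; rewrite /L2sqn => ->.
have pe : (sqn (p (phi n)) <= 2%:E * sqn f + 2%:E * (del (phi n))%:E)%E.
  have := sqnB P mf (measurable_funB mf (mp (phi n))).
  rewrite (_ : (fun w => f w - (f w - p (phi n) w)) = p (phi n)); last first.
    by apply/funext => w; rewrite subKr.
  move/le_trans; apply; rewrite leeD2l// lee_wpmul2l// ltW//; exact: (pP _).2.
apply: (@le_trans _ _ ((t - s)%:E * (2%:E * sqn f + 2%:E * (del (phi n))%:E))%E).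
  by apply: lee_wpmul2l; rewrite ?lee_fin.
rewrite muleDr//; last by rewrite ge0_adde_def// inE ?mule_ge0 ?sqn_ge0 ?lee_fin// ltW.
rewrite muleA -EFinM (mulrC (t - s)); apply: leeD => //.
rewrite -!EFinM lee_fin /del.
have n1 : (phi n).+1%:R^-1 <= 1 :> R by rewrite invf_le1// ler1n.
rewrite [leLHS](_ : _ = e * ((2 * (t - s)) / (2 * (t - s) + 1) * (phi n).+1%:R^-1)); last by ring.
apply: ler_piMr; first exact: ltW.
apply: mulr_ile1 => //; first by apply: divr_ge0; lra.
by rewrite ler_pdivrMr; lra.
Unshelve. all: by end_near. Qed.

End increments.

(** * Conditional expectations *)

Section conditional_expectation.
Context d (W : measurableType d) (R : realType) (P : probability W R).
Context (G : set (set W)) (sG : sigma_algebra setT G) (GM : forall A, G A -> measurable A).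
Local Notation sqn := (L2sqn P).
Local Notation "''E' X" := (Rintegral P setT X) (at level 10, X at level 9).
Implicit Types X C phi : W -> R.

Lemma measurable_wrt_measurable X : measurable_wrt G X -> measurable_fun setT X.
Proof. by move=> mX _ D mD; rewrite setTI; apply: GM; exact: mX. Qed.

Lemma integrable_bounded_mul phi X (M : R) : measurable_fun setT phi -> (forall w, `|phi w| <= M) ->
  P.-integrable setT (EFin \o X) -> P.-integrable setT (EFin \o (fun w => phi w * X w)).
Proof.
move=> mphi phiM iX; have mX : measurable_fun setT X.
  by apply/measurable_EFinP; exact: measurable_int iX.
apply: (@integrable_leE _ _ _ _ _ (fun w => M * `|X w|)).
- exact: measurable_funM.
- by move=> w; rewrite normrM ler_wpM2r.
- by apply: integrable_funZ; exact: integrable_norm.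
Qed.

(* The density h1 below is non-negative, so that the monotone class argument
   for non-negative densities applies to the signed integrand C - X. *)
Lemma condexp_test X C (f : R -> R) (M : R) : is_condexp P G X C -> measurable_fun setT f ->
  (forall x, `|f x| <= M) ->
  'E (fun w => f (C w) * C w) = 'E (fun w => f (C w) * X w).
Proof.
move=> [iX iC mC CX] mf fM; have mC' := measurable_wrt_measurable mC.
have mX : measurable_fun setT X by apply/measurable_EFinP; exact: measurable_int iX.
pose u w := `|C w| + `|X w|; pose h1 w := u w + (C w - X w).
have iu : P.-integrable setT (EFin \o u).
  by apply: integrable_funD; exact: integrable_norm.
have iCX : P.-integrable setT (EFin \o (fun w => C w - X w)).
  exact: integrable_funB.
have u0 w : 0 <= u w by rewrite addr_ge0.
have h0 w : 0 <= h1 w.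
  rewrite /h1 /u; have := ler_norm (X w); have := ler_norm (- C w); rewrite normrN; lra.
have mu : measurable_fun setT u by apply/measurable_EFinP; exact: measurable_int iu.
have mh : measurable_fun setT h1.
  by apply: measurable_funD => //; exact: measurable_funB.
have indE D (v : W -> R) : (\int[P]_w (\1_D (C w) * v w)%:E = \int[P]_(w in C @^-1` D) (v w)%:E)%E.
  rewrite [RHS]integral_mkcond; apply: eq_integral => w _.
  rewrite patchE indicE; have -> : (w \in C @^-1` D) = (C w \in D) by [].
  by case: (C w \in D); rewrite ?mul1r ?mul0r.
have ge0_test (k : R -> R) N : measurable_fun setT k -> (forall x, 0 <= k x) -> (forall x, `|k x| <= N) ->
    'E (fun w => k (C w) * C w) = 'E (fun w => k (C w) * X w).
  move=> mk k0 kN.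
  have kint : (\int[P]_w (k (C w) * h1 w)%:E = \int[P]_w (k (C w) * u w)%:E)%E.
    apply: (ge0_integral_ext_indic (mu1 := P) (mu2 := P)) => // D mD.
    rewrite !indE; have GA : G (C @^-1` D) by exact: mC.
    have mA := GM GA.
    rewrite (eq_integral (fun w => (u w)%:E + ((C w)%:E - (X w)%:E))%E); last first.
      by move=> w _; rewrite /h1 EFinD EFinB.
    rewrite integralD//; last 2 first.
    - exact: (integrableS measurableT mA (@subsetT _ _) iu).
    - by have := integrableS measurableT mA (@subsetT _ _) iCX.
    rewrite integralB//; [|exact: (integrableS measurableT mA (@subsetT _ _) iC)|exact: (integrableS measurableT mA (@subsetT _ _) iX)].
    rewrite (CX _ GA) subee ?adde0//.
    by apply: integrable_fin_num => //; exact: (integrableS measurableT mA (@subsetT _ _) iX).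
  have kCM w : `|k (C w)| <= N by exact: kN.
  have mkC : measurable_fun setT (fun w => k (C w)) by exact: measurableT_comp.
  have ikC := integrable_bounded_mul mkC kCM iC.
  have ikX := integrable_bounded_mul mkC kCM iX.
  have iku := integrable_bounded_mul mkC kCM iu.
  have E1 : 'E (fun w => k (C w) * h1 w) = 'E (fun w => k (C w) * u w) by rewrite /Rintegral kint.
  have E2 : 'E (fun w => k (C w) * h1 w) =
      'E (fun w => k (C w) * u w) + ('E (fun w => k (C w) * C w) - 'E (fun w => k (C w) * X w)).
    rewrite -RintegralB// -RintegralD//; first by apply: Rint_ext => w; rewrite /h1; ring.
    exact: integrable_funB.
  by move: E2; rewrite E1; lra.
have M0 : 0 <= M by exact: le_trans (normr_ge0 _) (fM 0).
(* The signed [f] is the difference of [f + M] and [M], both non-negative and bounded. *)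
have T1 := @ge0_test (cst M) M (measurable_cst M) (fun=> M0) (fun=> eq_ind_r (fun x => x <= M) (lexx M) (ger0_norm M0)).
have T2 := @ge0_test (fun x => f x + M) (M + M).
have fMC w : `|f (C w)| <= M by exact: fM.
have mfC : measurable_fun setT (fun w => f (C w)) by exact: measurableT_comp.
have ifC := integrable_bounded_mul mfC fMC iC.
have ifX := integrable_bounded_mul mfC fMC iX.
have iMC := integrable_bounded_mul (measurable_cst M) (fun w => eq_ind_r (fun x => x <= M) (lexx M) (ger0_norm M0)) iC.
have iMX := integrable_bounded_mul (measurable_cst M) (fun w => eq_ind_r (fun x => x <= M) (lexx M) (ger0_norm M0)) iX.
have : 'E (fun w => f (C w) * C w) + 'E (fun w => cst M w * C w) =
    'E (fun w => f (C w) * X w) + 'E (fun w => cst M w * X w).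
  rewrite -!RintegralD//.
  have E3 Z : 'E (fun w => f (C w) * Z w + cst M w * Z w) = 'E (fun w => (f (C w) + M) * Z w).
    by apply: Rint_ext => w; rewrite mulrDl.
  rewrite !E3; apply: T2.
  - exact: measurable_funD.
  - by move=> x; have := fM x; rewrite ler_norml; lra.
  - by move=> x; rewrite (le_trans (ler_normD _ _))// lerD// ger0_norm.
by rewrite T1; lra.
Qed.

(** Vanishes beyond [N] instead of being clamped there, so that its product with [x] is its own
    square. *)
Definition truncation (N : nat) (x : R) : R := x * (\1_[set y : R | `|y| <= N%:R] : R -> R) x.

Lemma truncationE N x : truncation N x = if `|x| <= N%:R then x else 0.
Proof.
rewrite /truncation indicE; have -> : (x \in [set y : R | `|y| <= N%:R]) = (`|x| <= N%:R).
  by apply/idP/idP; rewrite inE.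
by case: (`|x| <= _); rewrite ?mulr1 ?mulr0.
Qed.

Lemma measurable_truncation N : measurable_fun setT (truncation N).
Proof.
apply: measurable_funM => //; apply: measurable_indic.
rewrite (_ : [set _ | _] = `[- N%:R, N%:R]%classic).
  exact: measurable_itv.
by apply/seteqP; split=> x; rewrite /= in_itv/= ler_norml.
Qed.

Lemma truncation_le N x : `|truncation N x| <= N%:R.
Proof. by rewrite truncationE; case: (leP `|x|) => //; rewrite normr0 ler0n. Qed.

(** Duality with the extremal test variable, a truncation phi of [C] itself: E[phi^2] = E[phi C] =
    E[phi X] <= K / 2 + E[phi^2] / 2, hence E[phi^2] <= K; Fatou's lemma removes the truncation. *)
Lemma condexp_sqn_le X C (K : R) : is_condexp P G X C ->
  (forall phi, measurable_wrt G phi -> (exists M : R, forall w, `|phi w| <= M) ->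
    'E (fun w => phi w * X w) <= 2^-1 * K + 2^-1 * 'E (fun w => phi w ^+ 2)) ->
  (sqn C <= K%:E)%E.
Proof.
move=> CX H; have [iX iC mC _] := CX; have mC' := measurable_wrt_measurable mC.
pose phi N w := truncation N (C w).
have mphi N : measurable_fun setT (phi N) by exact: (measurableT_comp (measurable_truncation N)).
have phiN N w : `|phi N w| <= N%:R by exact: truncation_le.
have momphi N : moments P (phi N).
  apply: moments_le (moments_cst P N%:R) => // w.
  by rewrite [X in _ <= X]ger0_norm ?ler0n.
rewrite /L2sqn; apply: (@fatou_ae_le _ _ _ P (fun n w => phi n w ^+ 2)).
- by move=> n; exact: measurable_funX.
- exact: measurable_funX.
- by move=> n w; exact: sqr_ge0.
- by move=> w; exact: sqr_ge0.
- apply: aeW => w; apply: cvg_near_cst; near=> n.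
  rewrite /phi truncationE ifT//; near: n; exact: nbhs_infty_ger.
move=> n; have -> : (\int[P]_w ((phi n w ^+ 2)%:E) = ('E (fun w => phi n w ^+ 2))%:E)%E by rewrite -sqnE.
rewrite lee_fin.
have := H (phi n); have := condexp_test CX (measurable_truncation n) (truncation_le n).
have -> : 'E (fun w => truncation n (C w) * C w) = 'E (fun w => phi n w ^+ 2).
  apply: Rint_ext => w; rewrite /phi truncationE; case: (_ <= _); first by rewrite expr2.
  by rewrite mul0r expr0n.
move=> <- /(_ _ _)/wrap[].
- exact: measurable_wrt_comp (measurable_truncation n) mC.
- by exists n%:R.
by lra.
Unshelve. all: by end_near. Qed.

Lemma condexp_contraction X C : measurable_fun setT X -> (sqn X < +oo)%E ->
  is_condexp P G X C -> (sqn C <= sqn X)%E.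
Proof.
move=> mX sX CX; have iX2 := integrable_sqr mX sX.
have -> : sqn X = ('E (fun w => X w ^+ 2))%:E.
  by rewrite /Rintegral fineK//; exact: integrable_fin_num iX2.
apply: (condexp_sqn_le CX) => phi mphi [M phiM].
have mphi' := measurable_wrt_measurable mphi.
have mm : moments P phi.
  by apply: moments_le (moments_cst P M) => // w; rewrite [X in _ <= X]ger0_norm// (le_trans _ (phiM w)).
apply: le_trans (expectation_mul_le (l := 2^-1) mphi' mX (moments_sqn mm) sX _) _ => //.
by rewrite (_ : (4 * 2^-1)^-1 = 2^-1 :> R) 1?addrC//; field.
Qed.

Lemma is_condexpB X X' C C' : is_condexp P G X C -> is_condexp P G X' C' ->
  is_condexp P G (fun w => X w - X' w) (fun w => C w - C' w).
Proof.
move=> [iX iC mC CX] [iX' iC' mC' CX'].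
split; [exact: integrable_funB|exact: integrable_funB|exact: measurable_wrtB|] => A GA.
have mA := GM GA.
have IB (U V : W -> R) : P.-integrable setT (EFin \o U) -> P.-integrable setT (EFin \o V) ->
    (\int[P]_(w in A) (U w - V w)%:E = \int[P]_(w in A) (U w)%:E - \int[P]_(w in A) (V w)%:E)%E.
  move=> iU iV; rewrite -integralB//.
  - exact: (integrableS measurableT mA (@subsetT _ _) iU).
  - exact: (integrableS measurableT mA (@subsetT _ _) iV).
by rewrite !IB// CX// CX'.
Qed.

End conditional_expectation.

(** * Stability of the backward scheme *)

Section scheme_step.
Context d (W : measurableType d) (R : realType) (P : probability W R).
Context (P_complete : measure_is_complete P).
Context (m : nat) (B : R -> W -> 'rV[R]_m) (T : R) (B_bm : brownian_motion P B T).
Local Notation sqn := (L2sqn P).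
Local Notation "''E' X" := (Rintegral P setT X) (at level 10, X at level 9).
Local Notation Ft := (filtration P B).

Lemma ae_eq_measurable (f g : W -> R) : {ae P, forall w, f w = g w} ->
  measurable_fun setT f -> measurable_fun setT g.
Proof.
move=> fg mf; apply/measurable_EFinP.
apply: (ae_measurable_fun P_complete (f := EFin \o f)); last exact/measurable_EFinP.
by apply: filterS fg => w fgw _ /=; rewrite fgw.
Qed.

(** Young's inequality for D and phi dB with weight t - s: the increment bound makes the second term
    (4 (t - s))^-1 2 (t - s) E[phi^2] = E[phi^2] / 2, the form that [condexp_sqn_le] requires. *)
Lemma condexp_increment s t (k : 'I_m) (D C : W -> R) : 0 <= s -> s < t -> t <= T ->
  measurable_fun setT D -> (sqn D < +oo)%E ->
  is_condexp P (Ft s) (fun w => D w * (B t w - B s w) ord0 k) C ->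
  (sqn C <= (2 * (t - s))%:E * sqn D)%E.
Proof.
move=> s0 st tT mD sD CX; have iD2 := integrable_sqr mD sD.
have sT : 0 <= s <= T by rewrite s0 (le_trans (ltW st)).
have t0 : 0 <= t <= T by rewrite tT (le_trans s0 (ltW st)).
have -> : sqn D = ('E (fun w => D w ^+ 2))%:E.
  by rewrite /Rintegral fineK//; exact: integrable_fin_num iD2.
rewrite -EFinM.
apply: (condexp_sqn_le _ CX) => [A|phi mphi [M phiM]].
  exact: (filtration_measurable B_bm P_complete sT).
have mphi' := measurable_wrt_filtration B_bm P_complete sT mphi.
have mm : moments P phi.
  by apply: moments_le (moments_cst P M) => // w; rewrite [X in _ <= X]ger0_norm// (le_trans _ (phiM w)).
pose dB w := (B t w - B s w) ord0 k.
have mdB : measurable_fun setT dB.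
  rewrite (_ : dB = fun w => B t w ord0 k - B s w ord0 k); last first.
    by apply/funext => w; rewrite /dB !mxE.
  by apply: measurable_funB; exact: (brownian_measurable B_bm).
have ts : 0 < t - s by rewrite subr_gt0.
have sphidB := increment_sqn_le P_complete B_bm s0 (ltW st) tT k mphi.
have mpB : measurable_fun setT (fun w => phi w * dB w) by exact: measurable_funM.
have spB : (sqn (fun w => phi w * dB w)%R < +oo)%E.
  by apply: le_lt_trans sphidB _; rewrite lte_mul_pinfty ?lee_fin ?mulr_ge0 ?ltW// moments_sqn.
have ipB := integrable_sqr mpB spB.
have E1 : 'E (fun w => (phi w * dB w) ^+ 2) <= 2 * (t - s) * 'E (fun w => phi w ^+ 2).
  move: sphidB; rewrite (sqnE mm) -EFinM.
  have -> : sqn (fun w => phi w * (B t w - B s w) ord0 k) = ('E (fun w => (phi w * dB w) ^+ 2))%:E.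
    by rewrite /Rintegral fineK//; exact: integrable_fin_num ipB.
  by rewrite lee_fin.
have -> : 'E (fun w => phi w * (D w * (B t w - B s w) ord0 k)) = 'E (fun w => D w * (phi w * dB w)).
  by apply: Rint_ext => w; rewrite mulrCA.
apply: le_trans (expectation_mul_le mD mpB sD spB ts) _.
rewrite (_ : 2^-1 * (2 * (t - s) * _) = (t - s) * 'E (fun w => D w ^+ 2)); last by field.
by rewrite lerD2l ler_pdivrMl ?mulr_gt0// (le_trans E1)// le_eqVlt; apply/orP; left; apply/eqP; field.
Qed.

Context (g : R -> R -> 'rV[R]_m -> R) (L : R) (L_gt0 : 0 < L).
Context (n : nat) (t : nat -> R) (t_part : is_partition T n t) (t_mesh : mesh n t < L^-1).
Context (g_lip : forall i, (i < n)%N -> lipschitz_at g L (t i)).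

Lemma partition_mono i j : (i <= j)%N -> (j <= n)%N -> t i <= t j.
Proof.
have [_ _ tS] := t_part; move=> /subnK <-; elim: (j - i)%N => //= k IH kn.
by rewrite (le_trans (IH (ltnW kn)))// addSn ltW// tS.
Qed.

Lemma partition_bounds i : (i <= n)%N -> 0 <= t i <= T.
Proof.
by have [t0 tn _] := t_part; move=> ni; rewrite -t0 -tn !partition_mono.
Qed.

Lemma partition_step i : (i < n)%N -> 0 < t i.+1 - t i /\ (t i.+1 - t i) * L < 1.
Proof.
move=> ni; have [_ _ /(_ _ ni) tS] := t_part; rewrite subr_gt0; split => //.
rewrite -ltr_pdivlMr// div1r; apply: le_lt_trans t_mesh.
by rewrite /mesh (bigmax_sup (Ordinal ni)).
Qed.

Lemma scheme_measurable (xi : W -> R) Y Z i : measurable_wrt (Ft T) xi ->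
  backward_scheme P B g n t xi Y Z -> (i <= n)%N -> measurable_fun setT (Y i).
Proof.
have TT : 0 <= T <= T by rewrite lexx andbT; case/andP: (partition_bounds (leqnn n)); exact: le_trans.
move=> mxi [Yn _ YZ]; rewrite leq_eqVlt => /predU1P[->|ni].
  apply: (@ae_eq_measurable xi); last exact: (measurable_wrt_filtration B_bm P_complete TT).
  by apply: filterS Yn => w ->.
have [mY _ _] := YZ _ ni; apply: (measurable_wrt_filtration B_bm P_complete _ mY).
exact: partition_bounds (ltnW ni).
Qed.

(** [condexp_increment] gives 2 (t_{i+1} - t_i) per coordinate; the factor (t_{i+1} - t_i)^-1 of the
    scheme enters squared, and there are [m] coordinates. *)
Definition Zcst i := 2 * m%:R / (t i.+1 - t i).
(** From |dY| <= (1 - a)^-1 (|dC| + a |dZ|), where a is the time step times [L] and dC the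
    difference of the conditional expectations: 2 for the square of a sum, 1 for the contraction,
    [Zcst i] for dZ. *)
Definition Ycst i := 2 * (1 - (t i.+1 - t i) * L)^-1 ^+ 2 * (1 + ((t i.+1 - t i) * L) ^+ 2 * Zcst i).

Lemma Zcst_ge0 i : (i < n)%N -> 0 <= Zcst i.
Proof. by move=> /partition_step[d0 _]; rewrite divr_ge0 ?mulr_ge0 ?ler0n// ltW. Qed.

Lemma Ycst_ge0 i : (i < n)%N -> 0 <= Ycst i.
Proof.
move=> ni; apply: mulr_ge0; first by rewrite mulr_ge0// sqr_ge0.
by rewrite addr_ge0// mulr_ge0 ?sqr_ge0// Zcst_ge0.
Qed.

Lemma scheme_step_le (xi xi' : W -> R) Y Z Y' Z' i : (i < n)%N ->
  backward_scheme P B g n t xi Y Z -> backward_scheme P B g n t xi' Y' Z' ->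
  measurable_fun setT (fun w => Y i.+1 w - Y' i.+1 w) ->
  (sqn (fun w => Y i.+1 w - Y' i.+1 w)%R < +oo)%E ->
  [/\ measurable_fun setT (fun w => enorm (Z i w - Z' i w)),
    (sqn (fun w => enorm (Z i w - Z' i w)) <= (Zcst i)%:E * sqn (fun w => Y i.+1 w - Y' i.+1 w)%R)%E &
    (sqn (fun w => Y i w - Y' i w)%R <= (Ycst i)%:E * sqn (fun w => Y i.+1 w - Y' i.+1 w)%R)%E].
Proof.
move=> ni [_ _ /(_ _ ni)[mY ZC [C CY EY]]] [_ _ /(_ _ ni)[mY' ZC' [C' CY' EY']]] mD sD.
have [d0 dL] := partition_step ni; set del := t i.+1 - t i in d0 dL EY EY' ZC ZC' *.
have tb := partition_bounds (ltnW ni); have /andP[ti0 _] := tb.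
have /andP[_ tT] := partition_bounds ni.
have tlt : t i < t i.+1 by rewrite -subr_gt0.
pose D w := Y i.+1 w - Y' i.+1 w; rewrite -/D in mD sD *.
have sF := filtration_sigma_algebra P B (t i).
have FM A : Ft (t i) A -> measurable A by exact: (filtration_measurable B_bm P_complete tb).
have Zk k : measurable_fun setT (fun w => Z i w ord0 k - Z' i w ord0 k) /\
    (sqn (fun w => Z i w ord0 k - Z' i w ord0 k)%R <= (2 / del)%:E * sqn D)%E.
  have [Ck CCk ZE] := ZC k; have [Ck' CCk' ZE'] := ZC' k.
  have CB := is_condexpB sF FM CCk CCk'; have [_ _ mCB _] := CB.
  have mC := measurable_wrt_filtration B_bm P_complete tb mCB.
  have ZD : {ae P, forall w, del^-1 * (Ck w - Ck' w) = Z i w ord0 k - Z' i w ord0 k}.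
    by move: ZE ZE'; apply: filterS2 => w -> ->; rewrite mulrBr.
  have mdC : measurable_fun setT (fun w => del^-1 * (Ck w - Ck' w)) by exact: measurable_funM.
  have mZ := ae_eq_measurable ZD mdC; split => //.
  rewrite -(ae_eq_sqn mdC mZ ZD) sqnZ//.
  apply: (@le_trans _ _ ((del^-1 ^+ 2)%:E * ((2 * del)%:E * sqn D))%E).
    rewrite lee_wpmul2l ?lee_fin ?sqr_ge0//.
    apply: (condexp_increment (k := k) ti0 tlt tT mD sD).
    move: CB; congr is_condexp; apply/funext => w; rewrite /D mulrBl//.
  rewrite muleA -EFinM (_ : del^-1 ^+ 2 * (2 * del) = 2 / del)//.
  by field; rewrite gt_eqF.
pose z w := enorm (Z i w - Z' i w).
have z2 w : z w ^+ 2 = \sum_(k < m) (Z i w ord0 k - Z' i w ord0 k) ^+ 2.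
  by rewrite /z enorm_sqr; apply: eq_bigr => k _; rewrite !mxE expr2.
have mz : measurable_fun setT z.
  rewrite (_ : z = fun w => Num.sqrt (\sum_(k < m) (Z i w ord0 k - Z' i w ord0 k) ^+ 2)).
    have msqrt : measurable_fun [set: R] (@Num.sqrt R).
      by apply: continuous_measurable_fun; exact: sqrt_continuous.
    apply: (measurableT_comp msqrt); apply: measurable_sum => k.
    by apply: measurable_funX; exact: (Zk k).1.
  by apply/funext => w; rewrite -z2 sqrtr_sqr ger0_norm// sqrtr_ge0.
have sz : (sqn z <= (Zcst i)%:E * sqn D)%E.
  rewrite /L2sqn (eq_integral (fun w => \sum_(k < m) ((Z i w ord0 k - Z' i w ord0 k) ^+ 2)%:E)%E); last first.
    by move=> w _; rewrite z2 sumEFin.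
  rewrite ge0_integral_sum//; last 2 first.
  - by move=> k; apply: measurable_sqrE; exact: (Zk k).1.
  - by move=> k w _; rewrite lee_fin sqr_ge0.
  apply: (@le_trans _ _ (\sum_(k < m) ((2 / del)%:E * sqn D))%E).
    by apply: lee_sum => k _; exact: (Zk k).2.
  have sDfin : sqn D \is a fin_num by rewrite ge0_fin_numE ?sqn_ge0.
  rewrite -[X in (_ <= _ * X)%E]/(sqn D) -(fineK sDfin) -!EFinM sumEFin sumr_const card_ord lee_fin /Zcst -/del.
  by rewrite -mulr_natl le_eqVlt; apply/orP; left; apply/eqP; field; rewrite gt_eqF.
split => //.
have CB := is_condexpB sF FM CY CY'; have [_ _ mCB _] := CB.
have mC := measurable_wrt_filtration B_bm P_complete tb mCB.
have sC := condexp_contraction FM mD sD CB.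
(* The implicit generator contributes [del * L] times the left-hand side itself; [del * L < 1] lets
   it be absorbed at the price [r]. *)
pose r := (1 - del * L)^-1; have r0 : 0 < r by rewrite invr_gt0 subr_gt0.
have mYY : measurable_fun setT (fun w => Y i w - Y' i w).
  by apply: measurable_funB; exact: (measurable_wrt_filtration B_bm P_complete tb).
pose U w := r * (C w - C' w); pose V w := r * (del * L) * z w.
have mabs : measurable_fun setT (fun w => `|U w| + V w).
  apply: measurable_funD; last exact: measurable_funM.
  by apply: measurableT_comp => //; exact: measurable_funM.
have mU : measurable_fun setT (fun w => `|U w|).
  by apply: measurableT_comp => //; exact: measurable_funM.
have mV : measurable_fun setT V by exact: measurable_funM.
apply: (@le_trans _ _ (sqn (fun w => `|U w| + V w))).
  apply: ae_sqn_le => //; move: EY EY'; apply: filterS2 => w EYw EYw'.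
  have z0 : 0 <= z w by exact: sqrtr_ge0.
  have V0 : 0 <= V w by rewrite /V !mulr_ge0// ltW.
  rewrite [X in _ <= X]ger0_norm ?addr_ge0//.
  rewrite /U /V normrM (gtr0_norm r0) -mulrA -mulrDr /r ler_pdivlMl ?subr_gt0//.
  have := g_lip ni (Y i w) (Y' i w) (Z i w) (Z' i w); rewrite -/(z w).
  set a := `|Y i w - Y' i w|; set G := g _ _ _; set G' := g _ _ _ => GG.
  have : a <= `|C w - C' w| + del * `|G - G'|.
    have -> : del * `|G - G'| = `|del * (G - G')| by rewrite normrM (gtr0_norm d0).
    have YYE : Y i w - Y' i w = (C w - C' w) + del * (G - G').
      by rewrite {1}EYw {1}EYw' -/G -/G'; ring.
    by rewrite /a YYE ler_normD.
  have : del * `|G - G'| <= del * (L * (a + z w)) by rewrite ler_pM2l.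
  by lra.
apply: le_trans (sqnD P mU mV) _.
have -> : sqn (fun w => `|U w|) = ((r ^+ 2)%:E * sqn (fun w => C w - C' w)%R)%E.
  rewrite -sqnZ//; apply: eq_integral => w _; rewrite real_normK ?num_real//.
rewrite sqnZ//.
rewrite /Ycst -/del -/r.
apply: (@le_trans _ _ (2%:E * ((r ^+ 2)%:E * sqn D) + 2%:E * ((r * (del * L)) ^+ 2)%:E * ((Zcst i)%:E * sqn D))%E).
  apply: leeD; first by rewrite lee_wpmul2l// lee_wpmul2l// lee_fin sqr_ge0.
  by rewrite -muleA lee_wpmul2l// lee_wpmul2l// lee_fin sqr_ge0.
have sDfin : sqn D \is a fin_num by rewrite ge0_fin_numE ?sqn_ge0.
rewrite -(fineK sDfin) -!EFinM -EFinD lee_fin le_eqVlt; apply/orP; left; apply/eqP.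
ring.
Qed.

(** One constant for all steps and both components; being at least 1, its [n]-th power dominates the
    lower powers. *)
Definition stability_cst := 1 + \sum_(i < n) (Ycst i + Zcst i).

Lemma stability_cst_ge i : (i < n)%N -> Ycst i <= stability_cst /\ Zcst i <= stability_cst.
Proof.
move=> ni; rewrite /stability_cst (bigD1 (Ordinal ni))//=.
have : 0 <= \sum_(j < n | j != Ordinal ni) (Ycst j + Zcst j).
  by apply: sumr_ge0 => j _; rewrite addr_ge0 ?Ycst_ge0 ?Zcst_ge0.
by have := Ycst_ge0 ni; have := Zcst_ge0 ni; lra.
Qed.

Lemma stability_cst_ge1 : 1 <= stability_cst.
Proof. by rewrite lerDl sumr_ge0// => j _; rewrite addr_ge0 ?Ycst_ge0 ?Zcst_ge0. Qed.

Lemma scheme_stability (xi xi' : W -> R) Y Z Y' Z' :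
  measurable_wrt (Ft T) xi -> measurable_wrt (Ft T) xi' ->
  (sqn (fun w => xi w - xi' w)%R < +oo)%E ->
  backward_scheme P B g n t xi Y Z -> backward_scheme P B g n t xi' Y' Z' ->
  (forall i, (i <= n)%N ->
    (sqn (fun w => Y i w - Y' i w)%R <= (stability_cst ^+ n)%:E * sqn (fun w => xi w - xi' w)%R)%E) /\
  (forall i, (i < n)%N -> measurable_fun setT (fun w => enorm (Z i w - Z' i w)) /\
    (sqn (fun w => enorm (Z i w - Z' i w)) <= (stability_cst ^+ n)%:E * sqn (fun w => xi w - xi' w)%R)%E).
Proof.
move=> mxi mxi' sxi S S'; set c := stability_cst; set s := sqn (fun w => xi w - xi' w).
have c1 : 1 <= c := stability_cst_ge1.
have s0 : (0 <= s)%E by exact: sqn_ge0.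
have mD i : (i <= n)%N -> measurable_fun setT (fun w => Y i w - Y' i w).
  by move=> ni; apply: measurable_funB; [exact: scheme_measurable mxi S ni|exact: scheme_measurable mxi' S' ni].
have cs k l : (k <= l)%N -> ((c ^+ k)%:E * s <= (c ^+ l)%:E * s)%E.
  by move=> kl; rewrite lee_wpmul2r// lee_fin ler_weXn2l.
have cfin k : ((c ^+ k)%:E * s < +oo)%E.
  by rewrite lte_mul_pinfty// lee_fin exprn_ge0// (le_trans ler01).
(* [j] counts the steps back from the terminal date. *)
have H j : (j <= n)%N -> (sqn (fun w => Y (n - j)%N w - Y' (n - j)%N w)%R <= (c ^+ j)%:E * s)%E.
  elim: j => [|j IH] jn.
    rewrite subn0 expr0 mul1e le_eqVlt; apply/orP; left; apply/eqP.
    have [[Yn _ _] [Yn' _ _]] := (S, S'); have mDn := mD _ (leqnn n).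
    have ae : {ae P, forall w, Y n w - Y' n w = xi w - xi' w}.
      by move: Yn Yn'; apply: filterS2 => w -> ->.
    by rewrite /s; apply: ae_eq_sqn => //; exact: ae_eq_measurable ae mDn.
  have ni : (n - j.+1 < n)%N by rewrite ltn_subrL/=; exact: leq_trans jn.
  have E : (n - j.+1).+1 = (n - j)%N by rewrite subnSK.
  have mDj := mD _ ni; have IHj := IH (ltnW jn); rewrite -E in IHj.
  have [_ _ DD] := scheme_step_le ni S S' mDj (le_lt_trans IHj (cfin _)).
  apply: le_trans DD _; apply: (@le_trans _ _ (c%:E * ((c ^+ j)%:E * s))%E).
    apply: lee_pmul => //; [by rewrite lee_fin Ycst_ge0|exact: sqn_ge0|].
    by rewrite lee_fin; have [] := stability_cst_ge ni.
  by rewrite muleA -EFinM -exprS.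
split=> i ni.
  have := H (n - i)%N (leq_subr _ _); rewrite subKn// => /le_trans; apply.
  by apply: cs; exact: leq_subr.
have IHj := H (n - i.+1)%N (leq_subr _ _); rewrite subKn// in IHj.
have [mz ZZ _] := scheme_step_le ni S S' (mD _ ni) (le_lt_trans IHj (cfin _)).
split=> //; apply: le_trans ZZ _; apply: (@le_trans _ _ (c%:E * ((c ^+ (n - i.+1))%:E * s))%E).
  apply: lee_pmul => //; [by rewrite lee_fin Zcst_ge0|exact: sqn_ge0|].
  by rewrite lee_fin; have [] := stability_cst_ge ni.
rewrite muleA -EFinM -exprS; apply: cs; rewrite subnSK//; exact: leq_subr.
Qed.

End scheme_step.

(** * Uniform approximation on compact sets *)

Section L2space_facts.
Context d (W : measurableType d) (R : realType) (P : probability W R).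
Local Notation sqn := (L2sqn P).

Lemma Lnorm2_sqn (f : W -> R) : ('N[P]_(2%:R%:E)[EFin \o f] `^ 2%:R)%E = sqn f.
Proof.
rewrite poweR_Lnorm//; apply: eq_integral => w _ /=.
by rewrite powR_mulrn// real_normK// num_real.
Qed.

Lemma L2space_measurable (f : L2space P) : measurable_fun setT (L2fun f).
Proof. by have := LfunP (f : LfunType P _); rewrite inE => /andP[]; rewrite inE. Qed.

Lemma L2space_sqn (f : L2space P) : sqn f = (L2norm f ^+ 2)%:E.
Proof.
have Nf : ('N[P]_(2%:R%:E)[EFin \o L2fun f] < +oo)%E.
  by have := LfunP (f : LfunType P _); rewrite inE => /andP[_]; rewrite inE.
have N0 := Lnorm_ge0 P 2%:R%:E (EFin \o L2fun f).
have Nfin : ('N[P]_(2%:R%:E)[EFin \o L2fun f])%E \is a fin_num by rewrite ge0_fin_numE.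
rewrite -Lnorm2_sqn -(fineK Nfin) poweR_EFin powR_mulrn//.
by rewrite fine_ge0.
Qed.

(** Excludes the default value 0 of [toL2]. *)
Lemma toL2K (f : W -> R) : measurable_fun setT f -> (sqn f < +oo)%E -> L2fun (toL2 P f) = f.
Proof.
move=> mf sf; apply: insubdK; rewrite inE; apply/andP; split; rewrite inE//=.
rewrite /finite_norm ltey; apply/eqP => Ny; move: sf.
by rewrite -Lnorm2_sqn Ny poweRyr.
Qed.

Lemma L2ball_sqn (f g : L2space P) (e : R) : 0 <= e ->
  ball f (Num.sqrt e) g -> (sqn (fun w => f w - g w)%R < e%:E)%E.
Proof.
move=> e0 fg; have -> : sqn (fun w => f w - g w) = sqn (L2fun (f - g)%R) by [].
rewrite L2space_sqn lte_fin.
have N0 : 0 <= L2norm (f - g) by rewrite fine_ge0// Lnorm_ge0.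
by rewrite -(sqr_sqrtr e0) ltr_pXn2r// ?nnegrE ?sqrtr_ge0.
Qed.

End L2space_facts.

Section uniform_chaos.
Context d (W : measurableType d) (R : realType) (P : probability W R).
Context (P_complete : measure_is_complete P).
Context (m : nat) (B : R -> W -> 'rV[R]_m) (T : R) (B_bm : brownian_motion P B T).
Context (T_ge0 : 0 <= T).
Context (h : nat -> R -> 'rV[R]_m) (h_basis : orthonormal_basis T h).
Context (I : nat -> R -> W -> R).
Context (I_int : forall i, is_wiener_integral P B (h i) T (I i T)).
Context (K : set (L2space P)) (K_sub : K `<=` L2sub (filtration P B T)) (K_compact : compact K).
Local Notation sqn := (L2sqn P).

(* The projection is at least as close to xi as any chaos sum of the same
   order, in particular as the one approximating the centre of a ball
   containing xi. *)
Lemma chaos_proj_uniform (e : R) : 0 < e -> exists p0 M0 : nat, forall p M, (p0 <= p)%N -> (M0 <= M)%N ->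
  forall xi, K xi -> (sqn (fun w => xi w - chaos_proj P I T p M xi w)%R <= (4 * e)%:E)%E.
Proof.
move=> e0.
have WG := wiener_space_gaussian B_bm T_ge0.
have WI := wiener_spaceI I_int.
have orth := wiener_orthonormal B_bm T_ge0 h_basis I_int.
have /choice[q qP] : forall f : L2space P, exists q : nat * nat, K f ->
    exists c, (sqn (fun w => f w - chaos_sum I T q.1 q.2 c w)%R < e%:E)%E.
  move=> f; have [Kf|nKf] := pselect (K f); last by exists (0%N, 0%N).
  have sf : (sqn f < +oo)%E by rewrite L2space_sqn ltry.
  have [_ /(_ _ e0)[_ [p [M [c ->]]] fc]] := chaos_dense P_complete B_bm T_ge0 h_basis I_int (K_sub Kf) sf.
  by exists (p, M) => _; exists c.
(* Interiors of balls are open by construction and contain the centres. The radius is a square root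
   because the ball is for the norm while [e] bounds its square. *)
have := K_compact; rewrite compact_cover => /(_ _ K (fun f => (ball f (Num.sqrt e))^°)).
have sq0 : 0 < Num.sqrt e by rewrite sqrtr_gt0.
case=> [f _|f Kf|D DK KD]; first exact: open_interior.
  by exists f => //; apply: nbhs_singleton; apply: nbhs_interior; exact: nbhsx_ballx.
exists (\max_(f <- D) (q f).1), (\max_(f <- D) (q f).2) => p M pp MM xi Kxi.
have [f fD fxi] := KD _ Kxi.
have Kf : K f by have := DK _ fD; rewrite inE.
have [c fc] := qP _ Kf.
have p1 : ((q f).1 <= p)%N by apply: leq_trans pp; exact: (@leq_bigmax_seq _ _ xpredT (fun f => (q f).1)).
have M1 : ((q f).2 <= M)%N by apply: leq_trans MM; exact: (@leq_bigmax_seq _ _ xpredT (fun f => (q f).2)).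
have [c' cE] := @chaos_sum_widen _ W R I T _ _ _ _ c p1 M1.
rewrite cE in fc.
have mxi := L2space_measurable xi; have mf := L2space_measurable f.
have sxi : (sqn xi < +oo)%E by rewrite L2space_sqn ltry.
apply: le_trans (chaos_proj_best WG WI orth p M c' mxi sxi) _.
have mc := moments_measurable (chaos_sum_moments WG WI p M c').
rewrite (_ : (fun w => _) = (fun w => (xi w - f w) + (f w - chaos_sum I T p M c' w))); last first.
  by apply/funext => w; rewrite addrA subrK.
apply: le_trans (sqnD P (measurable_funB mxi mf) (measurable_funB mf mc)) _.
have fxi' : (sqn (fun w => xi w - f w)%R < e%:E)%E.
  by rewrite sqnBC; apply: L2ball_sqn; [exact: ltW|exact: interior_subset fxi].
apply: (@le_trans _ _ (2%:E * e%:E + 2%:E * e%:E)%E).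
  by apply: leeD; rewrite lee_wpmul2l// ltW.
by rewrite -!EFinM -EFinD lee_fin; lra.
Qed.

End uniform_chaos.

Section stability_in_expectation.
Context d (W : measurableType d) (R : realType) (P : probability W R).
Context (P_complete : measure_is_complete P).
Local Notation sqn := (L2sqn P).

(** Carries an estimate from the scheme to its representation, which equals it only a.e.;
    completeness makes [f] measurable too. *)
Lemma expectation_sqr_ae (f g : W -> R) : measurable_fun setT g ->
  {ae P, forall w, g w = f w} -> ('E_P[fun w => (`|f w| ^+ 2)%R])%E = sqn g.
Proof.
move=> mg gf; have mf := ae_eq_measurable P_complete gf mg.
rewrite (ae_eq_sqn mg mf gf) unlock; apply: eq_integral => w _.
by rewrite real_normK// num_real.
Qed.

Lemma integral_cst_itv (a b : R) (f g : W -> R) : a <= b -> measurable_fun setT g ->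
  {ae P, forall w, g w = f w} ->
  (\int[P]_w \int[lebesgue_measure]_(s in `[a, b]) (f w ^+ 2)%:E = (b - a)%:E * sqn g)%E.
Proof.
move=> ab mg gf; have mf := ae_eq_measurable P_complete gf mg.
rewrite (ae_eq_sqn mg mf gf).
have leb : lebesgue_measure `[a, b] = (b - a)%:E.
  rewrite lebesgue_measure_itv/= lte_fin; have [//|ba] := ltP a b.
  by rewrite (_ : b = a) ?subrr//; apply/eqP; rewrite eq_le ba.
rewrite (eq_integral (fun w => (b - a)%:E * (f w ^+ 2)%:E)%E).
  rewrite ge0_integralZl//; [exact: measurable_sqrE| |].
    by move=> w _; rewrite lee_fin sqr_ge0.
  by rewrite lee_fin subr_ge0.
move=> w _; transitivity ((f w ^+ 2)%:E * lebesgue_measure `[a, b]%classic)%E.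
  exact: integral_cst.
by rewrite leb muleC.
Qed.

End stability_in_expectation.

Theorem corollary4p9
  (R : realType) (d : measure_display) (W : measurableType d)
  (P : probability W R) (P_complete : measure_is_complete P)
  (T : R) (T_gt0 : 0 < T)
  (m : nat) (B : R -> W -> 'rV[R]_m) (B_bm : brownian_motion P B T)
  (* chaos *)
  (h : nat -> R -> 'rV[R]_m) (h_basis : orthonormal_basis T h)
  (I : nat -> R -> W -> R)
  (I_int : forall (i : nat) (s : R), 0 <= s <= T -> is_wiener_integral P B (h i) s (I i s))
  (* generator *)
  (g : R -> R -> 'rV[R]_m -> R)
  (g_meas : measurable_fun (`[0, T] `*` setT)
     (fun u : R * (R * borel 'rV[R]_m) => g u.1 u.2.1 u.2.2))
  (g_sqint : (\int[lebesgue_measure]_(s in `[0%R, T])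
                (`|g s 0 0| ^+ 2)%:E < +oo)%E)
  (L : R) (L_gt0 : 0 < L)
  (g_lip : {ae lebesgue_measure, forall s : R, 0 <= s <= T -> lipschitz_at g L s})
  (* partition *)
  (n : nat) (t : nat -> R) (t_part : is_partition T n t)
  (t_mesh : mesh n t < L^-1)
  (* the grid avoids the exceptional null set of g_lip *)
  (g_lip_grid : forall i, (i < n)%N -> lipschitz_at g L (t i))
  (* the scheme, and its representation as a function of the chaos process *)
  (Y : nat -> L2space P -> W -> R) (Z : nat -> L2space P -> W -> 'rV[R]_m)
  (YZ_scheme : forall xi, L2sub (filtration P B T) xi ->
     backward_scheme P B g n t xi
       (fun i => Y i xi) (fun i => Z i xi))
  (scrY : nat -> RA R -> borel (L2space P) -> R)
  (scrZ : nat -> RA R -> borel (L2space P) -> borel 'rV[R]_m)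
  (scrY_meas : forall i, (i <= n)%N ->
     measurable_fun ([set: RA R] `*`
        (L2sub (filtration P B T) : set (borel (L2space P))))
       (fun u : RA R * borel (L2space P) => scrY i u.1 u.2))
  (scrZ_meas : forall i, (i <= n)%N ->
     measurable_fun ([set: RA R] `*`
        (L2sub (filtration P B T) : set (borel (L2space P))))
       (fun u : RA R * borel (L2space P) => scrZ i u.1 u.2))
  (scrYE : forall i xi, (i <= n)%N -> L2sub (filtration P B T) xi ->
     {ae P, forall w, Y i xi w = scrY i (chaos_process I (t i) w) xi})
  (scrZE : forall i xi, (i <= n)%N -> L2sub (filtration P B T) xi ->
     {ae P, forall w, Z i xi w = scrZ i (chaos_process I (t i) w) xi})
  (K : set (L2space P)) (K_sub : K `<=` L2sub (filtration P B T))
  (K_compact : compact K) :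
  forall eps : R, 0 < eps ->
  exists peps Meps : nat, forall p M : nat, (peps <= p)%N -> (Meps <= M)%N ->
  forall xi, K xi ->
  (\big[maxe/0]_(i < n.+1)
     'E_P[fun w =>
       (`|scrY i (chaos_process I (t i) w) xi
          - chaos_approx I T p M (scrY i) (chaos_process I (t i) w) xi| ^+ 2)%R]
   + \sum_(i < n)
     \int[P]_w \int[lebesgue_measure]_(s in `[t i, t i.+1])
       (enorm (scrZ i (chaos_process I (t i) w) xi
            - chaos_approx I T p M (scrZ i) (chaos_process I (t i) w) xi
          : 'rV[R]_m) ^+ 2)%:E
   <= eps%:E)%E.
Proof.
move=> eps eps0; have [t0 tn _] := t_part.
have T0 := ltW T_gt0; have TT : 0 <= T <= T by rewrite T0 lexx.
have II i : is_wiener_integral P B (h i) T (I i T) by exact: I_int.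
pose c := stability_cst m L n t ^+ n.
have c1 : 1 <= c by apply: exprn_ege1; exact: (stability_cst_ge1 _ L_gt0 t_part t_mesh).
(* Every squared error is at most [c * (4 * e)]; the maximum takes this once, and the time steps,
   which add up to [T], take it [T] times. *)
pose e := eps / (4 * c * (1 + T)).
have e0 : 0 < e by rewrite divr_gt0// !mulr_gt0//; lra.
have [p0 [M0 pM]] := chaos_proj_uniform P_complete B_bm T0 h_basis II K_sub K_compact e0.
exists p0, M0 => p M pp MM xi Kxi.
have sprox := pM _ _ pp MM _ Kxi.
have mxi : L2sub (filtration P B T) xi by exact: K_sub.
pose xi' := toL2 P (chaos_proj P I T p M xi).
have mproj := chaos_proj_moments B_bm T0 II p M xi.
have xiE' : L2fun xi' = chaos_proj P I T p M xi.
  by apply: toL2K; [exact: moments_measurable mproj|exact: moments_sqn].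
have mxi' : L2sub (filtration P B T) xi'.
  by rewrite /L2sub /= xiE'; exact: (chaos_proj_wrt B_bm T0 II).
have {}sprox : (L2sqn P (fun w => xi w - xi' w)%R <= (4 * e)%:E)%E by rewrite xiE'.
have [HY HZ] := scheme_stability P_complete B_bm L_gt0 t_part t_mesh g_lip_grid mxi mxi'
  (le_lt_trans sprox (ltry _)) (YZ_scheme _ mxi) (YZ_scheme _ mxi').
have bound x : (x <= c%:E * L2sqn P (fun w => xi w - xi' w)%R)%E -> (x <= (c * (4 * e))%:E)%E.
  by move=> /le_trans; apply; rewrite EFinM lee_wpmul2l// lee_fin; lra.
have mY zeta i : L2sub (filtration P B T) zeta -> (i <= n)%N -> measurable_fun setT (Y i zeta).
  by move=> mz; exact: (scheme_measurable P_complete B_bm t_part mz (YZ_scheme _ mz)).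
apply: (@le_trans _ _ ((c * (4 * e))%:E + \sum_(i < n) ((t i.+1 - t i) * (c * (4 * e)))%:E)%E).
  apply: leeD.
    apply: bigmax_le => [|i _]; first by rewrite lee_fin mulr_ge0//; lra.
    have ni : (i <= n)%N by rewrite -ltnS.
    apply: bound.
    rewrite (@expectation_sqr_ae _ _ _ P P_complete _ (fun w => Y i xi w - Y i xi' w)); first exact: HY.
      by apply: measurable_funB; exact: mY.
    have := scrYE _ _ ni mxi'; have := scrYE _ _ ni mxi.
    by apply: filterS2 => w -> ->.
  apply: lee_sum => i _; have [mz sz] := HZ i (ltn_ord i).
  have ni : (i <= n)%N by exact: ltnW.
  have tS : t i <= t i.+1 by case: t_part => _ _ tS; exact/ltW/tS.
  rewrite (@integral_cst_itv _ _ _ P P_complete _ _ _ (fun w => enorm (Z i xi w - Z i xi' w)))//.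
    by rewrite EFinM lee_wpmul2l ?lee_fin ?subr_ge0//; exact: bound.
  have := scrZE _ _ ni mxi'; have := scrZE _ _ ni mxi.
  by apply: filterS2 => w -> ->.
rewrite sumEFin -EFinD lee_fin -mulr_suml.
have -> : \sum_(i < n) (t i.+1 - t i) = T.
  by rewrite -(big_mkord xpredT (fun i => t i.+1 - t i)) telescope_sumr// tn t0 subr0.
rewrite le_eqVlt; apply/orP; left; apply/eqP; rewrite /e; field.
by apply/andP; split; lra.
Qed.
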